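(* Let $\mathbb{V}=(\mathbb{U},S,p:S\to A)$ be a 1-analysable cover of $\mathbb{U}$ over a 0-definable set $A$ satisfying: (Uniform Finite Generatedness) for each integer $n\ge 1$, the language of $(\mathbb{U},S_{\overline c})$ is finitely generated over that of $\mathbb{U}$, uniformly for $\overline c\in A^{=n}$; (Local Stable Embeddedness) for each finite $C\subseteq A$, the structure $(\mathbb{U},\bigcup_{a\in C}S_a)$, with the structure induced by the $C$-definable sets of $(\mathbb{U},S)$, is stably embedded in $(\mathbb{U},S)$. Let $\mathcal{G}(\mathbb{V})$ be the binding simplicial groupoid of $\mathbb{V}$, 0-definable in $\mathbb{U}$, and let $C\mathcal{G}(\mathbb{V})=(\mathbb{U},O_* )$ be the cover of $\mathbb{U}$ associated to the simplicial groupoid $\mathcal{G}(\mathbb{V})$. Then there exists an isomorphism of covers $\eta_{\mathbb{V}}:\mathbb{V}\simeq C\mathcal{G}(\mathbb{V})$.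
   Context: **Covers.** $\mathbb{U}$ is a saturated (i.e. $|\mathbb{U}|$-saturated) model of a complete theory $T$ admitting elimination of imaginaries; all theories considered are assumed to have saturated models in a common cardinality, and structures are taken saturated. ''0-definable'' means definable without parameters. If $T'$ is a complete extension of $T$, possibly with additional sorts, $\mathbb{U}'$ a saturated model of $T'$ and $\mathbb{U}=\mathbb{U}'|_T$, then $\mathbb{U}$ is stably embedded in $\mathbb{U}'$ if the restriction map $\mathrm{Aut}(\mathbb{U}')\to\mathrm{Aut}(\mathbb{U})$ is surjective; then $\mathbb{U}'$ is called a cover of $\mathbb{U}$ (and $T'$ a cover of $T$). The cover is internal if there are bijections, definable possibly with parameters, between the new sorts and definable sets of $\mathbb{U}$. A cover $(\mathbb{U},S)$ is 1-analysable over a 0-definable $A\subseteq\mathbb{U}$ if it is given with a 0-definable surjection $f:S\to A$ such that each fiber $S_a=f^{-1}(a)$ is internal to $\mathbb{U}$. $A^{=n}$ is the set of $n$-tuples of pairwise distinct elements of $A$; $E_n$ is the orbit equivalence relation of the symmetric group $\mathfrak{S}_n$ on $A^{=n}$ (so $A^{=n}/E_n$ is the set of $n$-element subsets of $A$); $A^{<\omega}$ is the collection of finite subsets of $A$. For a finite tuple or set $\overline c$ from $A$, $S_{\overline c}=\bigcup_{a\in\overline c}S_a$, and $(\mathbb{U},S_{\overline c})$ carries the structure induced by the $\overline c$-definable sets of $(\mathbb{U},S)$. $\mathrm{Aut}(S_{\overline c}/\mathbb{U})$ is the group of automorphisms of $(\mathbb{U},S_{\overline c})$ fixing $\mathbb{U}$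 pointwise, acting on $S_{\overline c}$. The language of $(\mathbb{U},S_{\overline c})$ is finitely generated over that of $\mathbb{U}$, uniformly for $\overline c\in A^{=n}$, if there are finitely many 0-definable relations $R_1(\overline x_1,y),\dots,R_k(\overline x_k,y)$ of $(\mathbb{U},S)$ such that for every $\overline c\in A^{=n}$ the relations $R_i(\overline x_i,\overline c)$ generate the language of $(\mathbb{U},S_{\overline c})$ over that of $\mathbb{U}$. **Morphisms of covers.** Given covers $\mathbb{V}_1=(\mathbb{U},S_1)$, $\mathbb{V}_2=(\mathbb{U},S_2)$, a morphism of covers $\mathbb{V}_1\to\mathbb{V}_2$ is the theory of a structure on $\mathbb{U}\cup(S_1\sqcup S_2)$ extending the structures of $\mathbb{V}_1$ and $\mathbb{V}_2$ by a distinguished 0-definable map $h:S_1\to S_2$, which is a cover of both $Th(\mathbb{V}_1)$ and $Th(\mathbb{V}_2)$; for 1-analysable covers over $A$, $h$ is required to commute with the maps to $A$. Composition is by composing the distinguished maps (and taking the induced structure); an isomorphism of covers is an invertible morphism, i.e. one whose map $h$ is bijective. **Groupoids.** A groupoid is a category in which all morphisms are invertible; it is connected if any two objects are isomorphic. A definable (concrete) groupoid is given by definable sets $O,I,M,R$ and a definable surjection $O\to I$, with fibers $O_i$ (the objects), where $R\subseteq M\times O\times O$ is such that for each $m\in M$ the set $R_m$ is the graph of a bijection $O_i\to O_j$ for some $i,j\in I$, distinct $m$ give distinct maps, and these bijections form a groupoid under composition. It is 0-definable if all data are 0-definable. For a 0-definable set $B$, a 0-definable groupoid over $B$ is a 0-definable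 groupoid with a 0-definable surjection $g:I\to B$ such that $O_i,O_j$ are in the same connected component iff $g(i)=g(j)$. A morphism $H:\mathcal{G}_1\to\mathcal{G}_2$ of groupoids over $B_1,B_2$, compatible with a definable relation $R\subseteq B_1\times B_2$, is a non-empty 0-definable family of definable maps from objects of $\mathcal{G}_1$ to objects of $\mathcal{G}_2$ such that: there is a map in $H$ from an object over $b_1$ to an object over $b_2$ iff $R(b_1,b_2)$; (A) for maps $h_p:O_{1,i}\to O_{2,j}$, $h_m:O_{1,k}\to O_{2,l}$ of $H$ lying over the same pair $(b_1,b_2)$, $h_p\circ\mathrm{Hom}_{\mathcal{G}_1}(O_{1,k},O_{1,i})=\mathrm{Hom}_{\mathcal{G}_2}(O_{2,l},O_{2,j})\circ h_m$; (B') $H$ is stable under precomposition with morphisms of $\mathcal{G}_1$ and postcomposition with morphisms of $\mathcal{G}_2$. Composition of morphisms of groupoids is given by the set of all composites of maps. **Simplicial groupoids.** A definable simplicial groupoid $\mathcal{G}$ over $A$ is a sequence of 0-definable groupoids $\mathcal{G}_n$ ($n\ge1$) with morphisms of groupoids $\iota_{n,m}:\mathcal{G}_n\to\mathcal{G}_m$ ($n<m$) such that: $\mathcal{G}_n$ is a groupoid over $A^{=n}/E_n$; $\iota_{n,m}\circ\iota_{k,n}=\iota_{k,m}$ for $k<n<m$; each $\iota_{n,m}$ is compatible with the relation $\overline c\subseteq\overline d$ and all of its maps (called inclusions) are injective. It has the disjoint union property if for every $\overline d\in A^{<\omega}$, every partition $c_1,\dots,c_k$ of $\overline d$, all objects $O_{\overline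 d},O_{c_1},\dots,O_{c_k}$ in the corresponding components and all inclusions $\iota_j:O_{c_j}\to O_{\overline d}$, the map $\iota_1\sqcup\dots\sqcup\iota_k$ is a bijection $O_{c_1}\sqcup\dots\sqcup O_{c_k}\to O_{\overline d}$. A commuting system of inclusions is a choice of one object $O_{i_{\overline c}}$ in each component ($\overline c\in A^{<\omega}$) and inclusions $\iota_{\overline c,\overline d}:O_{i_{\overline c}}\to O_{i_{\overline d}}$ for $\overline c\subset\overline d$, with $\iota_{\overline d,\overline e}\circ\iota_{\overline c,\overline d}=\iota_{\overline c,\overline e}$. **Binding simplicial groupoid.** $\mathcal{G}(\mathbb{V})$ and $\mathcal{G}'(\mathbb{V})$ denote simplicial groupoids over $A$, 0-definable in $\mathbb{U}$ and $\mathbb{V}^{eq}$ respectively, such that $\mathcal{G}'(\mathbb{V})$ extends $\mathcal{G}(\mathbb{V})$ by exactly one extra object $S_{\overline c}$ in the component over each $\overline c$, the set-theoretic inclusions $S_{\overline c}\hookrightarrow S_{\overline d}$ belong to the simplicial structure of $\mathcal{G}'(\mathbb{V})$, and $\mathrm{Aut}_{\mathcal{G}'(\mathbb{V})}(S_{\overline c})=\mathrm{Aut}(S_{\overline c}/\mathbb{U})$ as permutation groups of $S_{\overline c}$. (Such a pair exists, is finitely faithful – each object contains a finite tuple with trivial pointwise stabilizer in the groupoid automorphism group – and has the disjoint union property.) **Cover associated to a simplicial groupoid.** Let $\mathcal{G}$ be a finitely faithful 0-definable simplicial groupoid in $\mathbb{U}$ over $A$ with the disjoint union property. Choose a commuting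 system of inclusions $(O_{i_{\overline c}},\iota_{\overline c,\overline d})$. For $a\in A$ let $O_{*,a}$ be a copy of $O_{i_a}$, with a bijection $f_a:O_{*,a}\to O_{i_a}$. For $\overline c\in A^{<\omega}$ let $O_{*,\overline c}=\bigsqcup_{a\in\overline c}O_{*,a}$ and let $f_{\overline c}:O_{*,\overline c}\to O_{i_{\overline c}}$ be the bijection restricting to $\iota_{a,\overline c}\circ f_a$ on each $O_{*,a}$. Extend $\mathcal{G}$ to $\mathcal{G}'$ by adding the objects $O_{*,\overline c}$, taking as morphisms and inclusions all composites of those of $\mathcal{G}$ with the maps $f_{\overline c}^{\pm1}$. Form the extension of $\mathbb{U}$ with new sorts $O_*=\bigcup_{a\in A}O_{*,a}$ (with its map to $A$), $M^{(n)}_*$ (morphisms of $\mathcal{G}'_n$ involving new objects) and $N^{(i,j)}_*$ (inclusion maps of $\mathcal{G}'$ from degree $i$ to degree $j$ involving new objects), with relations interpreting elements of the latter sorts as maps. $C(\mathcal{G})$ is the structure induced on $(\mathbb{U},O_* )$; it is a cover of $\mathbb{U}$, independent of the choices up to isomorphism over $\mathbb{U}$. *)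

(* Defs.v *)
From mathcomp Require Import all_boot.
From mathcomp Require Import boolp classical_sets functions cardinality.

Set Implicit Arguments.
Unset Strict Implicit.
Unset Printing Implicit Defensive.

Local Open Scope classical_set_scope.
Local Open Scope card_scope.

(* The elements of all sorts are collected in one type [elt].  The language is
   part of the structure, and a complete theory T with saturated model U is
   represented by U itself. *)
Record structure := Structure {
  elt : Type;
  sorts : Type;
  sort_of : elt -> sorts;
  rel : Type;
  arity : rel -> seq sorts;
  interp : rel -> set (seq elt) }.

Definition tup (M : structure) := seq (elt M).

Definition typed (M : structure) (w : seq (sorts M)) : set (tup M) :=
  [set t | map (@sort_of M) t = w].

(* [interp r] is only meaningful on tuples of the sorts given by [arity r]. *)
Definition holds (M : structure) (r : rel M) : set (tup M) :=
  [set t | typed (arity r) t /\ interp r t].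

(* Formulas with de Bruijn variables; [All s] binds a variable of sort [s]. *)
Inductive formula (M : structure) : Type :=
| Eq of nat & nat
| Atom of rel M & seq nat
| Bot
| Imp of formula M & formula M
| All of sorts M & formula M.

Fixpoint sat (M : structure) (e : tup M) (phi : formula M) : Prop :=
  match phi with
  | Eq i j => exists x, onth e i = Some x /\ onth e j = Some x
  | Atom r v => exists2 t, map (onth e) v = map Some t & holds r t
  | Bot => False
  | Imp phi1 phi2 => sat e phi1 -> sat e phi2
  | All s phi1 => forall x, sort_of x = s -> sat (x :: e) phi1
  end.

(* D is a C-definable subset of the product of the sorts listed in w. *)
Definition definable (M : structure) (C : set (elt M)) (w : seq (sorts M))
    (D : set (tup M)) : Prop :=
  D `<=` typed w /\
  exists (phi : formula M) (c : tup M),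
    (forall i x, onth c i = Some x -> C x) /\
    forall t, typed w t -> (D t <-> sat (t ++ c) phi).

Definition definable2 (M : structure) (w1 w2 : seq (sorts M))
    (R : tup M -> tup M -> Prop) : Prop :=
  (forall x y, R x y -> typed w1 x /\ typed w2 y) /\
  definable set0 (w1 ++ w2) [set t | exists x y, t = x ++ y /\ R x y].

Definition definable3 (M : structure) (w1 w2 w3 : seq (sorts M))
    (R : tup M -> tup M -> tup M -> Prop) : Prop :=
  (forall x y z, R x y z -> [/\ typed w1 x, typed w2 y & typed w3 z]) /\
  definable set0 (w1 ++ w2 ++ w3)
    [set t | exists x y z, t = x ++ y ++ z /\ R x y z].

(* |M|-saturation: every finitely satisfiable set of formulas in one variable,
   with parameters in a set of cardinality < |M|, is realised. *)
Definition saturated (M : structure) : Prop :=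
  forall (C : set (elt M)) (s : sorts M) (Phi : set (formula M * tup M)),
    ~ ([set: elt M] #<= C) ->
    (forall f i x, Phi f -> onth f.2 i = Some x -> C x) ->
    (forall F, finite_set F -> F `<=` Phi ->
       exists x, sort_of x = s /\ forall f, F f -> sat (x :: f.2) f.1) ->
    exists x, sort_of x = s /\ forall f, Phi f -> sat (x :: f.2) f.1.

Definition automorphism (M : structure) (sigma : elt M -> elt M) : Prop :=
  [/\ bijective sigma,
      forall x, sort_of (sigma x) = sort_of x &
      forall (r : rel M) t, holds r (map sigma t) <-> holds r t].

Record eqrel (M : structure) := EqRel {
  eq_word : seq (sorts M);
  eq_rel : tup M -> tup M -> Prop;
  eq_definable : definable2 eq_word eq_word eq_rel;
  eqrel_refl : forall x, typed eq_word x -> eq_rel x x;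
  eqrel_sym : forall x y, eq_rel x y -> eq_rel y x;
  eqrel_trans : forall x y z, eq_rel x y -> eq_rel y z -> eq_rel x z }.

Definition eq_class (M : structure) (E : eqrel M) (x : tup M) : set (tup M) :=
  [set y | eq_rel E x y].

(* Every class of a 0-definable equivalence relation can be written F(-, b)
   with F 0-definable, for a unique tuple b. *)
Definition eliminates_imaginaries (M : structure) : Prop :=
  forall (E : eqrel M) (a : tup M), typed (eq_word E) a ->
  exists (w : seq (sorts M)) (F : tup M -> tup M -> Prop),
    definable2 (eq_word E) w F /\
    exists! b, typed w b /\ eq_class E a = [set x | F x b].

(* M^eq: one new sort for each 0-definable equivalence relation E, whose
   elements are the E-classes, with the graph of the projection to it. *)
Definition imaginary (M : structure) : Type :=
  {E : eqrel M & {c : set (tup M) |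
                  exists2 x, typed (eq_word E) x & c = eq_class E x}}.

Definition Meq (M : structure) : structure := {|
  elt := elt M + imaginary M;
  sorts := sorts M + eqrel M;
  sort_of x := match x with
               | inl x => inl (sort_of x)
               | inr c => inr (projT1 c)
               end;
  rel := rel M + eqrel M;
  arity r := match r with
             | inl r => map inl (arity r)
             | inr E => rcons (map inl (eq_word E)) (inr E)
             end;
  interp r := match r with
              | inl r => [set t | exists2 x, t = map inl x & interp r x]
              | inr E => [set t | exists x c,
                  t = rcons (map inl x) (inr (existT _ E c)) /\ sval c x]
              end |}.

Record extension (U : structure) (K : Type) := Extension {
  nelt : Type;
  nsort_of : nelt -> K;
  nrel : Type;
  narity : nrel -> seq (sorts U + K);
  ninterp : nrel -> set (seq (elt U + nelt)) }.

Definition extend (U : structure) (K : Type) (E : extension U K) : structure := {|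
  elt := elt U + nelt E;
  sorts := sorts U + K;
  sort_of x := match x with
               | inl x => inl (sort_of x)
               | inr y => inr (nsort_of y)
               end;
  rel := rel U + nrel E;
  arity r := match r with
             | inl r => map inl (arity r)
             | inr r => narity r
             end;
  interp r := match r with
              | inl r => [set t | exists2 x, t = map inl x & interp r x]
              | inr r => ninterp r
              end |}.
Coercion extend : extension >-> structure.

(* Every automorphism of N extends to W along the inclusion [emb]. *)
Definition stably_embedded (N W : structure) (emb : elt N -> elt W) : Prop :=
  forall tau, automorphism tau ->
  exists2 sigma, automorphism sigma & forall x, sigma (emb x) = emb (tau x).

Definition is_cover (N W : structure) (emb : elt N -> elt W) : Prop :=
  saturated W /\ stably_embedded emb.

(* The subset Y of M with the structure induced by the C-definable sets. *)
Definition induced (M : structure) (Y C : set (elt M)) : structure := {|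
  elt := {x : elt M | Y x};
  sorts := sorts M;
  sort_of x := sort_of (sval x);
  rel := {w : seq (sorts M) & {D : set (tup M) | definable C w D}};
  arity r := projT1 r;
  interp r := [set t | sval (projT2 r) (map sval t)] |}.

Definition entries (T : Type) (c : set (seq T)) : set T :=
  [set x | exists2 a, c a & exists i, onth a i = Some x].

(* A^{=n} and A^{=n}/E_n. *)
Definition distinct_tuples (T : Type) (A : set T) (n : nat) : set ('I_n -> T) :=
  [set a | injective a /\ forall i, A (a i)].

Definition nsubsets (T : Type) (A : set T) (n : nat) : set (set T) :=
  [set c | c `<=` A /\ c #= `I_n].

Section OneAnalysable.
Variables (U : structure) (Aw : seq (sorts U)) (A : set (tup U)).
Variables (V : extension U unit) (p : nelt V -> tup U).

Definition internal_set (X : set (nelt V)) : Prop :=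
  exists (w : seq (sorts U)) (D : set (tup U)) (f : nelt V -> tup U),
    [/\ definable [set: elt U] w D,
        set_bij X D f &
        definable (M := V) [set: elt V] (inr tt :: map inl w)
          [set t | exists2 s, X s & t = inr s :: map inl (f s)]].

Definition one_analysable : Prop :=
  [/\ range p = A,
      definable (M := V) set0 (inr tt :: map inl Aw)
        [set t | exists s, t = inr s :: map inl (p s)] &
      forall a, A a -> internal_set [set s | p s = a]].

(* The part of V lying in U together with S_c. *)
Definition over_part (c : set (tup U)) : set (elt V) :=
  [set x | match x with inl _ => True | inr s => c (p s) end].

Definition params (c : set (tup U)) : set (elt V) := [set inl x | x in entries c].

(* (U, S_c) *)
Definition over_structure (c : set (tup U)) : structure :=
  induced (over_part c) (params c).

(* Aut(S_c / U), each element being given by its graph on S_c. *)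
Definition Aut_over (c : set (tup U)) : set (nelt V -> nelt V -> Prop) :=
  [set f | exists sigma : elt (over_structure c) -> elt (over_structure c),
    [/\ automorphism sigma,
        (forall x u, sval x = inl u -> sigma x = x) &
        forall s s', f s s' <->
          exists2 x, sval x = inr s & sval (sigma x) = inr s']].

(* U together with S_c, with the language of U and the relations R_i(-, c). *)
Definition generated (n k : nat) (c : 'I_n -> tup U)
    (w : 'I_k -> seq (sorts V)) (R : 'I_k -> tup V -> tup V -> Prop) : structure := {|
  elt := {x : elt V | over_part (range c) x};
  sorts := sorts V;
  sort_of x := sort_of (sval x);
  rel := rel U + 'I_k;
  arity r := match r with
             | inl r => map inl (arity r)
             | inr i => w i
             end;
  interp r := match r with
              | inl r => [set t | exists2 x, map sval t = map inl x & interp r x]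
              | inr i => [set t | R i (map sval t) (map inl (flatten (codom c)))]
              end |}.

Definition uniformly_finitely_generated : Prop :=
  forall n, (0 < n)%N ->
  exists (k : nat) (w : 'I_k -> seq (sorts V)) (R : 'I_k -> tup V -> tup V -> Prop),
    (forall i, definable2 (M := V) (w i) (map inl (flatten (nseq n Aw))) (R i)) /\
    forall c : 'I_n -> tup U, distinct_tuples A c ->
    forall v (D : set (tup V)), definable (M := V) (params (range c)) v D ->
      definable (M := generated c w R) set0 v [set t | D (map sval t)].

(* Elements of C are named in the induced structure, so the extension of an
   automorphism of (U, S_C) to V automatically fixes C. *)
Definition locally_stably_embedded : Prop :=
  forall C : set (tup U), finite_set C -> C `<=` A ->
    @stably_embedded (over_structure C) V sval.

End OneAnalysable.

Section CoverMorphisms.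
Variables (U : structure) (T : Type) (V1 V2 : extension U unit).
Variables (q1 : nelt V1 -> T) (q2 : nelt V2 -> T) (h : nelt V1 -> nelt V2).

(* [false] and [true] stand for the sorts S1 and S2. *)
Definition join_sort1 (s : sorts V1) : sorts U + bool :=
  match s with inl s => inl s | inr _ => inr false end.
Definition join_sort2 (s : sorts V2) : sorts U + bool :=
  match s with inl s => inl s | inr _ => inr true end.
Definition join_emb1 (x : elt V1) : elt U + (nelt V1 + nelt V2) :=
  match x with inl u => inl u | inr s => inr (inl s) end.
Definition join_emb2 (x : elt V2) : elt U + (nelt V1 + nelt V2) :=
  match x with inl u => inl u | inr s => inr (inr s) end.

(* U with S1 and S2, the structures of V1 and V2, and the graph of h. *)
Definition join : extension U bool := {|
  nelt := nelt V1 + nelt V2;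
  nsort_of x := match x with inl _ => false | inr _ => true end;
  nrel := nrel V1 + nrel V2 + unit;
  narity r := match r with
              | inl (inl r) => map join_sort1 (narity r)
              | inl (inr r) => map join_sort2 (narity r)
              | inr _ => [:: inr false; inr true]
              end;
  ninterp r := match r with
               | inl (inl r) =>
                   [set t | exists2 x, t = map join_emb1 x & ninterp r x]
               | inl (inr r) =>
                   [set t | exists2 x, t = map join_emb2 x & ninterp r x]
               | inr _ => [set t | exists s, t = [:: inr (inl s); inr (inr (h s))]]
               end |}.

Definition cover_morphism : Prop :=
  [/\ forall s, q2 (h s) = q1 s,
      @is_cover V1 join join_emb1 &
      @is_cover V2 join join_emb2].

Definition cover_isomorphism : Prop := cover_morphism /\ bijective h.

End CoverMorphisms.

Definition gcomp (X Y Z : Type) (g : Y -> Z -> Prop) (f : X -> Y -> Prop) :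
    X -> Z -> Prop := fun x z => exists2 y, f x y & g y z.

Definition gconv (X Y : Type) (f : X -> Y -> Prop) : Y -> X -> Prop :=
  fun y x => f x y.

Definition gid (X : Type) (P : set X) : X -> X -> Prop := fun x y => P x /\ x = y.

Definition is_map (X Y : Type) (P : set X) (Q : set Y) (f : X -> Y -> Prop) : Prop :=
  (forall x y, f x y -> P x /\ Q y) /\ forall x, P x -> exists! y, f x y.

Definition is_injection (X Y : Type) (P : set X) (Q : set Y)
    (f : X -> Y -> Prop) : Prop :=
  is_map P Q f /\ forall x x' y, f x y -> f x' y -> x = x'.

Definition is_bijection (X Y : Type) (P : set X) (Q : set Y)
    (f : X -> Y -> Prop) : Prop :=
  is_map P Q f /\ is_map Q P (gconv f).

Definition gtransport (X X' Y Y' : Type) (P : set X) (Q : set Y)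
    (u : X -> X') (v : Y -> Y') (f : X -> Y -> Prop) : X' -> Y' -> Prop :=
  fun x' y' => exists x y, [/\ P x, Q y, x' = u x, y' = v y & f x y].

Definition fiber (X Y : Type) (P : set X) (f : X -> Y) (y : Y) : set X :=
  [set x | P x /\ f x = y].

Record groupoid (M : structure) := Groupoid {
  Ow : seq (sorts M);
  Iw : seq (sorts M);
  Mw : seq (sorts M);
  Obj : set (tup M);
  Idx : set (tup M);
  Mor : set (tup M);
  idx : tup M -> tup M;
  Graph : tup M -> tup M -> tup M -> Prop;
  object i := fiber Obj idx i;
  Hom (i j : tup M) : set (tup M -> tup M -> Prop) :=
    [set f | exists2 m, Mor m & f = Graph m /\ is_bijection (object i) (object j) f];
  Obj_definable : definable set0 Ow Obj;
  Idx_definable : definable set0 Iw Idx;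
  Mor_definable : definable set0 Mw Mor;
  idx_definable : definable2 Ow Iw (fun o i => Obj o /\ i = idx o);
  idx_surj : idx @` Obj = Idx;
  Graph_definable : definable3 Mw Ow Ow Graph;
  Graph_dom : forall m x y, Graph m x y -> [/\ Mor m, Obj x & Obj y];
  Graph_bij : forall m, Mor m -> exists i j,
    [/\ Idx i, Idx j & is_bijection (object i) (object j) (Graph m)];
  Graph_inj : forall m m', Mor m -> Mor m' -> Graph m = Graph m' -> m = m';
  Hom_id : forall i, Idx i -> Hom i i (gid (object i));
  Hom_comp : forall i j k f g, Idx i -> Idx j -> Idx k ->
    Hom i j f -> Hom j k g -> Hom i k (gcomp g f);
  Hom_inv : forall i j f, Idx i -> Idx j -> Hom i j f -> Hom j i (gconv f) }.

(* A groupoid over A^{=n}/E_n; the projection g is required to be 0-definable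
   through its graph in I x A^{=n}. *)
Record groupoid_over (M : structure) (Aw : seq (sorts M)) (A : set (tup M))
    (n : nat) := GroupoidOver {
  gpd :> groupoid M;
  base : tup M -> set (tup M);
  base_surj : base @` Idx gpd = nsubsets A n;
  base_definable : definable2 (Iw gpd) (flatten (nseq n Aw))
    (fun i t => exists2 a : 'I_n -> tup M, distinct_tuples A a &
       [/\ Idx gpd i, t = flatten (codom a) & base i = range a]);
  base_connected : forall i j, Idx gpd i -> Idx gpd j ->
    ((exists f, Hom gpd i j f) <-> base i = base j) }.

(* Non-emptiness of the family is not a separate field: by [fam_over] it holds
   as soon as Rel is non-empty, and when A is finite and the base of G2 is empty
   there is nothing to require.  [fam_hom] is the equality
   h_p o Hom_G1(O_k, O_i) = Hom_G2(O_l, O_j) o h_m, and [fam_pre], [fam_post] are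
   the stability of the family under composition with morphisms. *)
Record groupoid_morphism (M : structure) (Aw : seq (sorts M)) (A : set (tup M))
    (n1 n2 : nat) (G1 : groupoid_over Aw A n1) (G2 : groupoid_over Aw A n2)
    (Rel : set (tup M) -> set (tup M) -> Prop) := GroupoidMorphism {
  Fw : seq (sorts M);
  Fam : set (tup M);
  FGraph : tup M -> tup M -> tup M -> Prop;
  maps (i j : tup M) : set (tup M -> tup M -> Prop) :=
    [set f | exists2 q, Fam q & f = FGraph q /\ is_map (object G1 i) (object G2 j) f];
  Fam_definable : definable set0 Fw Fam;
  FGraph_definable : definable3 Fw (Ow G1) (Ow G2) FGraph;
  FGraph_dom : forall q x y, FGraph q x y -> Fam q;
  FGraph_map : forall q, Fam q -> exists i j,
    [/\ Idx G1 i, Idx G2 j & is_map (object G1 i) (object G2 j) (FGraph q)];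
  fam_over : forall b1 b2, nsubsets A n1 b1 -> nsubsets A n2 b2 ->
    ((exists i j f, [/\ Idx G1 i, Idx G2 j, base G1 i = b1, base G2 j = b2 &
                        maps i j f]) <-> Rel b1 b2);
  fam_hom : forall i j k l hp hm,
    Idx G1 i -> Idx G2 j -> Idx G1 k -> Idx G2 l ->
    base G1 i = base G1 k -> base G2 j = base G2 l ->
    maps i j hp -> maps k l hm ->
    [set gcomp hp u | u in Hom G1 k i] = [set gcomp v hm | v in Hom G2 l j];
  fam_pre : forall i i' j f u, Idx G1 i -> Idx G1 i' -> Idx G2 j ->
    maps i j f -> Hom G1 i' i u -> maps i' j (gcomp f u);
  fam_post : forall i j j' f v, Idx G1 i -> Idx G2 j -> Idx G2 j' ->
    maps i j f -> Hom G2 j j' v -> maps i j' (gcomp v f) }.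

(* Degrees start at 1 on paper and are shifted here: [sgpd n] is the groupoid
   over the subsets of A with n.+1 elements. *)
Record simplicial_groupoid (M : structure) (Aw : seq (sorts M))
    (A : set (tup M)) := SimplicialGroupoid {
  sgpd : forall n : nat, groupoid_over Aw A n.+1;
  incl : forall n m, (n < m)%N ->
    groupoid_morphism (sgpd n) (sgpd m) (fun c d => c `<=` d);
  incl_inj : forall n m (nm : (n < m)%N) i j f,
    Idx (sgpd n) i -> Idx (sgpd m) j -> maps (incl nm) i j f ->
    is_injection (object (sgpd n) i) (object (sgpd m) j) f;
  incl_comp : forall k n m (kn : (k < n)%N) (nm : (n < m)%N) (km : (k < m)%N) i j f,
    Idx (sgpd k) i -> Idx (sgpd m) j ->
    (maps (incl km) i j f <->
     exists l f1 f2, [/\ Idx (sgpd n) l, maps (incl kn) i l f1,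
                        maps (incl nm) l j f2 & f = gcomp f2 f1]) }.

(* One object [cobj c] in the component over each non-empty finite subset c of A,
   and inclusions [cinc c d] for c strictly contained in d. *)
Record commuting_system (M : structure) (Aw : seq (sorts M)) (A : set (tup M))
    (G : simplicial_groupoid Aw A) := CommutingSystem {
  cobj : set (tup M) -> tup M;
  cinc : set (tup M) -> set (tup M) -> (tup M -> tup M -> Prop);
  cobj_over : forall n c, nsubsets A n.+1 c ->
    Idx (sgpd G n) (cobj c) /\ base (sgpd G n) (cobj c) = c;
  cinc_incl : forall n m (nm : (n < m)%N) c d,
    nsubsets A n.+1 c -> nsubsets A m.+1 d -> c `<=` d ->
    maps (incl G nm) (cobj c) (cobj d) (cinc c d);
  cinc_comp : forall k n m c d e, (k < n)%N -> (n < m)%N ->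
    nsubsets A k.+1 c -> nsubsets A n.+1 d -> nsubsets A m.+1 e ->
    c `<=` d -> d `<=` e -> gcomp (cinc d e) (cinc c d) = cinc c e }.

Section Binding.
Variables (U : structure) (Aw : seq (sorts U)) (A : set (tup U)).
Variables (V : extension U unit) (p : nelt V -> tup U).

Definition eq_word_of (w : seq (sorts U)) : seq (sorts (Meq V)) :=
  map (fun s => inl (inl s)) w.
Definition eq_tup (a : tup U) : tup (Meq V) := map (fun x => inl (inl x)) a.

(* G' extends G by exactly one object S_c over each c.  As the objects of a
   groupoid are disjoint and are tuples of fixed sorts, this is expressed up to
   0-definable identifications: [eO] and [eI] embed the objects and indices of
   G in those of G', [new c] is the index of the added object over c, and
   [theta] identifies that object with S_c. *)
Record binding_pair (G : simplicial_groupoid Aw A)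
    (G' : simplicial_groupoid (eq_word_of Aw) (eq_tup @` A))
    (eO eI : nat -> tup U -> tup (Meq V))
    (new : set (tup U) -> tup (Meq V))
    (theta : nat -> tup (Meq V) -> nelt V) : Prop := BindingPair {
  eO_definable : forall n, definable2 (eq_word_of (Ow (sgpd G n))) (Ow (sgpd G' n))
    (fun x y => exists2 o, Obj (sgpd G n) o & x = eq_tup o /\ y = eO n o);
  eI_definable : forall n, definable2 (eq_word_of (Iw (sgpd G n))) (Iw (sgpd G' n))
    (fun x y => exists2 i, Idx (sgpd G n) i & x = eq_tup i /\ y = eI n i);
  eO_inj : forall n, set_inj (Obj (sgpd G n)) (eO n);
  eI_inj : forall n, set_inj (Idx (sgpd G n)) (eI n);
  old_object : forall n i, Idx (sgpd G n) i ->
    object (sgpd G' n) (eI n i) = eO n @` object (sgpd G n) i;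
  old_base : forall n i, Idx (sgpd G n) i ->
    base (sgpd G' n) (eI n i) = eq_tup @` base (sgpd G n) i;
  old_hom : forall n i j, Idx (sgpd G n) i -> Idx (sgpd G n) j ->
    Hom (sgpd G' n) (eI n i) (eI n j) =
    [set gtransport (object (sgpd G n) i) (object (sgpd G n) j) (eO n) (eO n) f
       | f in Hom (sgpd G n) i j];
  old_incl : forall n m (nm : (n < m)%N) i j,
    Idx (sgpd G n) i -> Idx (sgpd G m) j ->
    maps (incl G' nm) (eI n i) (eI m j) =
    [set gtransport (object (sgpd G n) i) (object (sgpd G m) j) (eO n) (eO m) f
       | f in maps (incl G nm) i j];
  Idx_ext : forall n,
    Idx (sgpd G' n) = eI n @` Idx (sgpd G n) `|` new @` nsubsets A n.+1;
  new_fresh : forall n c, nsubsets A n.+1 c -> ~ (eI n @` Idx (sgpd G n)) (new c);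
  new_base : forall n c, nsubsets A n.+1 c ->
    base (sgpd G' n) (new c) = eq_tup @` c;
  new_object : forall n c, nsubsets A n.+1 c ->
    set_bij (object (sgpd G' n) (new c)) [set s | c (p s)] (theta n);
  theta_definable : forall n, definable2 (Ow (sgpd G' n)) [:: inl (inr tt)]
    (fun x y => exists2 c, nsubsets A n.+1 c &
       object (sgpd G' n) (new c) x /\ y = [:: inl (inr (theta n x))]);
  new_incl : forall n m (nm : (n < m)%N) c d,
    nsubsets A n.+1 c -> nsubsets A m.+1 d -> c `<=` d ->
    maps (incl G' nm) (new c) (new d)
      (fun x y => [/\ object (sgpd G' n) (new c) x,
                      object (sgpd G' m) (new d) y & theta n x = theta m y]);
  new_Aut : forall n c, nsubsets A n.+1 c ->
    [set gtransport (object (sgpd G' n) (new c)) (object (sgpd G' n) (new c))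
           (theta n) (theta n) f | f in Hom (sgpd G' n) (new c) (new c)]
    = Aut_over p c }.

Definition is_binding (G : simplicial_groupoid Aw A) : Prop :=
  exists G' eO eI new theta, @binding_pair G G' eO eI new theta.

End Binding.

Section AssociatedCover.
Variables (U : structure) (Aw : seq (sorts U)) (A : set (tup U)).
Variables (G : simplicial_groupoid Aw A) (Q : commuting_system G).

(* The disjoint union of the copies O_{*,a} of O_{i_a}: its elements are the
   pairs (a, x) with a in A and x in O_{i_a}. *)
Definition Ostar : Type :=
  {y : tup U * tup U | A y.1 /\ object (sgpd G 0) (cobj Q [set y.1]) y.2}.

Definition star_proj (y : Ostar) : tup U := (sval y).1.

(* Graph of f_c : O_{*,c} -> O_{i_c} *)
Definition star_map (c : set (tup U)) : Ostar -> tup U -> Prop := fun y o =>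
  let: (a, x) := sval y in
  c a /\ ((c = [set a] /\ o = x) \/ (c <> [set a] /\ cinc Q [set a] c x o)).

(* Objects of G' in a given degree: [inl i] is O_i and [inr c] is O_{*,c}. *)
Definition is_index (n : nat) (k : tup U + set (tup U)) : Prop :=
  match k with inl i => Idx (sgpd G n) i | inr c => nsubsets A n.+1 c end.
Definition is_new (X Y : Type) (k : X + Y) : bool :=
  match k with inl _ => false | inr _ => true end.
Definition under (k : tup U + set (tup U)) : tup U :=
  match k with inl i => i | inr c => cobj Q c end.

Definition to_under (n : nat) (k : tup U + set (tup U)) : tup U + Ostar -> tup U -> Prop :=
  fun x o => match k, x with
             | inl i, inl x => gid (object (sgpd G n) i) x o
             | inr c, inr y => star_map c y o
             | _, _ => False
             end.

(* Morphisms of G'_n, and inclusions of G' from degree n to degree m, that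
   involve a new object. *)
Definition star_hom (n : nat) : set (tup U + Ostar -> tup U + Ostar -> Prop) :=
  [set f | exists k l u,
    [/\ is_index n k, is_index n l, is_new k || is_new l,
        Hom (sgpd G n) (under k) (under l) u &
        f = gcomp (gconv (to_under n l)) (gcomp u (to_under n k))]].

Definition star_incl (n m : nat) : set (tup U + Ostar -> tup U + Ostar -> Prop) :=
  [set f | exists (nm : (n < m)%N) k l u,
    [/\ is_index n k, is_index m l, is_new k || is_new l,
        maps (incl G nm) (under k) (under l) u &
        f = gcomp (gconv (to_under m l)) (gcomp u (to_under n k))]].

(* The new sorts O_*, M_*^(n) and N_*^(n,m). *)
Inductive star_sort : Type := sO | sM of nat | sN of nat & nat.

Inductive star_elt : Type :=
| xO of Ostar
| xM (n : nat) of {f | star_hom n f}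
| xN (n m : nat) of {f | star_incl n m f}.

(* The booleans tell whether the domain, respectively the codomain, is new. *)
Inductive star_rel : Type :=
| rproj
| rM of nat & bool & bool
| rN of nat & nat & bool & bool.

Definition side_word (n : nat) (b : bool) : seq (sorts U + star_sort) :=
  if b then [:: inr sO] else map inl (Ow (sgpd G n)).
Definition point (x : tup U + Ostar) : seq (elt U + star_elt) :=
  match x with inl x => map inl x | inr y => [:: inr (xO y)] end.

Definition star_extension : extension U star_sort := {|
  nelt := star_elt;
  nsort_of x := match x with
                | xO _ => sO
                | xM n _ => sM n
                | xN n m _ => sN n m
                end;
  nrel := star_rel;
  narity r := match r with
              | rproj => inr sO :: map inl Aw
              | rM n b1 b2 => inr (sM n) :: side_word n b1 ++ side_word n b2
              | rN n m b1 b2 => inr (sN n m) :: side_word n b1 ++ side_word m b2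
              end;
  ninterp r := match r with
    | rproj => [set t | exists y, t = inr (xO y) :: map inl (star_proj y)]
    | rM n b1 b2 => [set t | exists (f : {f | star_hom n f}) x y,
        [/\ t = inr (xM f) :: point x ++ point y,
            is_new x = b1, is_new y = b2 & sval f x y]]
    | rN n m b1 b2 => [set t | exists (f : {f | star_incl n m f}) x y,
        [/\ t = inr (xN f) :: point x ++ point y,
            is_new x = b1, is_new y = b2 & sval f x y]]
    end |}.

Definition star_embed (x : elt U + Ostar) : elt star_extension :=
  match x with inl u => inl u | inr y => inr (xO y) end.
Definition star_embed_sort (s : sorts U + unit) : sorts star_extension :=
  match s with inl s => inl s | inr _ => inr sO end.

(* C(G): the structure induced on U together with O_*. *)
Definition associated_cover : extension U unit := {|
  nelt := Ostar;
  nsort_of _ := tt;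
  nrel := {w : seq (sorts U + unit) & {D : set (tup star_extension) |
             definable set0 (map star_embed_sort w) D}};
  narity r := projT1 r;
  ninterp r := [set t | sval (projT2 r) (map star_embed t)] |}.

End AssociatedCover.

(* Main.v *)
Require Import Defs.
From mathcomp Require Import all_boot finmap.
From mathcomp Require Import boolp classical_sets functions cardinality wochoice.
From Stdlib Require List Inverse_Image.

(* The objects S_c (with their inclusions) and the chosen objects O_c (with the
   inclusions of the commuting system) are two systems of objects of the binding
   groupoids G' over the finite subsets c of A.  A transfinite induction along an
   initial well-order of A, using the saturation of V at each step, glues morphisms
   S_a -> O_a into a bijection eta : S -> O_* whose restriction to every S_c is a
   morphism S_c -> O_c of G'.

   Through eta the sorts of morphisms and inclusions that define C(G) are interpreted
   in V^eq, so that every relation of C(G) is 0-definable in V.  Hence U with both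
   covers and eta is interpreted in V: it is saturated, and automorphisms of V extend
   to it.

   Conversely let tau be an automorphism of C(G).  Correcting it by an automorphism of
   V extending its restriction to U, one may assume that tau fixes U pointwise.  Given a
   tuple y of O_{*,c} and a morphism f : O_{*,c} -> O_c, the 0-definable relation "some
   morphism maps y to f(y)" is preserved, so that some morphism O_{*,c} -> O_{*,c} maps y
   to tau(y).  It comes from an element of Aut(S_c/U), which preserves the relations of V
   on S_c; therefore so does tau. *)

Set Implicit Arguments.
Unset Strict Implicit.
Unset Printing Implicit Defensive.
Local Open Scope classical_set_scope.
Local Open Scope card_scope.

(** * Cardinals and transfinite choice *)

(** The groupoid axioms control only finite sets of points: for infinite [A] no single morphism of
    [G'] trivialises all of [S], and values at [a] chosen for different finite sets need not agree.
    At a new point [a], each finite set [c] of earlier points leaves a non-empty set of admissible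
    morphisms, definable in [V^eq] over finitely many parameters, and these sets decrease as [c]
    grows. Saturation gives a common element as long as fewer than [|V|] parameters occur in all.
    This is why every initial segment of the order must be smaller than [A], why the cardinality of
    the finite lists over an infinite set is needed, and why a finite segment, where one condition
    implies all others, is treated apart. Saturation of [V] concerns one variable of a real sort,
    while morphisms are tuples of imaginaries; interpretations carry the conditions down to [V]. The
    same notion serves again for the relations of [C(G)], whose definitions may quantify over the
    auxiliary sorts of morphisms and inclusions. *)

Lemma In_onth T (x : T) (l : seq T) : List.In x l <-> exists i, onth l i = Some x.
Proof.
elim: l => [|y l IH] /=; first by split=> // -[[]].
rewrite IH; split=> [[->|[i ?]]|[[|i] /= ?]]; [by exists 0|by exists i.+1| |].
  by left; congruence.
by right; exists i.
Qed.

Lemma finite_list T (A : set T) :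
  finite_set A <-> exists l, A = [set x | List.In x l].
Proof.
elim/Peq: T => T in A *; rewrite finite_seqP.
have E (s : seq T) x : (x \in s) <-> List.In x s.
  elim: s => //= y s IH; rewrite inE; split=> [/orP[/eqP->|/IH]|[->|/IH->]];
    rewrite ?eqxx ?orbT; auto.
by split=> -[s ->]; exists s; apply/seteqP; split=> x /=; apply E.
Qed.

(** With relations instead of functions, an injection on [A] can be given without values outside
    [A], and without a default element when [U] is empty. *)
Lemma card_leE T U (A : set T) (B : set U) :
  A #<= B <-> exists r : T -> U -> Prop,
    (forall x, A x -> exists2 y, B y & r x y) /\
    (forall x x' y, A x -> A x' -> r x y -> r x' y -> x = x').
Proof.
split.
  move=> /card_leP[f]; exists (fun x y => exists h : x \in A, sval (f (SigSub h)) = y).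
  split=> [x Ax|x x' y _ _ [h hy] [h' h'y]].
    have h : x \in A by rewrite inE.
    exists (sval (f (SigSub h))); last by exists h.
    by have := svalP (f (SigSub h)); rewrite /= inE.
  have : f (SigSub h) = f (SigSub h') by apply: val_inj; rewrite /= hy -h'y.
  by move=> /inj /= => /(_ (mem_set I) (mem_set I)) [].
elim/Ppointed: U => U in B *.
  move=> [r [rA _]]; have -> : A = set0.
    by apply/seteqP; split=> x // Ax; have [y] := rA x Ax; case: (no y).
  exact: card_ge0.
move=> [r [rA rinj]].
have /choice[f fP] : forall x, exists y, A x -> B y /\ r x y.
  move=> x; have [Ax|nAx] := pselect (A x); last by exists point.
  by have [y By rxy] := rA x Ax; exists y.
apply/pcard_leP/injfunPex; exists f => [x /fP[]//|x x'].
rewrite !inE => Ax Ax' e; apply: (rinj x x' (f x)) => //; first exact: (fP _ Ax).2.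
by rewrite e; exact: (fP _ Ax').2.
Qed.

Lemma card_le_fun T U (A : set T) (B : set U) (f : T -> U) :
  (forall x, A x -> B (f x)) -> (forall x y, A x -> A y -> f x = f y -> x = y) ->
  A #<= B.
Proof.
move=> fAB finj; apply/card_leE; exists (fun x y => f x = y).
split=> [x Ax|x x' y Ax Ax' <- e]; first by exists (f x); first exact: fAB.
exact: finj.
Qed.

Lemma total_on_subset2 T (F : set (set T)) (u v : T) :
  total_on F subset -> (\bigcup_(X in F) X) u -> (\bigcup_(X in F) X) v ->
  exists2 X, F X & X u /\ X v.
Proof.
by move=> tF [X FX Xu] [Y FY Yv]; have [XY|YX] := tF X Y FX FY;
  [exists Y; auto|exists X; auto].
Qed.

Lemma card_le_total T U (A : set T) (B : set U) : A #<= B \/ B #<= A.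
Proof.
pose P (g : set (T * U)) := g `<=` A `*` B /\ forall u v, g u -> g v ->
  (u.1 = v.1 <-> u.2 = v.2).
have [F FP tF|g [[gAB ginj] gmax]] := @Zorn_bigcup _ P.
  split=> [u [X FX Xu]|u v uF vF]; first exact: (FP _ FX).1.
  by have [X FX [Xu Xv]] := total_on_subset2 tF uF vF; exact: (FP _ FX).2.
have [Adom|] := pselect (forall x, A x -> exists y, g (x, y)).
  left; apply/card_leE; exists (fun x y => g (x, y)); split=> [x /Adom[y gxy]|].
    by exists y => //; exact: (gAB _ gxy).2.
  by move=> x x' y _ _ gx gx'; exact: (ginj _ _ gx gx').2.
move=> /existsNP[x /not_implyP[Ax nx]].
have [Bdom|] := pselect (forall y, B y -> exists x, g (x, y)).
  right; apply/card_leE; exists (fun y x => g (x, y)); split=> [y /Bdom[x' gxy]|].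
    by exists x' => //; exact: (gAB _ gxy).1.
  by move=> y y' x' _ _ gx gx'; exact: (ginj _ _ gx gx').1.
move=> /existsNP[y /not_implyP[By ny]].
case: (gmax (g `|` [set (x, y)])).
  split=> [u ?|/(_ (x, y))]; first by left.
  by move=> /(_ (or_intror erefl)) gxy; apply: nx; exists y.
split=> [u [/gAB//|->//]|[u1 u2] [v1 v2] [gu|[-> ->]] [gv|[-> ->]] //=].
- exact: (ginj _ _ gu gv).
- by split=> e; [case: nx; exists u2; rewrite -e|case: ny; exists u1; rewrite -e].
- by split=> e; [case: nx; exists v2; rewrite e|case: ny; exists v1; rewrite e].
Qed.

(* Zorn's lemma on the graphs of injections S x S -> S with S infinite in B: if S is
   maximal, B \ S cannot contain a copy of S, so that B #<= S x S #<= S. *)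
Lemma card_square T (B : set T) : infinite_set B -> B `*` B #<= B.
Proof.
move=> /infiniteP /card_leE[r [rB rinj]].
have /choice[e eP] : forall n, exists y, B y /\ r n y.
  by move=> n; have [y] := rB n I; exists y.
have einj : injective e.
  by move=> n m nm; apply: (rinj n m (e n)) => //; [exact: (eP n).2|rewrite nm; exact: (eP m).2].
have [pr prinj] : exists pr : nat * nat -> nat, injective pr.
  by exists choice.pickle; exact: pcan_inj choice.pickleK.
(* A set [g] of triples stands for a total injective relation from pairs in [supp g] to [supp g];
   the set [supp g] is read off the diagonal. *)
pose supp (g : set (T * T * T)) := [set x | exists z, g (x, x, z)].
pose P (g : set (T * T * T)) := [/\ supp g `<=` B,
  (forall x y z, g (x, y, z) -> [/\ supp g x, supp g y & supp g z]),
  (forall x y, supp g x -> supp g y -> exists z, g (x, y, z)) &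
  (forall u v, g u -> g v -> u.2 = v.2 -> u.1 = v.1)].
(* The starting point is the copy [e] of the integers in [B] with the pairing [pr]. Asking for [P]
   of the union with [g0] keeps this copy in the maximal element, so that [S] is infinite. *)
pose g0 : set (T * T * T) := [set u | exists n m, u = (e n, e m, e (pr (n, m)))].
have P0 : P g0.
  have s0 n : supp g0 (e n) by exists (e (pr (n, n))); exists n, n.
  have s0' x : supp g0 x -> exists n, x = e n by move=> [z [n [m [-> _ _]]]]; exists n.
  split=> [x /s0'[n ->]|x y z [n [m [-> -> ->]]]|x y /s0'[n ->] /s0'[m ->]|].
  - exact: (eP n).1.
  - by split; exact: s0.
  - by exists (e (pr (n, m))); exists n, m.
  - by move=> u v [n [m ->]] [n' [m' ->]] /= /einj /prinj [-> ->].
have [F FP tF|g [Pg gmax]] := @Zorn_bigcup _ [set g | P (g0 `|` g)].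
  have lift u v : (g0 `|` \bigcup_(X in F) X) u -> (g0 `|` \bigcup_(X in F) X) v ->
      exists g, [/\ g `<=` g0 `|` \bigcup_(X in F) X, P g, g u & g v].
    have sub X : F X -> g0 `|` X `<=` g0 `|` \bigcup_(X in F) X.
      by move=> FX w [?|?]; [left|right; exists X].
    move=> [g0u|Fu] [g0v|Fv].
    - by exists g0; split=> // w; left.
    - have [X FX Xv] := Fv; exists (g0 `|` X).
      by split; [exact: sub|exact: FP|left|right].
    - have [X FX Xu] := Fu; exists (g0 `|` X).
      by split; [exact: sub|exact: FP|right|left].
    - have [X FX [Xu Xv]] := total_on_subset2 tF Fu Fv; exists (g0 `|` X).
      by split; [exact: sub|exact: FP|right|right].
  have lifts (g : set (T * T * T)) : g `<=` g0 `|` \bigcup_(X in F) X ->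
      supp g `<=` supp (g0 `|` \bigcup_(X in F) X).
    by move=> gs x [z /gs]; exists z.
  split=> [x [z xz]|x y z xyz|x y [z xz] [z' yz']|u v gu gv].
  - by have [g [gs [gB _ _ _] gx _]] := lift _ _ xz xz; apply: gB; exists z.
  - have [g [gs [_ gS _ _] gx _]] := lift _ _ xyz xyz.
    by have [? ? ?] := gS _ _ _ gx; split; apply: (lifts _ gs).
  - have [g [gs [_ _ gS _] gx gy]] := lift _ _ xz yz'.
    have [w gw] := gS x y (ex_intro _ _ gx) (ex_intro _ _ gy).
    by exists w; apply: gs.
  - have [h [_ [_ _ _ hi] hu hv]] := lift _ _ gu gv; exact: hi.
have {gmax} gmax h : P h -> g0 `|` g `<` h -> False.
  move=> Ph [gh nhg]; apply: (gmax h); last first.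
    by rewrite /= (_ : g0 `|` h = h) //; apply/setUidPr => u ?; apply: gh; left.
  split=> [u gu|hg]; first by apply: gh; right.
  by apply: nhg => u /hg; right.
have g00 : g0 `<=` g0 `|` g by move=> u; left.
have {}Pg : P (g0 `|` g) by [].
move: (g0 `|` g) Pg g00 gmax => {}g [gB gS gD ginj] g00 gmax.
set S := supp g in gB gS gD.
have Se n : S (e n) by exists (e (pr (n, n))); apply: g00; exists n, n.
have /choice[J0 J0P] : forall u : T * T, exists z, S u.1 -> S u.2 -> g (u, z).
  move=> [x y]; have [Sx|] := pselect (S x); last by exists (e 0).
  have [Sy|] := pselect (S y); last by exists (e 0).
  by have [z gz] := gD x y Sx Sy; exists z.
pose J x y := J0 (x, y).
have JS x y : S x -> S y -> S (J x y).
  by move=> Sx Sy; have [] := gS _ _ _ (J0P (x, y) Sx Sy).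
have Jinj x y x' y' : S x -> S y -> S x' -> S y' -> J x y = J x' y' ->
    x = x' /\ y = y'.
  move=> Sx Sy Sx' Sy' ee.
  by have [] := ginj _ _ (J0P (x, y) Sx Sy) (J0P (x', y') Sx' Sy') ee.
have e01 : e 0 <> e 1 by move/einj.
have e02 : e 0 <> e 2 by move/einj.
have e12 : e 1 <> e 2 by move/einj.
have SS : S `*` S #<= S.
  apply: (@card_le_fun _ _ _ _ J0) => [[x y] [Sx Sy]|[x y] [x' y']]; first exact: JS.
  move=> [/= Sx Sy] [/= Sx' Sy'] ee.
  by have [-> ->] := Jinj _ _ _ _ Sx Sy Sx' Sy' ee.
(* If [S] embeds by [f] in its complement, the relation extends to the union [S'] of [S] and its
   image: pairs outside [S x S] are sent into the image, against maximality. *)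
have [/card_leE[q [qB qinj]]|/card_leE[q [qB qinj]]] := card_le_total S (B `\` S).
  have /choice[f fP] : forall x, exists y, S x -> (B `\` S) y /\ q x y.
    move=> x; have [Sx|] := pselect (S x); last by exists x.
    by have [y] := qB x Sx; exists y.
  have finj x y : S x -> S y -> f x = f y -> x = y.
    move=> Sx Sy fxy; apply: (qinj x y (f x)) => //; first exact: (fP x Sx).2.
    by rewrite fxy; exact: (fP y Sy).2.
  pose S' := S `|` f @` S.
  pose cd x (b : bool) y := S y /\ x = if b then f y else y.
  have cdS x b y : cd x b y -> S' x.
    by case: b => -[Sy ->]; [right; exists y|left].
  have cdE x : S' x -> exists b y, cd x b y.
    by move=> [Sx|[y Sy <-]]; [exists false, x|exists true, y].
  have cdI x b y b' y' : cd x b y -> cd x b' y' -> b = b' /\ y = y'.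
    move=> [Sy ->] [Sy' xe]; case: b b' xe => -[] // xe; first by split=> //; apply: finj.
      by have [[_ []]] := fP y Sy; rewrite xe.
    by have [[_ []]] := fP y' Sy'; rewrite -xe.
  (* The three blocks of pairs with an entry in the image of [f] are kept apart by the three
     distinct elements [e 0], [e 1], [e 2]. *)
  pose tag (b1 b2 : bool) := if b1 && b2 then e 2 else if b1 then e 1 else e 0.
  have tagS b1 b2 : S (tag b1 b2) by case: b1 b2 => -[]; exact: Se.
  have tagI b1 b2 b1' b2' : b1 || b2 -> b1' || b2' -> tag b1 b2 = tag b1' b2' ->
     b1 = b1' /\ b2 = b2'.
    by case: b1 b2 b1' b2' => [] [] [] [] //= _ _ ?; exfalso; auto.
  pose h : set (T * T * T) := g `|` [set u | exists b1 b2 y1 y2,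
    [/\ b1 || b2, cd u.1.1 b1 y1, cd u.1.2 b2 y2 &
        u.2 = f (J (tag b1 b2) (J y1 y2))]].
  have hS : supp h = S'.
    apply/seteqP; split=> [x [z [gx|[b1 [b2 [y1 [y2 [_ c1 _ _]]]]]]]|x].
    - by left; exists z.
    - exact: cdS c1.
    - move=> [[z gx]|[y Sy <-]]; first by exists z; left.
      exists (f (J (tag true true) (J y y))); right.
      by exists true, true, y, y.
  exfalso; apply: (gmax h); last first.
    split=> [u ?|hg]; first by left.
    have /hg/gS[Sf _ _] : h (f (e 0), f (e 0), f (J (tag true true) (J (e 0) (e 0)))).
      by right; exists true, true, (e 0), (e 0).
    by have [[_ []]] := fP _ (Se 0).
  rewrite /P hS; split.
  - by move=> x [/gB//|[y Sy <-]]; have [[]] := fP y Sy.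
  - move=> x y z [/gS[? ? ?]|]; first by split; left.
    move=> [b1 [b2 [y1 [y2 [_ c1 c2 /= ->]]]]]; split; [exact: cdS c1|exact: cdS c2|].
    by right; exists (J (tag b1 b2) (J y1 y2)) => //; apply: (JS) => //; apply: (JS);
      [case: c1|case: c2].
  - move=> x y /cdE[b1 [y1 c1]] /cdE[b2 [y2 c2]].
    have [b12|] := boolP (b1 || b2).
      by exists (f (J (tag b1 b2) (J y1 y2))); right; exists b1, b2, y1, y2.
    case: b1 b2 c1 c2 => -[] // [Sy1 ->] [Sy2 ->] _.
    by have [z gz] := gD _ _ Sy1 Sy2; exists z; left.
  - move=> [[x1 x2] z] [[x1' x2'] z'] + + /= zz; rewrite -{}zz {z'} => -[gz|].
      move=> [gz'|]; first exact: (ginj _ _ gz gz').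
      move=> [b1 [b2 [y1 [y2 [_ [Sy1 _] [Sy2 _] /= ze]]]]].
      have [_ _] := gS _ _ _ gz; rewrite ze.
      by have [[_ +]] := fP _ (JS _ _ (tagS b1 b2) (JS _ _ Sy1 Sy2)).
    move=> [b1 [b2 [y1 [y2 [b12 /= c1 c2 ->]]]]].
    have Sy1 : S y1 by case: c1. have Sy2 : S y2 by case: c2.
    have Jy := JS _ _ Sy1 Sy2.
    move=> [/gS[_ _]|].
      by have [[_ +]] := fP _ (JS _ _ (tagS b1 b2) Jy).
    move=> [b1' [b2' [y1' [y2' [b12' /= [Sy1' ->] [Sy2' ->] ee]]]]].
    have Jy' := JS _ _ Sy1' Sy2'.
    have [te Je] := Jinj _ _ _ _ (tagS _ _) Jy (tagS _ _) Jy'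
      (finj _ _ (JS _ _ (tagS _ _) Jy) (JS _ _ (tagS _ _) Jy') ee).
    have [<- <-] := tagI _ _ _ _ b12 b12' te.
    have [<- <-] := Jinj _ _ _ _ Sy1 Sy2 Sy1' Sy2' Je.
    by case: c1 => _ ->; case: c2 => _ ->.
(* [B] is [S] and its complement, which now embeds in [S]; the second coordinates [e 0] and [e 1]
   separate the two pieces inside [S x S]. *)
have BS : B #<= S.
  apply: card_le_trans SS; apply/card_leE.
  exists (fun x u => (S x /\ u = (x, e 0)) \/ (~ S x /\ q x u.1 /\ u.2 = e 1)).
  split=> [x Bx|x x' [u1 u2] Bx Bx' /=].
    have [Sx|nSx] := pselect (S x); first by exists (x, e 0); [split=> //=|left].
    by have [y Sy qxy] := qB x (conj Bx nSx); exists (y, e 1); [split=> //=|right].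
  move=> [[Sx [-> ->]]|[nSx [qx ->]]] [[Sx' []]|[nSx' [qx' ee]]] //.
    by move=> _ /esym.
  exact: (qinj x x' u1).
apply: card_le_trans (card_le_trans _ SS) (subset_card_le gB).
have /card_leE[k [kS kinj]] := BS; apply/card_leE.
exists (fun u v => k u.1 v.1 /\ k u.2 v.2); split=> [[x y] [/= Bx By]|].
  by have [x' ? ?] := kS _ Bx; have [y' ? ?] := kS _ By; exists (x', y').
move=> [x y] [x' y'] [z t] [/= Bx By] [/= Bx' By'] [/= ? ?] [/= ? ?].
by congr pair; [apply: (kinj _ _ z)|apply: (kinj _ _ t)].
Qed.

(** A list is folded into one element by the pairing of [card_square]; the fold is injective on
    lists of a given length, so the length is coded beside it. The extra integer serves as a
    position in a list or as a tag. *)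
Lemma card_seq T (B : set T) : infinite_set B ->
  [set l : seq T | forall x, List.In x l -> B x] `*` [set: nat] #<= B.
Proof.
move=> Binf; have /card_leE[r [rB rinj]] := card_square Binf.
have /infiniteP /card_leE[s [sB sinj]] := Binf.
have /choice[e eP] : forall n, exists y, B y /\ s n y.
  by move=> n; have [y] := sB n I; exists y.
have einj n m : e n = e m -> n = m.
  by move=> nm; apply: (sinj n m (e n)) => //; [exact: (eP n).2|rewrite nm; exact: (eP m).2].
have /choice[J0 J0P] : forall u, exists z, (B `*` B) u -> B z /\ r u z.
  move=> u; have [Bu|] := pselect ((B `*` B) u); last by exists (e 0).
  by have [z] := rB u Bu; exists z.
pose J x y := J0 (x, y).
have JB x y : B x -> B y -> B (J x y).
  by move=> Bx By; have [] := J0P (x, y) (conj Bx By).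
have Jinj x y x' y' : B x -> B y -> B x' -> B y' -> J x y = J x' y' ->
    x = x' /\ y = y'.
  move=> Bx By Bx' By' ee.
  have [_ r1] := J0P (x, y) (conj Bx By); have [_ r2] := J0P (x', y') (conj Bx' By').
  have : (x, y) = (x', y') by apply: (rinj _ _ (J x y)) => //; rewrite ee.
  by case.
pose fd (l : seq T) := foldr J (e 0) l.
have fdB l : (forall x, List.In x l -> B x) -> B (fd l).
  elim: l => [_|x l IH Bl]; first exact: (eP 0).1.
  by apply: JB; [apply: Bl; left|apply: IH => y yl; apply: Bl; right].
have fdinj l l' : (forall x, List.In x l -> B x) -> (forall x, List.In x l' -> B x) ->
    size l = size l' -> fd l = fd l' -> l = l'.
  elim: l l' => [|x l IH] [|x' l'] //= Bl Bl' [sl] /Jinj[].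
  - by apply: Bl; left.
  - by apply: fdB => y yl; apply: Bl; right.
  - by apply: Bl'; left.
  - by apply: fdB => y yl; apply: Bl'; right.
  move=> -> /IH-> // y yl; [apply: Bl|apply: Bl']; auto.
have eB n : B (e n) by exact: (eP n).1.
apply: (@card_le_fun _ _ _ _ (fun u => J (e u.2) (J (e (size u.1)) (fd u.1)))).
  by move=> [l n] [/= Bl _]; apply: (JB) => //; apply: (JB) => //; apply: fdB.
move=> [l n] [l' n'] [/= Bl _] [/= Bl' _].
have b1 := fdB _ Bl; have b2 := fdB _ Bl'.
move=> /Jinj[]; [exact: eB|by apply: JB|exact: eB|by apply: JB|].
move=> /einj-> /Jinj[] // /einj sl fl; congr pair; exact: fdinj.
Qed.

(** This bounds the parameters of conditions indexed by the finite lists over an initial segment: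
    each one is located by a list and a position. *)
Lemma card_bigcup_seq T U (B : set T) (g : seq T -> seq U) : infinite_set B ->
  [set y | exists2 l, (forall x, List.In x l -> B x) & List.In y (g l)] #<= B.
Proof.
move=> /card_seq; apply: card_le_trans; apply/card_leE.
exists (fun y u => onth (g u.1) u.2 = Some y); split; last by move=> ? ? ? _ _ -> [].
by move=> y [l Bl /In_onth[i li]]; exists (l, i).
Qed.

(** Used contrapositively: a small parameter set stays small when one realised coordinate is added
    to it. *)
Lemma infinite_setU1 T U (A : set T) (C : set U) x : infinite_set A ->
  A #<= x |` C -> A #<= C.
Proof.
move=> Ainf AC; have Cinf : infinite_set C.
  by apply: contra_not Ainf => Cf; apply: card_le_finite AC _; rewrite finite_setU.
apply: card_le_trans AC _; apply: card_le_trans _ (card_seq Cinf).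
apply/card_leE; exists (fun y u => (C y /\ u = ([:: y], 0)) \/ (~ C y /\ u = ([::], 0))).
split=> [y|y y' u].
  have [Cy|nCy] := pselect (C y); last first.
    by exists ([::], 0); [split|right].
  by exists ([:: y], 0); [split=> // z [<-|//]|left].
move=> xy xy' [[_ ->]|[ny ->]] [[_ []]|[ny' _]] //.
by case: xy xy' => [->|//] [->|//].
Qed.

Lemma card_prod_bool T U (A : set T) : infinite_set A -> [set: U] #<= A ->
  [set: U * bool] #<= A.
Proof.
move=> Ainf /card_leE[r [rA rinj]]; apply: card_le_trans (card_seq Ainf).
apply/card_leE; exists (fun x u => exists2 y, r x.1 y & u = ([:: y], nat_of_bool x.2)).
split=> [[x b] _|[x b] [x' b'] u _ _ [y /= rx ->] [y' /= rx' [ye be]]].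
  have [y Ay rxy] := rA x I; exists ([:: y], nat_of_bool b); last by exists y.
  by split=> // z [<-|//].
subst y'; have -> : x = x' by apply: (rinj x x' y).
by case: b b' be => -[].
Qed.

(* If x is least such that X injects into its initial segment, pulling the order back
   along this injection makes all initial segments strictly smaller than X. *)
Lemma initial_well_order (X : Type) : exists R : X -> X -> Prop,
  [/\ well_founded R, (forall x y, x = y \/ R x y \/ R y x),
      (forall x y z, R x y -> R y z -> R x z) &
      forall x, ~ ([set: X] #<= [set y | R y x])].
Proof.
elim/Peq: X => X.
have [R Rwo] := well_ordering_principle X.
have minR (P : set X) : P !=set0 -> exists2 z, P z & forall x, P x -> R z x.
  move=> [x Px]; have [|z [[zP zmin] _]] := Rwo [pred x | `[< P x >]].
    by exists x; apply/asboolP.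
  by exists z; [apply/asboolP|move=> y Py; apply: zmin; apply/asboolP].
have wch : wo_chain R predT by move=> A _; exact: Rwo.
have Rtot x y : R x y \/ R y x.
  by apply/orP; apply: (wo_chainW wch).
have Ranti x y : R x y -> R y x -> x = y.
  by move=> xy yx; apply: (wo_chain_antisymmetric wch) => //; rewrite xy yx.
have Rtrans x y z : R x y -> R y z -> R x z.
  move=> xy yz; have [|w wP wmin] := minR [set w | w = x \/ w = y \/ w = z].
    by exists x; left.
  have [we|[we|we]] := wP; subst w.
  - by apply: wmin; right; right.
  - by have -> : x = y by apply: Ranti => //; apply: wmin; left.
  - by have <- : y = z by apply: Ranti => //; apply: wmin; right; left.
pose Rs x y := R x y /\ x <> y.
have Rs_trans x y z : Rs x y -> Rs y z -> Rs x z.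
  move=> [xy nxy] [yz nyz]; split; first exact: Rtrans xy yz.
  by move=> xz; apply: nxy; apply: Ranti => //; rewrite xz.
have Rs_tot x y : x = y \/ Rs x y \/ Rs y x.
  have [->|/eqP n] := eqVneq x y; first by left.
  by right; have [?|?] := Rtot x y; [left|right]; split=> // /esym.
have Rs_wf : well_founded Rs.
  move=> x; apply: contrapT => nx.
  have [|z nz zmin] := minR [set x | ~ Acc Rs x]; first by exists x.
  apply: nz; constructor=> y [yz nyz]; apply: contrapT => ny.
  by apply: nyz; apply: Ranti => //; apply: zmin.
have [small|] := pselect (forall x, ~ ([set: X] #<= [set y | Rs y x])).
  by exists Rs.
move=> /existsNP[x0 /contrapT bx0].
have [|m /card_leE[k [km kinj]] mmin] := minR [set x | [set: X] #<= [set y | Rs y x]].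
  by exists x0.
have /choice[f fP] : forall x, exists y, Rs y m /\ k x y.
  by move=> x; have [y] := km x I; exists y.
have finj x y : f x = f y -> x = y.
  by move=> e; apply: (kinj x y (f x)) => //; [exact: (fP x).2|rewrite e; exact: (fP y).2].
exists (fun x y => Rs (f x) (f y)); split.
- exact: (Inverse_Image.wf_inverse_image _ _ Rs f).
- by move=> x y; have [/finj->|?] := Rs_tot (f x) (f y); auto.
- by move=> x y z; exact: Rs_trans.
(* An injection of [X] into a segment of the new order, followed by [f], would embed [X] below
   [f x], which lies strictly below the minimal [m]. *)
- move=> x /card_le_trans bx; have [[fm nfm] _] := fP x; apply: nfm.
  apply: Ranti => //; apply: mmin => /=; apply: bx.
  by apply: (@card_le_fun _ _ _ _ f) => // y z _ _; apply: finj.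
Qed.

(** * Transfinite recursion under conditions on finite sets *)

Section Transfinite.
Variables (X W : Type) (R : X -> X -> Prop).
Hypotheses (R_wf : well_founded R) (R_total : forall x y, x = y \/ R x y \/ R y x)
  (R_trans : forall x y z, R x y -> R y z -> R x z).

Definition update (f : X -> W) (x : X) (w : W) : X -> W :=
  fun y => if pselect (y = x) then w else f y.

Lemma finite_max (c : set X) : finite_set c -> c !=set0 ->
  exists x, c x /\ c `<=` x |` [set y | R y x].
Proof.
move=> /finite_list[l ->] {c}; elim: l => [[]//|x l IH] _.
have [l0|/set0P/IH[y [yl ly]]] := eqVneq [set y | List.In y l] set0.
  exists x; split; first by left.
  by move=> y [<-|yl]; [left|have : set0 y by rewrite -l0].
have [xy|[xy|yx]] := R_total x y.
- by exists y; split; [right|move=> z [<-|/ly//]; left].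
- by exists y; split; [right|move=> z [<-|/ly//]; right].
- exists x; split; first by left.
  by move=> z [<-|/ly[->|zy]]; [left|right|right; exact: R_trans zy yx].
Qed.

(** Conditions on finite sets suffice because a non-empty finite set is its largest element together
    with a finite set below it. Goodness on every initial segment then follows by well-founded
    induction, and passes to any finite set through its maximum. *)
Lemma transfinite_choice (w0 : W) (good : set X -> (X -> W) -> Prop) :
  (forall c f f', (forall x, c x -> f x = f' x) -> good c f -> good c f') ->
  (forall f, good set0 f) ->
  (forall x f, (forall c, finite_set c -> c `<=` [set y | R y x] -> good c f) ->
    exists w, forall c, finite_set c -> c `<=` [set y | R y x] ->
      good (x |` c) (update f x w)) ->
  exists f, forall c, finite_set c -> good c f.
Proof.
move=> good_ext good0 step.
(* The step function is made total with the value [w0] where its hypothesis fails, so that the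
   recursion can be defined before goodness is known. *)
have /choice[G GP] : forall u : X * (X -> W), exists w,
    (forall c, finite_set c -> c `<=` [set y | R y u.1] -> good c u.2) ->
    forall c, finite_set c -> c `<=` [set y | R y u.1] ->
      good (u.1 |` c) (update u.2 u.1 w).
  move=> [x f] /=.
  have [/step[w hw]|h] := pselect (forall c, finite_set c ->
    c `<=` [set y | R y x] -> good c f); by [exists w|exists w0].
pose below x (g : forall y, R y x -> W) y :=
  match pselect (R y x) with left h => g y h | right _ => w0 end.
pose F := Fix R_wf (fun _ => W) (fun x g => G (x, below x g)).
have FE x : F x = G (x, below x (fun y _ => F y)).
  rewrite /F Fix_eq // => y g g' gg'; congr (G (y, _)).
  by apply: funext => z; rewrite /below; case: pselect.
exists F.
have goodU x : (forall c, finite_set c -> c `<=` [set y | R y x] -> good c F) ->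
    forall c, finite_set c -> c `<=` [set y | R y x] -> good (x |` c) F.
  move=> H c cf cx; have := GP (x, below x (fun y _ => F y)) _ c cf cx.
  rewrite /= -FE => /(_ _)/good_ext; apply; last first.
    move=> c' c'f c'x; apply: good_ext (H c' c'f c'x) => y c'y.
    by rewrite /below; case: pselect => // /(_ (c'x y c'y)).
  move=> y; rewrite /update; case: pselect => [yx|nyx] [yx'|cy] //=; rewrite ?yx //.
  by rewrite /below; case: pselect => // /(_ (cx y cy)).
have split_max c : finite_set c -> c !=set0 -> exists x c',
    [/\ c x, c = x |` c', finite_set c' & c' `<=` [set y | R y x]].
  move=> cf c0; have [x [cx cR]] := finite_max cf c0.
  exists x, (c `&` [set y | R y x]); split=> //.
    by apply/seteqP; split=> [y cy|y [->|[]]//]; have [->|] := cR y cy; [left|right].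
  exact: (finite_setIl _ cf).
have main : forall x c, finite_set c -> c `<=` [set y | R y x] -> good c F.
  elim/(well_founded_ind R_wf) => x IH c cf cx.
  have [->//|/set0P/(split_max _ cf)[y [c' [cy -> c'f c'y]]]] := eqVneq c set0.
  by apply: goodU => //; apply: IH; exact: cx.
move=> c cf.
have [->//|/set0P/(split_max _ cf)[y [c' [cy -> c'f c'y]]]] := eqVneq c set0.
by apply: goodU => //; apply: main.
Qed.

End Transfinite.

(** * Definability and saturation *)

Section Definability.
Variable M : structure.
Implicit Types (e c t : tup M) (phi : formula M) (w : seq (sorts M))
  (W : seq (seq (sorts M))) (ts : seq (tup M)).

Definition lift_var (rho : nat -> nat) (n : nat) : nat :=
  if n is n'.+1 then (rho n').+1 else 0.

Fixpoint rename (rho : nat -> nat) phi : formula M :=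
  match phi with
  | Eq i j => Eq M (rho i) (rho j)
  | Atom r v => Atom r (map rho v)
  | Bot => Bot M
  | Imp phi1 phi2 => Imp (rename rho phi1) (rename rho phi2)
  | All s phi1 => All s (rename (lift_var rho) phi1)
  end.

Lemma sat_rename phi rho e e' : (forall i, onth e' (rho i) = onth e i) ->
  sat e' (rename rho phi) <-> sat e phi.
Proof.
elim: phi rho e e' => [i j|r v||phi1 IH1 phi2 IH2|s phi IH] rho e e' H //=.
- by rewrite !H.
- by rewrite -map_comp (eq_map H).
- by rewrite (IH1 _ _ _ H) (IH2 _ _ _ H).
- by split=> S x xs; apply/(IH (lift_var rho) (x :: e) (x :: e')); auto; case.
Qed.

(** The default [size e'] of [nth] is a variable without value in [e'], so the variables of [phi]
    beyond [e] remain without value after renaming. *)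
Lemma sat_vars phi e e' (v : seq nat) : map (onth e') v = map Some e ->
  sat e' (rename (nth (size e') v) phi) <-> sat e phi.
Proof.
move=> H; apply: sat_rename => i.
have sv : size v = size e by have := congr1 size H; rewrite !size_map.
have [iv|vi] := ltnP i (size v).
  by rewrite -(nth_map _ None) // H onthE.
by rewrite nth_default // !onth_default // -sv.
Qed.

Fixpoint allw w phi : formula M := if w is s :: w' then allw w' (All s phi) else phi.

Lemma sat_allw w phi e :
  sat e (allw w phi) <-> forall t, typed w t -> sat (t ++ e) phi.
Proof.
elim: w phi e => [|s w IH] phi e /=.
  by split=> [? [|//] _|/(_ [::] erefl)].
rewrite IH; split=> [H [|x t] //= [xs tw]|H t tw x xs]; first exact: (H t).
by apply: (H (x :: t)); rewrite /typed /= xs tw.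
Qed.

(** Contexts are lists of blocks of variables, one word of sorts for each block: a quantifier over
    tuples then adds a single block at the head. *)
Definition wt W ts := map (map (@sort_of M)) ts = W.

Lemma wt_shape W ts : wt W ts -> shape ts = shape W.
Proof. by move=> <-; rewrite /shape -map_comp; apply: eq_map => t; rewrite /= size_map. Qed.

Lemma wt_flatten W ts : wt W ts -> typed (flatten W) (flatten ts).
Proof. by move=> <-; rewrite /typed /= map_flatten. Qed.

Lemma wt_size W ts : wt W ts -> size (flatten ts) = size (flatten W).
Proof. by move=> /wt_shape; rewrite !size_flatten => ->. Qed.

Lemma wt_inj W ts ts' : wt W ts -> wt W ts' -> flatten ts = flatten ts' -> ts = ts'.
Proof.
move=> /wt_shape h /wt_shape h' ff.
by rewrite -(flattenK ts) -(flattenK ts') h h' ff.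
Qed.

Lemma wt_reshape W t : typed (flatten W) t -> exists ts, wt W ts /\ t = flatten ts.
Proof.
elim: W t => [|w W IH] t; first by case: t => // _; exists [::].
move=> tw; have [ts [tsW te]] : exists ts, wt W ts /\ drop (size w) t = flatten ts.
  by apply: IH; rewrite /typed /= map_drop tw drop_size_cat.
exists (take (size w) t :: ts); split; last by rewrite /= -te cat_take_drop.
by rewrite /wt /= tsW map_take tw take_size_cat.
Qed.

Lemma wt_cat W1 W2 ts : wt (W1 ++ W2) ts ->
  wt W1 (take (size W1) ts) /\ wt W2 (drop (size W1) ts).
Proof.
by move=> H; rewrite /wt map_take map_drop H take_size_cat // drop_size_cat.
Qed.

(* A term selects, from the blocks of variables ts and the parameters c, a tuple of
   sorts w by a fixed list of positions. *)
Definition term c W (f : seq (tup M) -> tup M) w := exists v : seq nat,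
  forall ts, wt W ts -> map (onth (flatten ts ++ c)) v = map Some (f ts) /\ typed w (f ts).

(** The closure properties of this notion under terms, connectives and quantifiers replace the
    writing of formulas with explicit de Bruijn indices. *)
Definition edef c W (P : seq (tup M) -> Prop) := exists phi,
  forall ts, wt W ts -> (P ts <-> sat (flatten ts ++ c) phi).

Lemma term_ext c W f g w : (forall ts, wt W ts -> f ts = g ts) ->
  term c W f w -> term c W g w.
Proof.
by move=> fg [v vP]; exists v => ts tsW; have := vP ts tsW; rewrite fg.
Qed.

Lemma map_onth_iota (T : Type) (a b : seq T) :
  map (onth (a ++ b)) (iota 0 (size a)) = map Some a.
Proof.
apply: (@eq_from_nth _ None) => [|i]; rewrite ?size_map ?size_iota // => ia.
by rewrite (nth_map 0) ?size_iota // nth_iota // add0n onth_cat ia onthE.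
Qed.

Lemma term_flatten c W : term c W flatten (flatten W).
Proof.
exists (iota 0 (size (flatten W))) => ts tsW; split; last exact: wt_flatten.
by rewrite -(wt_size tsW) map_onth_iota.
Qed.

Lemma term_take c W1 W2 f w : term c W1 f w ->
  term c (W1 ++ W2) (fun ts => f (take (size W1) ts)) w.
Proof.
move=> [v vP].
(* A position beyond the blocks of [W1] points to a parameter, and has to jump over the inserted
   blocks of [W2]. *)
exists (map (fun i => if i < size (flatten W1) then i else i + size (flatten W2)) v).
move=> ts /wt_cat[ts1 ts2]; have [<- fw] := vP _ ts1; split=> //.
rewrite -map_comp; apply: eq_map => i /=.
rewrite -{1}(cat_take_drop (size W1) ts) flatten_cat -catA !onth_cat.
rewrite (wt_size ts1) (wt_size ts2).
case: (ltnP i (size (flatten W1))) => [->//|ile].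
rewrite ltnNge (leq_trans ile) ?leq_addr //=.
by rewrite -addnBAC // ltnNge leq_addl /= addnK.
Qed.

Lemma term_drop c W1 W2 f w : term c W2 f w ->
  term c (W1 ++ W2) (fun ts => f (drop (size W1) ts)) w.
Proof.
move=> [v vP]; exists (map (addn (size (flatten W1))) v).
move=> ts /wt_cat[ts1 ts2]; have [<- fw] := vP _ ts2; split=> //.
rewrite -map_comp; apply: eq_map => i /=.
rewrite -{1}(cat_take_drop (size W1) ts) flatten_cat -catA onth_cat.
by rewrite (wt_size ts1) ltnNge leq_addr /= addKn.
Qed.

Lemma term_behead c w0 W f w : term c W f w ->
  term c (w0 :: W) (fun ts => f (behead ts)) w.
Proof.
move=> /(@term_drop c [:: w0]); apply: term_ext => ts _; by rewrite drop1.
Qed.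

Lemma term_head c w W : term c (w :: W) (head [::]) w.
Proof.
have /(@term_take c [:: w] W) := term_flatten c [:: w]; rewrite /= cats0.
apply: term_ext => -[|t ts] //= _; by rewrite take0 /= cats0.
Qed.

Lemma term_cat c W f g w w' : term c W f w -> term c W g w' ->
  term c W (fun ts => f ts ++ g ts) (w ++ w').
Proof.
move=> [v vP] [v' v'P]; exists (v ++ v') => ts tsW.
have [e1 t1] := vP ts tsW; have [e2 t2] := v'P ts tsW.
by rewrite !map_cat e1 e2 /typed /= map_cat t1 t2.
Qed.

Lemma term_cst c W d w : typed w d -> (forall x, List.In x d -> List.In x c) ->
  term c W (fun=> d) w.
Proof.
move=> dw dc; have [v vP] : exists v, map (onth c) v = map Some d.
  elim: d {dw} dc => [_|x d IH dc]; first by exists [::].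
  have [|v vP] := IH; first by move=> y yd; apply: dc; right.
  have /In_onth[i ci] : List.In x c by apply: dc; left.
  by exists (i :: v); rewrite /= ci vP.
exists (map (addn (size (flatten W))) v) => ts tsW; split=> //.
rewrite -vP -map_comp; apply: eq_map => i /=.
by rewrite onth_cat (wt_size tsW) ltnNge leq_addr /= addKn.
Qed.

Lemma edef_ext c W P Q : (forall ts, wt W ts -> (P ts <-> Q ts)) ->
  edef c W P -> edef c W Q.
Proof. by move=> PQ [phi H]; exists phi => ts tsW; rewrite -PQ // H. Qed.

Lemma edef_sat c W f w phi : term c W f w -> edef c W (fun ts => sat (f ts) phi).
Proof.
move=> [v vP]; exists (rename (nth (size (flatten W) + size c) v) phi) => ts tsW.
have [/(sat_vars phi) + _] := vP ts tsW; rewrite size_cat (wt_size tsW) => H.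
exact: iff_sym H.
Qed.

Lemma edef_definable c W f w D : definable [set x | List.In x c] w D ->
  term c W f w -> edef c W (fun ts => D (f ts)).
Proof.
move=> [Dw [phi [d [dc H]]]] tf.
have td : term c W (fun=> d) (map (@sort_of M) d).
  by apply: term_cst => // x /In_onth[i]; exact: dc.
apply: edef_ext (edef_sat phi (term_cat tf td)) => ts tsW.
by have [v vP] := tf; have [_ fw] := vP ts tsW; rewrite H.
Qed.

Lemma definable_sub (C C' : set (elt M)) w D : C `<=` C' ->
  definable C w D -> definable C' w D.
Proof.
move=> CC' [Dw [phi [d [dc H]]]]; split=> //; exists phi, d; split=> //.
by move=> i x /dc/CC'.
Qed.

Lemma edef_definable0 c W f w D : definable set0 w D ->
  term c W f w -> edef c W (fun ts => D (f ts)).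
Proof.
by move=> /(@definable_sub _ [set x | List.In x c])-/(_ (@sub0set _ _)); exact: edef_definable.
Qed.

Lemma typed_cat_inj w t1 t2 t3 t4 : typed w t1 -> typed w t3 ->
  t1 ++ t2 = t3 ++ t4 -> t1 = t3 /\ t2 = t4.
Proof.
move=> h1 h3; have /(congr1 size) : map (@sort_of M) t1 = map (@sort_of M) t3.
  by rewrite h1 h3.
rewrite !size_map => s e; split.
  by have := congr1 (take (size t1)) e; rewrite take_size_cat // s take_size_cat.
by have := congr1 (drop (size t1)) e; rewrite drop_size_cat // s drop_size_cat.
Qed.

Lemma term_typed c W f w ts : term c W f w -> wt W ts -> typed w (f ts).
Proof. by move=> [v vP] /vP[]. Qed.

Lemma edef_definable2 c W f g w w' R : definable2 w w' R ->
  term c W f w -> term c W g w' -> edef c W (fun ts => R (f ts) (g ts)).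
Proof.
move=> [Rw RD] tf tg; have := edef_definable0 RD (term_cat tf tg).
apply: edef_ext => ts tsW; split=> [[x [y [e Rxy]]]|]; last by exists (f ts), (g ts).
have [xw _] := Rw _ _ Rxy.
by have [-> ->] := typed_cat_inj (term_typed tf tsW) xw e.
Qed.

Lemma edef_definable3 c W f g h w w' w'' R : definable3 w w' w'' R ->
  term c W f w -> term c W g w' -> term c W h w'' ->
  edef c W (fun ts => R (f ts) (g ts) (h ts)).
Proof.
move=> [Rw RD] tf tg th; have := edef_definable0 RD (term_cat tf (term_cat tg th)).
apply: edef_ext => ts tsW; split=> [[x [y [z [e Rxyz]]]]|]; last first.
  by exists (f ts), (g ts), (h ts).
have [xw yw zw] := Rw _ _ _ Rxyz.
have [-> e'] := typed_cat_inj (term_typed tf tsW) xw e.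
by have [-> ->] := typed_cat_inj (term_typed tg tsW) yw e'.
Qed.

Lemma edef_imp c W P Q : edef c W P -> edef c W Q -> edef c W (fun ts => P ts -> Q ts).
Proof.
move=> [phi H] [psi K]; exists (Imp phi psi) => ts tsW /=.
by rewrite H // K.
Qed.

Lemma edef_false c W : edef c W (fun=> False).
Proof. by exists (Bot M). Qed.

Lemma edef_not c W P : edef c W P -> edef c W (fun ts => ~ P ts).
Proof. by move=> H; exact: edef_imp H (edef_false c W). Qed.

Lemma edef_true c W : edef c W (fun=> True).
Proof. by apply: edef_ext (edef_not (edef_false c W)) => ts _; split=> // _ []. Qed.

Lemma edef_and c W P Q : edef c W P -> edef c W Q -> edef c W (fun ts => P ts /\ Q ts).
Proof.
move=> HP HQ; apply: edef_ext (edef_not (edef_imp HP (edef_not HQ))) => ts _.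
split=> [H|[p q]]; last by move=> /(_ p).
by split; apply: contrapT => n; apply: H => p // q.
Qed.

Lemma edef_or c W P Q : edef c W P -> edef c W Q -> edef c W (fun ts => P ts \/ Q ts).
Proof.
move=> HP HQ; apply: edef_ext (edef_imp (edef_not HP) HQ) => ts _.
split=> [H|[p|q]]; [|by []|by []].
by have [p|/H] := pselect (P ts); [left|right].
Qed.

Lemma edef_iff c W P Q : edef c W P -> edef c W Q -> edef c W (fun ts => P ts <-> Q ts).
Proof. by move=> HP HQ; apply: edef_and; apply: edef_imp. Qed.

Lemma edef_all c W w (Q : seq (tup M) -> tup M -> Prop) :
  edef c (w :: W) (fun ts => Q (behead ts) (head [::] ts)) ->
  edef c W (fun ts => forall t, typed w t -> Q ts t).
Proof.
move=> [phi H]; exists (allw w phi) => ts tsW; rewrite sat_allw.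
split=> K t tw; first by rewrite catA; apply/(H (t :: ts)); [rewrite /wt /= tw tsW|exact: K].
by apply/(H (t :: ts)); [rewrite /wt /= tw tsW|rewrite /= -catA; exact: K].
Qed.

Lemma edef_ex c W w (Q : seq (tup M) -> tup M -> Prop) :
  edef c (w :: W) (fun ts => Q (behead ts) (head [::] ts)) ->
  edef c W (fun ts => exists t, typed w t /\ Q ts t).
Proof.
move=> /edef_not HQ; have := edef_not (edef_all (Q := fun ts t => ~ Q ts t) HQ).
apply: edef_ext => ts _; split=> [H|[t [tw Qt]] /(_ t tw)//].
by apply: contrapT => n; apply: H => t tw Qt; apply: n; exists t.
Qed.

Lemma edef_all_in c W (T : Type) (l : seq T) (P : T -> seq (tup M) -> Prop) :
  (forall x, List.In x l -> edef c W (P x)) ->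
  edef c W (fun ts => forall x, List.In x l -> P x ts).
Proof.
elim: l => [_|x l IH H]; first by apply: edef_ext (edef_true c W) => ts _; split.
have H1 : edef c W (fun ts => forall x, List.In x l -> P x ts).
  by apply: IH => y yl; apply: H; right.
apply: edef_ext (edef_and (H x (or_introl erefl)) H1) => ts _.
split=> [[Px Pl] y [<-|/Pl]//|K]; split; first by apply: K; left.
by move=> y yl; apply: K; right.
Qed.

(** The formula is a conjunction of equations between variables. It depends only on the two lists of
    positions, which are therefore generalised before the induction on the length. *)
Lemma edef_eq c W f g w : term c W f w -> term c W g w -> edef c W (fun ts => f ts = g ts).
Proof.
move=> tf tg; have [v vP] := tf; have [v' v'P] := tg.
suff [phi H] : exists phi, forall e (t t' : tup M),
    map (onth e) v = map Some t -> map (onth e) v' = map Some t' ->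
    size t = size w -> size t' = size w -> (t = t' <-> sat e phi).
  exists phi => ts tsW; have [h1 /(congr1 size) t1] := vP ts tsW.
  have [h2 /(congr1 size) t2] := v'P ts tsW; rewrite !size_map in t1 t2.
  by apply: H => //.
elim: (size w) v v' {tf tg vP v'P} => [|n IH] v v'.
  by exists (Imp (Bot M) (Bot M)) => e [|? ?] [|? ?] //=.
case: v => [|i v]; first by exists (Bot M) => e [].
case: v' => [|i' v']; first by exists (Bot M) => e [|? ?] [].
have [phi H] := IH v v'.
exists (Imp (Imp (Eq M i i') (Imp phi (Bot M))) (Bot M)) => e [|x t] [|x' t'] //=.
move=> [ei ev] [ei' ev'] [st] [st'].
have {}H := H e t t' ev ev' st st'.
rewrite -H; split=> [[xx tt'] K|K]; first by apply: K => //; exists x'; rewrite ei ei' xx.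
apply: contrapT => n'; apply: K => -[y []]; rewrite ei ei' => -[xy] [x'y] tt'.
by apply: n'; congruence.
Qed.

Lemma edef_definableI c W P : edef c W P ->
  definable [set x | List.In x c] (flatten W)
    [set t | exists ts, [/\ wt W ts, t = flatten ts & P ts]].
Proof.
move=> [phi H]; split=> [t [ts [tsW -> _]]|]; first exact: wt_flatten.
exists phi, c; split=> [i x ci|t /wt_reshape[ts [tsW ->]]].
  by apply/In_onth; exists i.
rewrite -(H ts tsW); split=> [[ts' [ts'W e Pts]]|Pts]; last by exists ts.
by rewrite (wt_inj tsW ts'W e).
Qed.

Lemma edef_definable0I W P : edef [::] W P ->
  definable set0 (flatten W) [set t | exists ts, [/\ wt W ts, t = flatten ts & P ts]].
Proof.
by move=> /edef_definableI; apply: definable_sub => x.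
Qed.

Lemma definable0_sat w D : definable set0 w D ->
  exists phi, forall t, typed w t -> (D t <-> sat t phi).
Proof.
move=> [_ [phi [[|x d] [dc H]]]]; last by case: (dc 0 x).
by exists phi => t tw; rewrite H // cats0.
Qed.

Lemma sat_automorphism sigma phi e : automorphism sigma ->
  sat (map sigma e) phi <-> sat e phi.
Proof.
move=> [[tau sK tK] ss sr]; elim: phi e => [i j|r v||phi1 IH1 phi2 IH2|s phi IH] e //=.
- rewrite !onth_map; split=> [[x []]|[x [-> ->]]]; last by exists (sigma x).
  case: (onth e i) => //= y [<-]; case: (onth e j) => //= z [/(can_inj sK)->].
  by exists y.
- split=> [[t vt ht]|[t vt ht]].
    have e1 : map (onth e) v = map Some (map tau t).
      have -> : map (onth e) v = map (omap tau) (map (onth (map sigma e)) v).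
        rewrite -map_comp; apply: eq_map => n /=; rewrite onth_map.
        by case: onth => //= x; rewrite sK.
      by rewrite vt -!map_comp.
    exists (map tau t) => //; apply/sr; rewrite -map_comp (eq_map (g := id)) ?map_id //.
  exists (map sigma t); last exact/sr.
  have -> : map (onth (map sigma e)) v = map (omap sigma) (map (onth e) v).
    by rewrite -map_comp; apply: eq_map => n /=; rewrite onth_map.
  by rewrite vt -!map_comp.
- by rewrite IH1 IH2.
- split=> H x xs; first by apply/IH; apply: H; rewrite ss.
  by rewrite -(tK x) -map_cons IH; apply: H; rewrite -ss tK.
Qed.

Lemma definable_automorphism sigma w D t : automorphism sigma -> definable set0 w D ->
  D (map sigma t) <-> D t.
Proof.
move=> sa Dw; have [phi H] := definable0_sat Dw; have [Dt _] := Dw.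
have [_ ss _] := sa.
have st : typed w (map sigma t) <-> typed w t.
  by rewrite /typed /= -map_comp (eq_map (g := @sort_of M)).
have [tw|ntw] := pselect (typed w t); last by split=> /Dt // /st.
by rewrite !H ?sat_automorphism //; apply/st.
Qed.

Lemma saturated_family (C : set (elt M)) s (J : Type) (F : J -> formula M * tup M) :
  saturated M -> ~ ([set: elt M] #<= C) ->
  (forall j x, List.In x (F j).2 -> C x) ->
  (forall l : seq J, exists x, sort_of x = s /\
     forall j, List.In j l -> sat (x :: (F j).2) (F j).1) ->
  exists x, sort_of x = s /\ forall j, sat (x :: (F j).2) (F j).1.
Proof.
move=> sat_M small FC fin.
have [|F' /finite_list[l ->] lF|x [xs H]] := sat_M C s (range F) small.
- by move=> f i x [j _ <-] h; apply: (FC j); apply/In_onth; exists i.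
- have [l' l'P] : exists l', forall f, List.In f l -> exists2 j, List.In j l' & F j = f.
    elim: l lF => [_|f l IH lF]; first by exists [::].
    have [|l' l'P] := IH; first by move=> g gl; apply: lF; right.
    have [j _ <-] := lF f (or_introl erefl).
    exists (j :: l') => g [<-|/l'P[k kl' <-]]; first by exists j => //; left.
    by exists k => //; right.
  have [x [xs H]] := fin l'; exists x; split=> // f /l'P[j jl' <-]; exact: H.
- by exists x; split=> // j; apply: H; exists j.
Qed.

Lemma directed_list (J : Type) (le : J -> J -> Prop) (j0 : J) :
  (forall j, le j j) -> (forall i j k, le i j -> le j k -> le i k) ->
  (forall j j', exists k, le k j /\ le k j') ->
  forall l : seq J, exists k, forall j, List.In j l -> le k j.
Proof.
move=> lexx letr dir; elim=> [|j l [k kl]]; first by exists j0.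
have [k' [k'j k'k]] := dir j k.
by exists k' => i [<-//|/kl]; exact: letr.
Qed.

(** Coordinates are realised one after the other: the first satisfies the projections of all the
    [D j], and then joins the parameters, which remain few because [M] is infinite. Directedness
    reduces finite satisfiability to the non-emptiness of each [D j]. *)
Lemma saturated_words w (C : set (elt M)) (J : Type) (j0 : J)
    (D : J -> tup M -> Prop) (c : J -> tup M) :
  saturated M -> infinite_set [set: elt M] -> ~ ([set: elt M] #<= C) ->
  (forall j x, List.In x (c j) -> C x) ->
  (forall j, edef (c j) [:: w] (fun ts => D j (head [::] ts))) ->
  (forall j j', exists k, forall t, typed w t -> D k t -> D j t /\ D j' t) ->
  (forall j, exists t, typed w t /\ D j t) ->
  exists t, typed w t /\ forall j, D j t.
Proof.
move=> satM infM.
elim: w C D c => [|s w IH] C D c small cC Ddef dir Dne.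
  by exists [::]; split=> // j; have [[|? ?] []] := Dne j.
have edefj j : edef (c j) [:: [:: s]]
    (fun ts => exists t, typed w t /\ D j (head [::] ts ++ t)).
  apply: edef_ex; have [phi H] := Ddef j.
  have th : term (c j) [:: w; [:: s]]
      (fun ts => (head [::] (behead ts) ++ head [::] ts) ++ c j)
      (([:: s] ++ w) ++ map (@sort_of M) (c j)).
    apply: term_cat; last exact: term_cst.
    by apply: term_cat; [apply: term_behead|]; exact: term_head.
  apply: edef_ext (edef_sat phi th) => -[|t [|t' [|]]] //= [tw t's].
  have := H [:: t' ++ t]; rewrite /= cats0 => ->//.
  by rewrite /wt /= map_cat t's tw.
have /choice[phi phiP] := edefj.
have [||x [xs xD]] := saturated_family (s := s) (F := fun j => (phi j, c j)) satM small.
- exact: cC.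
- have kP (l : seq J) : exists k, forall j, List.In j l ->
      forall t, typed (s :: w) t -> D k t -> D j t.
    apply: (directed_list (le := fun k j => forall t, typed (s :: w) t -> D k t -> D j t)) => //.
    + by move=> i j k ij jk t tw /(ij t tw)/(jk t tw).
    + by move=> j j'; have [k kP] := dir j j'; exists k; split=> t tw /(kP t tw)[].
  move=> l; have [k kl] := kP l; have [[|x t] [//= [xs tw] Dt]] := Dne k.
  exists x; split=> // j jl; apply/(phiP j [:: [:: x]]); first by rewrite /wt /= xs.
  exists t; split=> //; apply: (kl j jl) => //; by rewrite /typed /= xs tw.
have [|||||t [tw tD]] := IH (x |` C) (fun j t => D j (x :: t)) (fun j => x :: c j).
- by move=> bad; apply: small; apply: infinite_setU1 bad.
- by move=> j y [<-|/cC]; [left|right].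
- move=> j; have [psi H] := Ddef j.
  have th : term (x :: c j) [:: w]
      (fun ts => ([:: x] ++ head [::] ts) ++ c j) (([:: s] ++ w) ++ map (@sort_of M) (c j)).
    apply: term_cat; last by apply: term_cst => // y; right.
    apply: term_cat; last exact: term_head.
    by apply: term_cst; [rewrite /typed /= xs|move=> y [<-|//]; left].
  apply: edef_ext (edef_sat psi th) => -[|t [|]] //= [tw].
  have := H [:: x :: t]; rewrite /= cats0 => ->//.
  by rewrite /wt /= tw xs.
- move=> j j'; have [k kP] := dir j j'; exists k => t tw; apply: kP.
  by rewrite /typed /= xs tw.
- move=> j; have /(phiP j [:: [:: x]])/= := xD j; rewrite /wt /= xs => -[//|t [tw Dt]].
  by exists t.
by exists (x :: t); split=> //; rewrite /typed /= xs tw.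
Qed.

(** If every element of sort [s] refuted some formula of [Phi], one formula for each of the finitely
    many elements would give a finite subset that is not satisfied. *)
Lemma finite_saturated : finite_set [set: elt M] -> saturated M.
Proof.
move=> /finite_list[l lE] C s Phi _ _ fin; apply: contrapT => none.
have bad x : sort_of x = s -> exists2 f, Phi f & ~ sat (x :: f.2) f.1.
  move=> xs; apply: contrapT => K; apply: none; exists x; split=> // f Pf.
  by apply: contrapT => n; apply: K; exists f.
have [l' [l'Phi l'P]] : exists l', (forall f, List.In f l' -> Phi f) /\
    forall x, List.In x l -> sort_of x = s -> exists2 f, List.In f l' & ~ sat (x :: f.2) f.1.
  elim: l {lE} => [|x l [l' [l'Phi l'P]]]; first by exists [::].
  have [xs|nxs] := pselect (sort_of x = s); last first.
    by exists l'; split=> // y [<-//|]; exact: l'P.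
  have [f Pf nf] := bad x xs; exists (f :: l'); split; first by move=> g [<-|/l'Phi].
  move=> y [<- _|yl /(l'P y yl)[g gl' ng]]; first by exists f => //; left.
  by exists g => //; right.
have [|x [xs H]] := fin [set f | List.In f l'] _ l'Phi; first by apply/finite_list; exists l'.
have [f fl' nf] : exists2 f, List.In f l' & ~ sat (x :: f.2) f.1.
  apply: l'P => //; have : [set: elt M] x by [].
  by rewrite lE.
by apply: nf; apply: H.
Qed.

End Definability.

(** * Interpretations *)

(** Turns a tuple into a context of blocks of length one, in which its entries are coded
    separately. *)
Definition single (T : Type) (x : T) : seq T := [:: x].

Lemma flatten_single (T : Type) (s : seq T) : flatten (map (@single T) s) = s.
Proof. by elim: s => //= x s ->. Qed.

Section Terms.
Variable M : structure.
Implicit Types (c : tup M) (W : seq (seq (sorts M))).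

Lemma term_nth c W i : i < size W ->
  term c W (fun ts => nth [::] ts i) (nth [::] W i).
Proof.
elim: W i => [|w W IH] [|i] //= iW.
  by apply: term_ext (term_head c w W) => -[].
by apply: term_ext (term_behead w (IH i iW)) => -[|? ?] //= _; rewrite nth_nil.
Qed.

Lemma edef_terms c W W0 P (fs : seq (seq (tup M) -> tup M)) : edef [::] W0 P ->
  List.Forall2 (term c W) fs W0 -> edef c W (fun ts => P (map (fun f => f ts) fs)).
Proof.
move=> [phi H] F.
have tfs : term c W (fun ts => flatten (map (fun f => f ts) fs)) (flatten W0).
  elim: F => [|f w fs' W0' tf _ IH] /=; last exact: term_cat.
  by apply: term_cst.
apply: edef_ext (edef_sat phi tfs) => ts tsW.
rewrite (H (map (fun f => f ts) fs)) ?cats0 //.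
elim: F {H tfs} => //= f w fs' W0' tf _ IH.
by rewrite /wt /= (term_typed tf tsW) IH.
Qed.

Lemma edef_behead c W w P : edef c W P -> edef c (w :: W) (fun ts => P (behead ts)).
Proof.
move=> [phi H].
have t : term c (w :: W) (fun ts => flatten (behead ts) ++ c) (flatten W ++ map (@sort_of M) c).
  by apply: term_cat; [apply: term_behead; exact: term_flatten|exact: term_cst].
apply: edef_ext (edef_sat phi t) => -[//|x ts] [_ tsW] /=.
exact: iff_sym (H _ tsW).
Qed.

Lemma edef_weaken c W P : edef [::] W P -> edef c W P.
Proof.
move=> [phi H]; apply: edef_ext (edef_sat phi (term_flatten c W)) => ts tsW.
by rewrite H // cats0.
Qed.

Lemma holds_definable (r : Defs.rel M) : definable set0 (arity r) (holds r).
Proof.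
split=> [t []//|]; exists (Atom r (iota 0 (size (arity r)))), [::].
split=> [i x|t tw]; first by rewrite onth0n.
have st : size t = size (arity r) by rewrite -tw size_map.
rewrite /= -st map_onth_iota; split=> [h|[t' /inj_map-> //]]; first by exists t.
Qed.

Lemma wt_single (w : seq (sorts M)) ts : wt (map (@single _) w) ts ->
  exists2 t, typed w t & ts = map (@single _) t.
Proof.
elim: w ts => [|s w IH] [|[|x [|? ?]] ts] //; first by exists [::].
move=> [xs /IH[t tw ->]]; exists (x :: t) => //.
by rewrite /typed /= xs tw.
Qed.

End Terms.

Section Interpretation.
Variables (N M : structure) (Wd : sorts N -> seq (sorts M)) (cd : elt N -> tup M -> Prop).

(* The elements of N of sort s are coded by tuples of M of sorts Wd s. *)
Record interpretation : Prop := Interpretation {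
  cd_typed : forall x t, cd x t -> typed (Wd (sort_of x)) t;
  cd_total : forall x, exists t, cd x t;
  cd_inj : forall x y t, sort_of x = sort_of y -> cd x t -> cd y t -> x = y;
  cd_eq : forall s, edef [::] [:: Wd s; Wd s] (fun ts => exists x,
    [/\ sort_of x = s, cd x (head [::] ts) & cd x (head [::] (behead ts))]);
  cd_rel : forall r : Defs.rel N, edef [::] (map Wd (arity r)) (fun ts => exists xs,
    holds r xs /\ List.Forall2 cd xs ts) }.

Hypothesis I : interpretation.

Lemma coded_wt w e ts : typed w e -> List.Forall2 cd e ts -> wt (map Wd w) ts.
Proof.
move=> <-; elim=> // x t {}e {}ts xt _ IH.
by rewrite /wt /= IH (cd_typed I xt).
Qed.

Lemma coded_exists e : exists ts, List.Forall2 cd e ts.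
Proof.
elim: e => [|x e [ts ets]]; first by exists [::].
by have [t xt] := cd_total I x; exists (t :: ts); constructor.
Qed.

Lemma coded_nth e ts i x : List.Forall2 cd e ts -> onth e i = Some x ->
  cd x (nth [::] ts i).
Proof. by move=> H; elim: H i => [|y t e' ts' yt _ IH] [|i] //= => [[<-]|/IH]. Qed.

Lemma coded_inj w e e' ts : typed w e -> typed w e' ->
  List.Forall2 cd e ts -> List.Forall2 cd e' ts -> e = e'.
Proof.
move=> ew e'w H; elim: H w e' ew e'w => [|x t {}e {}ts xt _ IH] w e' ew e'w H'.
  by inversion H'.
inversion H' as [|x' t' e'' ts' x't e''ts]; subst.
move: ew e'w; rewrite /typed /= => <- [xx' ee'].
by rewrite (cd_inj I (esym xx') xt x't) (IH _ e'' erefl ee').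
Qed.

Lemma edef_coded c W s f : term c W f (Wd s) ->
  edef c W (fun ts => exists2 x, sort_of x = s & cd x (f ts)).
Proof.
move=> tf; have := edef_terms (fs := [:: f; f]) (cd_eq I s) _.
move=> /(_ c W) H; apply: edef_ext (H _) => [ts _ /=|]; last by repeat constructor.
by split=> [[x []]|[x]]; exists x.
Qed.

(** The word [w] fixes the sorts of the free variables. An equation between variables of different
    sorts, or an atom that does not fit its arity, fails on all such tuples and becomes [False]; a
    quantifier over [s] becomes one over the tuples of [Wd s] that code something. *)
Lemma interpretation_edef (phi : formula N) w : exists2 P, edef [::] (map Wd w) P &
  forall e ts, typed w e -> List.Forall2 cd e ts -> (P ts <-> sat e phi).
Proof.
elim: phi w => [i j|r v||phi1 IH1 phi2 IH2|s phi IH] w.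
- have [[s [wi wj]]|nw] := pselect (exists s, onth w i = Some s /\ onth w j = Some s).
    have ow (k : nat) : onth w k = Some s ->
        term [::] (map Wd w) (fun ts => nth [::] ts k) (Wd s).
      move=> wk; have kw : k < size w by rewrite -onthTE wk.
      have := @term_nth M [::] (map Wd w) k.
      by rewrite size_map (nth_map s) // (onth_nth _ _ _ _ wk); apply.
    eexists; first by apply: (edef_terms (cd_eq I s)
      (fs := [:: (fun ts => nth [::] ts i); (fun ts => nth [::] ts j)]));
      repeat constructor; exact: ow.
    move=> e ts ew ets /=.
    have [[xi ei si] [xj ej sj]] : (exists2 x, onth e i = Some x & sort_of x = s) /\
        (exists2 x, onth e j = Some x & sort_of x = s).
      move: wi wj; rewrite -ew !onth_map.
      by case: (onth e i) => //= x [<-]; case: (onth e j) => //= y [yx]; split;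
         [exists x|exists y].
    have ci := coded_nth ets ei; have cj := coded_nth ets ej.
    split=> [[x [xs xi' xj']]|[x []]].
      exists x; rewrite ei ej; split; congr Some.
        by apply: (cd_inj I _ ci xi'); rewrite si xs.
      by apply: (cd_inj I _ cj xj'); rewrite sj xs.
    by rewrite ei ej => -[<-] [xx]; exists xi; split=> //; rewrite -xx.
  exists (fun=> False); first exact: edef_false.
  move=> e ts ew _; split=> // -[x [ei ej]]; apply: nw; exists (sort_of x).
  by rewrite -ew !onth_map ei ej.
- have [vr|nvr] := pselect (map (onth w) v = map Some (arity r)); last first.
    exists (fun=> False); first exact: edef_false.
    move=> e ts ew _; split=> // -[t vt [tr _]]; apply: nvr.
    rewrite -tr -[in RHS]map_comp (eq_map (g := omap (@sort_of N) \o Some)) //.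
    by rewrite map_comp -vt -map_comp; apply: eq_map => k /=; rewrite -ew onth_map.
  eexists.
    apply: (edef_terms (cd_rel I r) (fs := map (fun i ts => nth [::] ts i) v)).
    elim: v (arity r) vr => [|k v IH] [|s ar] //= [wk /IH vr]; constructor=> //.
    have kw : k < size w by rewrite -onthTE wk.
    have := @term_nth M [::] (map Wd w) k.
    by rewrite size_map (nth_map s) // (onth_nth _ _ _ _ wk); apply.
  move=> e ts ew ets /=; rewrite -map_comp.
  have [t [vt tr tc]] : exists t, [/\ map (onth e) v = map Some t, typed (arity r) t &
      List.Forall2 cd t (map ((fun f => f ts) \o (fun i ts => nth [::] ts i)) v)].
    elim: v (arity r) vr => [|k v IH] [|s ar] //= ; first by exists [::].
    move=> [wk /IH[t [vt tr tc]]]; move: wk; rewrite -ew onth_map.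
    case ek: (onth e k) => [x|] //= [xs]; exists (x :: t); rewrite /= vt; split=> //.
      by rewrite /typed /= xs tr.
    by constructor=> //; exact: coded_nth ek.
  split=> [[xs [hr xsc]]|[t']].
    by exists t => //; rewrite (coded_inj tr _ tc xsc) //; case: hr.
  by rewrite vt => /inj_map <- => [hr|? ? []//]; exists t.
- exists (fun=> False); first exact: edef_false.
  by [].
- have [P1 d1 H1] := IH1 w; have [P2 d2 H2] := IH2 w.
  exists (fun ts => P1 ts -> P2 ts); first exact: edef_imp.
  by move=> e ts ew ets /=; rewrite (H1 e) // (H2 e).
- have [P d H] := IH (s :: w).
  exists (fun ts => forall t, typed (Wd s) t ->
    (exists2 x, sort_of x = s & cd x t) -> P (t :: ts)).
    apply: edef_all; apply: edef_imp; first by apply: edef_coded; exact: term_head.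
    by apply: edef_ext d => -[].
  move=> e ts ew ets /=; split=> [K x xs|K t _ [x xs xt]].
    have [t xt] := cd_total I x; apply/(H (x :: e) (t :: ts)).
    - by rewrite /typed /= xs ew.
    - by constructor.
    - by apply: K; [rewrite -xs; exact: cd_typed xt|exists x].
  apply/(H (x :: e) (t :: ts)); last exact: K.
    by rewrite /typed /= xs ew.
  by constructor.
Qed.

Lemma interpretation_sat (phi : formula N) w : exists psi, forall e ts,
  typed w e -> List.Forall2 cd e ts -> (sat e phi <-> sat (flatten ts) psi).
Proof.
have [P [psi H] PE] := interpretation_edef phi w; exists psi => e ts ew ets.
by rewrite -(PE e ts) // -[flatten ts]cats0 -H //; exact: coded_wt ets.
Qed.

Lemma edef_all_coded w : edef [::] (map Wd w)
  (fun ts => exists2 e, typed w e & List.Forall2 cd e ts).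
Proof.
elim: w => [|s w IH] /=.
  apply: edef_ext (edef_true [::] [::]) => -[|//] _; split=> // _.
  by exists [::]; last constructor.
apply: edef_ext (edef_and (edef_coded (term_head [::] (Wd s) (map Wd w)))
  (edef_behead (Wd s) IH)).
move=> [//|t ts] _ /=; split=> [[[x xs xt] [e ew ets]]|[e ew H]].
  by exists (x :: e); [rewrite /typed /= xs ew|constructor].
inversion H as [|x t' e' ts' xt ets]; subst; move: ew => [xs ew].
by split; [exists x|exists e'].
Qed.

(** The form with parameters: a condition over [d] becomes a condition on concatenated codes over
    any code of [d]. It lets saturation be applied in [M] to conditions stated in [N]. *)
Lemma interpretation_definable (phi : formula N) w d dts : List.Forall2 cd d dts ->
  edef (flatten dts) [:: flatten (map Wd w)] (fun us => exists e ts,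
    [/\ head [::] us = flatten ts, typed w e, List.Forall2 cd e ts & sat (e ++ d) phi]).
Proof.
move=> ddts; have [psi psiP] := interpretation_sat phi (w ++ map (@sort_of _) d).
have H1 : edef (flatten dts) (map Wd w) (fun ts => sat (flatten ts ++ flatten dts) psi).
  by exists psi.
have /edef_definableI := edef_and (edef_weaken (flatten dts) (edef_all_coded w)) H1.
move=> /edef_definable/(_ (term_head _ _ [::])).
apply: edef_ext => us _ /=; split=> [[ts [_ -> [[e ew ets]]]]|[e [ts [-> ew ets S]]]].
  rewrite -flatten_cat -(psiP (e ++ d)); first by exists e, ts.
    by rewrite /typed /= map_cat ew.
  exact: List.Forall2_app.
exists ts; split=> //; first exact: coded_wt ets.
split; first by exists e.
rewrite -flatten_cat -(psiP (e ++ d)) //.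
  by rewrite /typed /= map_cat ew.
exact: List.Forall2_app.
Qed.

End Interpretation.

(** Codes of length one. Injectivity of [g] is only asked within each sort, because the sort of a
    variable tells apart elements with the same image; this allows two sorts of [N] to be mapped to
    one sort of [M]. *)
Lemma map_interpretation (N M : structure) (gs : sorts N -> sorts M) (g : elt N -> elt M) :
  (forall x, sort_of (g x) = gs (sort_of x)) ->
  (forall x y, sort_of x = sort_of y -> g x = g y -> x = y) ->
  (forall s y, sort_of y = gs s -> exists2 x, sort_of x = s & g x = y) ->
  (forall r : Defs.rel N, definable set0 (map gs (arity r))
     [set t | exists2 xs, holds r xs & t = map g xs]) ->
  forall phi w, exists psi, forall e : tup N, typed w e ->
    (sat e phi <-> sat (map g e) psi).
Proof.
move=> g_sort g_inj g_surj g_rel phi w.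
pose cd (x : elt N) (t : tup M) := t = [:: g x].
have cdE xs ts : List.Forall2 cd xs ts <-> ts = map (@single _) (map g xs).
  split=> [|->]; first by elim=> // x t {}xs {}ts -> _ ->.
  by elim: xs => [|x xs IH]; constructor.
have Igs : interpretation (fun s => [:: gs s]) cd.
  split.
  - by move=> x _ ->; rewrite /typed /= g_sort.
  - by move=> x; exists [:: g x].
  - by move=> x y _ xy -> [/g_inj-> //].
  - move=> s.
    have /edef_ext : edef [::] [:: [:: gs s]; [:: gs s]]
        (fun ts : seq (tup M) => head [::] ts = head [::] (behead ts)).
      by apply: edef_eq; [exact: term_head|apply: term_behead; exact: term_head].
    apply=> -[|[|y [|? ?]] [|t' [|? ?]]] //= [/esym ys _]; split=> [<-|[x [_ -> ->]]//].
    by have [x xs xy] := g_surj s y (esym ys); exists x; rewrite /cd xy.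
  - move=> r; have W : map (fun s => [:: gs s]) (arity r) =
        map (@single _) (map gs (arity r)) by rewrite -map_comp.
    rewrite W; have /edef_definable0 := g_rel r.
    move=> /(_ [::] (map (@single _) (map gs (arity r))) flatten) H.
    apply: edef_ext (H _) => [ts /wt_single[t tw ->]|]; last first.
      by rewrite -{2}[map gs _]flatten_single; exact: term_flatten.
    rewrite flatten_single; split=> [[xs hr ->]|[xs [hr /cdE te]]]; exists xs => //.
      by split=> //; apply/cdE.
    by rewrite -[LHS]flatten_single te flatten_single.
have [psi H] := interpretation_sat Igs phi w; exists psi => e ew.
rewrite (H e (map (@single _) (map g e))) ?flatten_single //.
exact/cdE.
Qed.

(** * Imaginaries coded by representatives *)

Section Eq.
Variable M : structure.

Definition eq_sort (s : sorts (Meq M)) : seq (sorts M) :=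
  match s with inl s => [:: s] | inr E => eq_word E end.

(** Every member of a class is a code of it, so that no choice of representatives enters the
    definable conditions. *)
Definition eq_code (x : elt (Meq M)) (t : tup M) : Prop :=
  match x with inl x => t = [:: x] | inr c => sval (projT2 c) t end.

Lemma eq_codeP (E : Defs.eqrel M) (c : {c : set (tup M) |
    exists2 x, typed (eq_word E) x & c = eq_class E x}) t t' :
  sval c t -> (sval c t' <-> eq_rel E t t').
Proof.
case: c => c' [x xw /= ce]; rewrite {}ce => xt; split=> [|tt']; last exact: eqrel_trans tt'.
by apply: eqrel_trans; exact: eqrel_sym.
Qed.

(** On the codes of an imaginary sort both equality and the graph of the projection become the
    0-definable relation [eq_rel E] itself. *)
Lemma Meq_interpretation : interpretation eq_sort eq_code.
Proof.
split.
- case=> [x|[E [c' [x xw /= ce]]]] t /=; first by move->.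
  by rewrite ce => /(eq_definable E).1[].
- case=> [x|[E [c' [x xw /= ce]]]] /=; first by exists [:: x].
  by exists x; rewrite ce; exact: eqrel_refl.
- case=> [x|[E c]] [y|[E' c']] t //= => [_ -> [->]//|[EE]]; subst E' => ct c't.
  have cc : sval c = sval c'.
    apply/seteqP; split=> u; first by move/(eq_codeP _ ct)/(eq_codeP _ c't).
    by move/(eq_codeP _ c't)/(eq_codeP _ ct).
  by congr (inr (existT _ _ _)); move: cc; case: (c) (c') => [? ?] [? ?] /= cc; exact: eq_exist.
- case=> [s|E] /=.
    have /edef_ext : edef [::] [:: [:: s]; [:: s]]
        (fun ts : seq (tup M) => head [::] ts = head [::] (behead ts)).
      by apply: edef_eq; [exact: term_head|apply: term_behead; exact: term_head].
    apply=> -[|[|y [|? ?]] [|t' [|? ?]]] //= [ys _].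
    by split=> [<-|[[x|[E c]] []//= _ -> ->//]]; exists (inl y); rewrite /= ys.
  have /edef_ext : edef [::] [:: eq_word E; eq_word E]
      (fun ts : seq (tup M) => eq_rel E (head [::] ts) (head [::] (behead ts))).
    apply: edef_definable2 (eq_definable E) _ _; first exact: term_head.
    by apply: term_behead; exact: term_head.
  apply=> -[|t [|t' [|? ?]]] //= [tw t'w]; split=> [tt'|[[x|[E' c]] []//= [EE]]].
    have h : exists2 x, typed (eq_word E) x & eq_class E t = eq_class E x by exists t.
    exists (inr (existT _ E (exist _ (eq_class E t) h))); split=> //=.
    exact: eqrel_refl.
  by subst E' => ct /(eq_codeP _ ct).
- case=> [r|E] /=.
    have W : map eq_sort (map inl (arity r)) = map (@single _) (arity r).
      by rewrite -map_comp.
    rewrite W; have /edef_definable0 := holds_definable r.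
    move=> /(_ [::] (map (@single _) (arity r)) flatten) H.
    apply: edef_ext (H _) => [ts /wt_single[t tw ->]|]; last first.
      by rewrite -{2}[arity r]flatten_single; exact: term_flatten.
    rewrite flatten_single.
    have F x ts' : List.Forall2 eq_code (map inl x) ts' <-> ts' = map (@single _) x.
      split=> [|->]; last by elim: x => [|? ? ?]; constructor.
      elim: x ts' => [|y x IH] ts' H'; inversion H' as [|? ? ? ? e1 e2] => //; subst.
      by rewrite e1 (IH _ e2).
    split=> [[tr ht]|[xs [[xr [x xe hx]] /=]]].
      exists (map inl t); split; last exact/F.
      split; last by exists t.
      by rewrite /typed /= -tr -!map_comp.
    rewrite xe => /F /(congr1 flatten); rewrite !flatten_single => tx.
    by split=> //; rewrite tx.
  have W : map eq_sort (rcons (map inl (eq_word E)) (inr E)) =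
      map (@single _) (eq_word E) ++ [:: eq_word E].
    by rewrite map_rcons -cats1 -map_comp.
  rewrite W; set W1 := map (@single _) (eq_word E).
  have t1 : term [::] W1 flatten (eq_word E).
    by rewrite -[eq_word E]flatten_single; exact: term_flatten.
  have := edef_definable2 (eq_definable E) (term_take [:: eq_word E] t1)
     (term_drop W1 (term_head [::] (eq_word E) [::])).
  apply: edef_ext => ts /wt_cat; set ts1 := take _ _; set ts2 := drop _ _ => -[h1 h2].
  have -> : ts = ts1 ++ ts2 by rewrite cat_take_drop.
  have [t tw ->] := wt_single h1; rewrite flatten_single.
  case: ts2 h2 => [|t2 [|? ?]] //= [t2w]; split=> [tt2|].
    have h : exists2 x, typed (eq_word E) x & eq_class E t = eq_class E x by exists t.
    pose c := exist (fun c => exists2 x, typed (eq_word E) x & c = eq_class E x) _ h.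
    have ct : sval c t by exact: eqrel_refl.
    exists (rcons (map inl t) (inr (existT _ E c))); split.
      split; last by exists t, c.
      by rewrite /typed /= map_rcons -tw -!map_comp.
    rewrite -cats1; apply: List.Forall2_app; first by elim: (t) => [|? ? ?]; constructor.
    by constructor.
  move=> [xs [[_ [x [c [xe cx]]]]]]; rewrite xe -cats1 => /List.Forall2_app_inv_l.
  move=> [l1 [l2 [f1 [f2 ll]]]].
  have l1e : l1 = map (@single _) x.
    elim: x l1 f1 {xe cx ll} => [|y x IH] l1 f1; inversion f1 as [|? ? ? ? e1 e2] => //; subst.
    by rewrite e1 (IH _ e2).
  inversion f2 as [|? t2' ? l3 c2 f3]; subst; inversion f3; subst.
  have /rcons_inj[{}ll ->] : rcons (map (@single _) t) t2 = rcons (map (@single _) x) t2'.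
    by rewrite -!cats1.
  have -> : t = x by rewrite -[LHS]flatten_single ll flatten_single.
  exact/(eq_codeP _ cx).
Qed.

(** Passing to [M^eq] adds no 0-definable sets on the real sorts, since a real element has only
    itself as a code. *)
Lemma Meq_down w D : definable (M := Meq M) set0 (map inl w) D ->
  definable (M := M) set0 w [set t | typed w t /\ D (map inl t)].
Proof.
move=> /definable0_sat[phi phiP].
have [psi psiP] := interpretation_sat Meq_interpretation phi (map inl w).
split=> [t []//|]; exists psi, [::]; split=> [i x|t tw]; first by rewrite onth0n.
have tw' : typed (M := Meq M) (map inl w) (map inl t).
  by rewrite /typed /= -tw -!map_comp.
have /psiP : List.Forall2 eq_code (map inl t) (map (@single _) t).
  by elim: (t) => [|? ? ?]; constructor.
move=> /(_ tw'); rewrite flatten_single cats0 => <-.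
by rewrite -phiP //; split=> [[]|].
Qed.

Lemma Meq_up w D : definable (M := M) set0 w D ->
  definable (M := Meq M) set0 (map inl w) [set map inl t | t in D].
Proof.
move=> Dd; have [Dw _] := Dd; have [phi phiP] := definable0_sat Dd.
have [||||psi psiP] := @map_interpretation M (Meq M) inl inl _ _ _ _ phi w => //.
- by move=> x y _ [].
- by move=> s [y|y] //= [<-]; exists y.
- move=> r; have [hw [chi [d [dc H]]]] := holds_definable (M := Meq M) (inl r).
  split=> [_ [t [tr ht] ->]|]; first by rewrite /typed /= -tr -!map_comp.
  exists chi, d; split=> // t tw; rewrite -H //; split=> [[x [xr hx] ->]|].
    by split; [rewrite /typed /= -xr -!map_comp|exists x].
  move=> [_ [x te hx]]; subst t; exists x => //; split=> //.
  apply: (@inj_map _ _ (@inl (sorts M) (Defs.eqrel M))) => [? ? []//|].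
  by rewrite -[RHS]tw -!map_comp.
split=> [_ [t /Dw tw <-]|]; first by rewrite /typed /= -tw -!map_comp.
exists psi, [::]; split=> [i x|t tw]; first by rewrite onth0n.
have [x xw ->] : exists2 x, typed w x & t = map inl x.
  elim: w t tw {D Dd Dw phiP psiP} => [|s w IH] [|[y|y] t] //=; first by exists [::].
  by move=> [ys /IH[x xw ->]]; exists (y :: x); rewrite // /typed /= ys xw.
rewrite cats0 -psiP // -phiP //; split=> [[x' Dx' /inj_map <-//]|Dx]; last by exists x.
by move=> ? ? [].
Qed.

(* K chooses a code in M for each element of M^eq. *)
Lemma Meq_saturated_words : exists K : elt (Meq M) -> tup M,
  forall w (J : Type) (j0 : J) (D : J -> tup (Meq M) -> Prop) (c : J -> tup (Meq M)),
  saturated M -> infinite_set [set: elt M] ->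
  ~ ([set: elt M] #<= [set x | exists j, List.In x (flatten (map K (c j)))]) ->
  (forall j, edef (c j) [:: w] (fun ts => D j (head [::] ts))) ->
  (forall j j', exists k, forall t, typed w t -> D k t -> D j t /\ D j' t) ->
  (forall j, exists t, typed w t /\ D j t) ->
  exists t, typed w t /\ forall j, D j t.
Proof.
have I := Meq_interpretation.
have /choice[K KP] := cd_total I; exists K => w J j0 D c satM infM small Ddef dir Dne.
have KF e : List.Forall2 eq_code e (map K e) by elim: e => [|? ? ?]; constructor.
pose D' j u := exists ts t, [/\ u = flatten ts, typed w t, List.Forall2 eq_code t ts & D j t].
have codes t ts : typed w t -> List.Forall2 eq_code t ts ->
    typed (flatten (map eq_sort w)) (flatten ts).
  by move=> tw tts; apply: wt_flatten; exact: (coded_wt I tw tts).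
have [|j|j j'|j|u [uw uD]] := @saturated_words M (flatten (map eq_sort w)) _ J j0 D'
    (fun j => flatten (map K (c j))) satM infM small.
- by move=> j x xj; exists j.
- have [phi phiP] := Ddef j.
  apply: edef_ext (interpretation_definable I phi w (KF (c j))) => us _ /=.
  split=> [[e [ts [ue ew ets S]]]|[ts [e [ue ew ets De]]]].
    exists ts, e; split=> //; apply/(phiP [:: e]); first by rewrite /wt /= ew.
    by rewrite /= cats0.
  exists e, ts; split=> //; have /phiP : wt [:: w] [:: e] by rewrite /wt /= ew.
  by rewrite /= cats0 => <-.
- have [k kP] := dir j j'; exists k => u _ [ts [t [-> tw tts Dt]]].
  by have [? ?] := kP t tw Dt; split; exists ts, t.
- have [t [tw Dt]] := Dne j; have [ts tts] := coded_exists I t.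
  by exists (flatten ts); split; [exact: codes tw tts|exists ts, t].
(* For each index, [u] codes some member of [D j]. As [u] splits into blocks in one way only and
   codes are injective, it is the same tuple for all indices. *)
have [ts [t [ue tw tts Dt]]] := uD j0; exists t; split=> // j.
have [ts' [t' [ue' t'w t'ts' Dt']]] := uD j.
suff <- : t' = t by [].
have tsE : ts = ts'.
  by apply: wt_inj (coded_wt I tw tts) (coded_wt I t'w t'ts') _; rewrite -ue -ue'.
by apply: (coded_inj I t'w tw t'ts'); rewrite -tsE.
Qed.

End Eq.

(** * Trivialisations of the binding groupoid *)

Lemma eq_finite_subset T (c d : set T) n : c #= `I_n -> d #= `I_n -> c `<=` d -> c = d.
Proof.
elim/Pchoice: T => T in c d *.
move=> cn dn cd.
have /finite_fsetP[X cX] : finite_set c by exists n.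
have /finite_fsetP[Y dY] : finite_set d by exists n.
move: cn dn cd; rewrite {}cX {}dY => /card_eq_fsetP XX /card_eq_fsetP YY XY.
have sXY : (X `<=` Y)%fset by apply/fsubsetP => x; exact: XY.
have -> // : X = Y by apply/eqP; rewrite eqEfcard sXY XX YY leqnn.
Qed.

Lemma sval_injective T (P : T -> Prop) : injective (@sval T P).
Proof. by move=> [x px] [y py] /= xy; exact: eq_exist. Qed.

Section Subsets.
Variables (T : Type) (A : set T).

Lemma nsubsets_finite n c : nsubsets A n c -> finite_set c.
Proof. by move=> [_ cn]; exists n. Qed.

Lemma nsubsets_of_finite c : finite_set c -> c `<=` A -> c !=set0 ->
  exists n, nsubsets A n.+1 c.
Proof.
move=> [[|n] cn] cA [x cx]; last by exists n.
by move: cn cx; rewrite II0 card_eq0 => /eqP->.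
Qed.

Lemma nsubsets1 a : A a -> nsubsets A 1 [set a].
Proof. by move=> Aa; split=> [x ->//|]; exact: card_set1. Qed.

Lemma nsubsets_ne n c : nsubsets A n.+1 c -> c !=set0.
Proof.
move=> [_ cn]; apply/set0P/negP => /eqP c0; move: cn; rewrite c0.
rewrite card_eq_sym card_eq0 => /eqP/seteqP[/(_ 0) h _]; exact: h.
Qed.

Lemma nsubsets_lt n m c d : nsubsets A n.+1 c -> nsubsets A m.+1 d ->
  c `<=` d -> c <> d -> (n < m)%N.
Proof.
move=> [_ cn] [_ dm] cd ncd; have : (n <= m)%N.
  rewrite -ltnS -card_le_II -(card_le_eql cn) -(card_le_eqr dm).
  exact: subset_card_le.
rewrite leq_eqVlt => /orP[/eqP nm|//]; exfalso; apply: ncd.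
by move: cn dm cd; rewrite nm; exact: eq_finite_subset.
Qed.

Lemma nsubsets_eq n m c : nsubsets A n.+1 c -> nsubsets A m.+1 c -> n = m.
Proof.
move=> [_ cn] [_ cm]; apply/eqP; rewrite -eqSS; apply/eqP/card_eq_II.
exact: card_eq_trans (card_esym cn) cm.
Qed.

End Subsets.

Section Graphs.
Variables (X Y : Type) (P : set X) (Q : set Y) (f : X -> Y -> Prop).

Lemma is_bijectionE : is_bijection P Q f <->
  [/\ forall x y, f x y -> P x /\ Q y, forall x, P x -> exists y, f x y,
      forall y, Q y -> exists x, f x y, forall x y y', f x y -> f x y' -> y = y' &
      forall x x' y, f x y -> f x' y -> x = x'].
Proof.
split=> [[[fPQ ftot] [_ fsurj]]|[fPQ ftot fsurj ffun finj]].
  split=> // [x /ftot[y [fxy _]]|y /fsurj[x [fxy _]]|x y y' fxy fxy'|x x' y fxy fx'y].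
  - by exists y.
  - by exists x.
  - by have [z [_ zu]] := ftot x (fPQ _ _ fxy).1; rewrite -(zu y fxy) (zu y' fxy').
  - by have [z [_ zu]] := fsurj y (fPQ _ _ fxy).2; rewrite -(zu x fxy) (zu x' fx'y).
split; split=> //.
- by move=> x /ftot[y fxy]; exists y; split=> // y'; exact: ffun fxy.
- by move=> y x /fPQ[].
- by move=> y /fsurj[x fxy]; exists x; split=> // x'; exact: finj fxy.
Qed.

End Graphs.

Lemma graph_ext (X Y : Type) (f g : X -> Y -> Prop) : (forall x y, f x y <-> g x y) -> f = g.
Proof. by move=> fg; apply: funext => x; apply: funext => y; apply: propext. Qed.

Section Groupoid.
Variables (M : structure) (H : groupoid M).

Lemma object_ne i : Idx H i -> exists x, object H i x.
Proof. by rewrite -idx_surj => -[x Ox <-]; exists x. Qed.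

Lemma object_eq i j x : object H i x -> object H j x -> i = j.
Proof. by move=> [_ <-] [_ <-]. Qed.

Definition hom_code (i j : tup M) (t : tup M) : Prop :=
  Mor H t /\ is_bijection (object H i) (object H j) (Graph H t).

Lemma HomE i j f : Hom H i j f <-> exists2 t, hom_code i j t & f = Graph H t.
Proof.
by split=> [[t Mt [-> fb]]|[t [Mt fb] ->]]; exists t.
Qed.

Lemma Hom_bij i j f : Hom H i j f -> is_bijection (object H i) (object H j) f.
Proof. by move=> [t _ [-> ]]. Qed.

(** Distinct objects are disjoint, so one pair of the graph already determines the domain and the
    codomain. Bijectivity is thereby replaced by an existential condition, visibly definable over
    [i] and [j]. *)
Lemma hom_codeE i j t : Idx H i -> hom_code i j t <->
  Mor H t /\ exists x y, [/\ Graph H t x y, object H i x & object H j y].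
Proof.
move=> Ii; split=> [[Mt tb]|[Mt [x [y [txy ix jy]]]]]; split=> //.
  have [x ix] := object_ne Ii; have /is_bijectionE[tPQ ttot _ _ _] := tb.
  by have [y txy] := ttot x ix; exists x, y; have [] := tPQ _ _ txy.
have [i' [j' [_ _ tb]]] := Graph_bij Mt; have /is_bijectionE[tPQ _ _ _ _] := tb.
by have [i'x j'y] := tPQ _ _ txy; rewrite (object_eq ix i'x) (object_eq jy j'y).
Qed.

Lemma Idx_typed i : Idx H i -> typed (Iw H) i.
Proof. exact: (Idx_definable H).1. Qed.

Lemma edef_hom_code c W f i j : term c W f (Mw H) -> Idx H i -> Idx H j ->
  (forall x, List.In x i -> List.In x c) -> (forall x, List.In x j -> List.In x c) ->
  edef c W (fun ts => hom_code i j (f ts)).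
Proof.
move=> tf Ii Ij ic jc.
have objd w0 W' k g : term c (w0 :: W') g (Ow H) -> Idx H k ->
    (forall x, List.In x k -> List.In x c) ->
    edef c (w0 :: W') (fun ts => object H k (g ts)).
  move=> tg Ik kc.
  apply: edef_ext (edef_definable2 (idx_definable H) tg (term_cst _ (Idx_typed Ik) kc)).
  by move=> ts _; split=> -[Ox kx].
have : edef c W (fun ts => Mor H (f ts) /\ exists x, typed (Ow H) x /\
    exists y, typed (Ow H) y /\ [/\ Graph H (f ts) x y, object H i x & object H j y]).
  apply: edef_and; first exact: edef_definable0 (Mor_definable H) tf.
  apply: edef_ex; apply: edef_ex.
  have tx : term c (Ow H :: Ow H :: W) (fun ts => head [::] (behead ts)) (Ow H).
    by apply: term_behead; exact: term_head.
  have ty := term_head c (Ow H) (Ow H :: W).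
  have tf2 := term_behead (Ow H) (term_behead (Ow H) tf).
  apply: edef_ext (edef_and (edef_definable3 (Graph_definable H) tf2 tx ty)
    (edef_and (objd _ _ _ _ tx Ii ic) (objd _ _ _ _ ty Ij jc))).
  by move=> ts _; split=> [[? [? ?]]|[? ? ?]].
apply: edef_ext => ts _; rewrite hom_codeE //; split=> -[Mt].
  by move=> [x [_ [y [_ h]]]]; split=> //; exists x, y.
move=> [x [y [h1 h2 h3]]]; split=> //; exists x; have [_ xw yw] := (Graph_definable H).1 _ _ _ h1.
by split=> //; exists y.
Qed.

End Groupoid.

(** * Isomorphisms from [S_c] to [O_c] and their restrictions *)

Section Binding.
Variables (U : structure) (Aw : seq (sorts U)) (A : set (tup U)).
Variables (V : extension U unit) (p : nelt V -> tup U).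
Variables (G : simplicial_groupoid Aw A)
  (G' : simplicial_groupoid (eq_word_of V Aw) (@eq_tup U V @` A))
  (eO eI : nat -> tup U -> tup (Meq V))
  (new : set (tup U) -> tup (Meq V))
  (theta : nat -> tup (Meq V) -> nelt V).
Hypothesis B : @binding_pair U Aw A V p G G' eO eI new theta.
Variable Q : commuting_system G.
Implicit Types (c d : set (tup U)).

Lemma new_idx n c : nsubsets A n.+1 c -> Idx (sgpd G' n) (new c).
Proof. by move=> cn; rewrite (Idx_ext B); right; exists c. Qed.

Lemma cobj_idx n c : nsubsets A n.+1 c -> Idx (sgpd G n) (cobj Q c).
Proof. by move=> /(cobj_over Q)[]. Qed.

Lemma cobj_base n c : nsubsets A n.+1 c -> base (sgpd G n) (cobj Q c) = c.
Proof. by move=> /(cobj_over Q)[]. Qed.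

Lemma eI_idx n i : Idx (sgpd G n) i -> Idx (sgpd G' n) (eI n i).
Proof. by move=> cn; rewrite (Idx_ext B); left; exists i. Qed.

Lemma theta_in n c x : nsubsets A n.+1 c -> object (sgpd G' n) (new c) x ->
  c (p (theta n x)).
Proof. by move=> /(new_object B)[h _ _]; exact: h. Qed.

Lemma theta_inj n c x y : nsubsets A n.+1 c -> object (sgpd G' n) (new c) x ->
  object (sgpd G' n) (new c) y -> theta n x = theta n y -> x = y.
Proof. by move=> /(new_object B)[_ h _] cx cy; apply: h; rewrite inE. Qed.

Lemma theta_surj n c s : nsubsets A n.+1 c -> c (p s) ->
  exists2 x, object (sgpd G' n) (new c) x & theta n x = s.
Proof. by move=> /(new_object B)[_ _ h] /h. Qed.

Lemma eO_object n i y : Idx (sgpd G n) i -> object (sgpd G' n) (eI n i) y <->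
  exists2 o, object (sgpd G n) i o & eO n o = y.
Proof. by move=> /(old_object B) ->. Qed.

Lemma eO_injective n i j o o' : object (sgpd G n) i o -> object (sgpd G n) j o' ->
  eO n o = eO n o' -> o = o'.
Proof. by move=> [Oo _] [Oo' _]; apply: (eO_inj B); rewrite inE. Qed.

(** [h] is an arrow between tuples of [V^eq]; reading its ends through [theta] and [eO] turns it
    into a relation between [S_c] and the chosen object of [G]. *)
Definition to_triv n c (h : tup (Meq V) -> tup (Meq V) -> Prop) : nelt V -> tup U -> Prop :=
  fun s o => exists x, [/\ object (sgpd G' n) (new c) x, theta n x = s,
                           object (sgpd G n) (cobj Q c) o & h x (eO n o)].

Definition trivialisation n c (H : nelt V -> tup U -> Prop) : Prop :=
  exists2 h, Hom (sgpd G' n) (new c) (eI n (cobj Q c)) h & H = to_triv n c h.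

Lemma trivialisation_exists n c : nsubsets A n.+1 c -> exists H, trivialisation n c H.
Proof.
move=> cn.
have [_ [|h hh]] := base_connected (g := sgpd G' n) (new_idx cn) (eI_idx (cobj_idx cn)).
  by rewrite (new_base B) // (old_base B) ?cobj_base //; exact: cobj_idx cn.
by exists (to_triv n c h), h.
Qed.

Lemma to_trivE n c h x o : nsubsets A n.+1 c -> object (sgpd G' n) (new c) x ->
  object (sgpd G n) (cobj Q c) o -> (to_triv n c h (theta n x) o <-> h x (eO n o)).
Proof.
move=> cn cx co; split=> [[x' [cx' xx' _ hx]]|hx]; last by exists x.
by rewrite -(theta_inj cn cx' cx xx').
Qed.

Lemma trivialisation_bij n c H : nsubsets A n.+1 c -> trivialisation n c H ->
  is_bijection [set s | c (p s)] (object (sgpd G n) (cobj Q c)) H.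
Proof.
move=> cn [h /Hom_bij /is_bijectionE[hin htot hsurj hfun hinj] ->].
have ci := cobj_idx cn.
apply/is_bijectionE; split.
- by move=> s o [x [cx <- co _]]; split=> //; exact: theta_in cx.
- move=> s /(theta_surj cn)[x cx xs]; have [y hxy] := htot x cx.
  have [_ /(eO_object _ ci)[o co oy]] := hin _ _ hxy.
  by exists o, x; rewrite oy.
- move=> o co; have [|x hx] := hsurj (eO n o); first by apply/(eO_object _ ci); exists o.
  by exists (theta n x), x; split=> //; exact: (hin _ _ hx).1.
- move=> s o o' [x [cx xs co hx]] [x' [cx' x's co' hx']].
  have xx : x = x' by apply: (theta_inj cn) => //; rewrite xs.
  by subst x'; apply: eO_injective co co' _; exact: hfun hx hx'.
- move=> s s' o [x [cx <- co hx]] [x' [cx' <- co' hx']].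
  by rewrite (hinj _ _ _ hx hx').
Qed.

(** A commuting system has maps for strict inclusions only. Adding the identity for [c = d] lets a
    one-element set be compared with itself, as in the definition of [star_map]. *)
Definition cinc_or_id c d (x o : tup U) : Prop :=
  (d = c /\ o = x) \/ (d <> c /\ cinc Q c d x o).

Lemma cinc_inj n m c d : nsubsets A n.+1 c -> nsubsets A m.+1 d -> c `<=` d -> c <> d ->
  is_injection (object (sgpd G n) (cobj Q c)) (object (sgpd G m) (cobj Q d)) (cinc Q c d).
Proof.
move=> cn dm cd ncd; have nm := nsubsets_lt cn dm cd ncd.
exact: (incl_inj (cobj_idx cn) (cobj_idx dm) (cinc_incl Q nm cn dm cd)).
Qed.

Lemma cinc_or_id_inj n m c d x x' o : nsubsets A n.+1 c -> nsubsets A m.+1 d -> c `<=` d ->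
  cinc_or_id c d x o -> cinc_or_id c d x' o -> x = x'.
Proof.
move=> cn dm cd [[dc ox]|[ndc xo]] [[dc' ox']|[ndc' x'o]] //; first by rewrite -ox.
by have [|_] := cinc_inj cn dm cd; [move/esym|apply; [exact: xo|exact: x'o]].
Qed.

Lemma cinc_or_id_total n m c d x : nsubsets A n.+1 c -> nsubsets A m.+1 d -> c `<=` d ->
  object (sgpd G n) (cobj Q c) x -> exists o, cinc_or_id c d x o.
Proof.
move=> cn dm cd cx; have [dc|ndc] := pselect (d = c); first by exists x; left.
have [|[_ /(_ x cx)[o [xo _]]] _] := cinc_inj cn dm cd; first by move/esym.
by exists o; right.
Qed.

Lemma cinc_or_id_comp k n m c d e x o : nsubsets A k.+1 c -> nsubsets A n.+1 d ->
  nsubsets A m.+1 e -> c `<=` d -> d `<=` e ->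
  cinc_or_id c e x o <-> exists2 y, cinc_or_id c d x y & cinc_or_id d e y o.
Proof.
move=> ck dn em cd de.
have [dc|ndc] := pselect (d = c).
  subst d; split=> [h|[y [[_ ->]|[]//]]//]; by exists x => //; left.
have [ed|ned] := pselect (e = d).
  subst e; split=> [h|[y h [[_ ->]|[]//]]//]; by exists o => //; left.
have ec : e <> c by move=> ec; subst e; apply: ndc; apply/seteqP.
have kn := nsubsets_lt ck dn cd (not_eq_sym ndc).
have nm := nsubsets_lt dn em de (not_eq_sym ned).
rewrite /cinc_or_id -(cinc_comp Q kn nm ck dn em cd de).
split=> [[[]//|[_ [y xy yo]]]|[y [[]//|[_ xy]] [[]//|[_ yo]]]].
  by exists y; right.
by right; split=> //; exists y.
Qed.

Definition restricts c d (Hc Hd : nelt V -> tup U -> Prop) : Prop :=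
  forall s o, c (p s) -> (Hd s o <-> exists2 x, Hc s x & cinc_or_id c d x o).

Definition cinc' n m c d : tup (Meq V) -> tup (Meq V) -> Prop :=
  gtransport (object (sgpd G n) (cobj Q c)) (object (sgpd G m) (cobj Q d))
    (eO n) (eO m) (cinc Q c d).

Definition sinc' n m c d : tup (Meq V) -> tup (Meq V) -> Prop := fun x y =>
  [/\ object (sgpd G' n) (new c) x, object (sgpd G' m) (new d) y & theta n x = theta m y].

(** Restriction is the commutativity of a square in [G']. As an equality of composites it is the
    form to which the groupoid axioms apply, and the form that is definable from the codes of the
    four maps. *)
Lemma restrictsE n m c d u v : nsubsets A n.+1 c -> nsubsets A m.+1 d -> c `<=` d -> c <> d ->
  Hom (sgpd G' n) (new c) (eI n (cobj Q c)) u -> Hom (sgpd G' m) (new d) (eI m (cobj Q d)) v ->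
  gcomp (cinc' n m c d) u = gcomp v (sinc' n m c d) <->
  restricts c d (to_triv n c u) (to_triv m d v).
Proof.
move=> cn dm cd ncd /Hom_bij /is_bijectionE[uin utot _ ufun _].
move=> /Hom_bij /is_bijectionE[vin vtot _ vfun _].
have ci := cobj_idx cn; have di := cobj_idx dm.
have [[iin itot] iinj] := cinc_inj cn dm cd ncd.
have L x o : object (sgpd G' n) (new c) x -> object (sgpd G m) (cobj Q d) o ->
    (gcomp (cinc' n m c d) u x (eO m o) <->
     exists2 z, to_triv n c u (theta n x) z & cinc_or_id c d z o).
  move=> cx dO; split.
    move=> [y uxy [z [o' [cz do' yz oo' zo]]]].
    have oe : o = o' by exact: eO_injective dO do' oo'.
    subst o'; exists z; last by right; split=> // /esym.
    by apply/(to_trivE _ cn cx cz); rewrite -yz.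
  move=> [z [x' [cx' xx' cz ux]] [[/esym//]|[_ zo]]].
  exists (eO n z); last by exists z, o.
  by rewrite -(theta_inj cn cx' cx xx').
have R x o : object (sgpd G' n) (new c) x -> object (sgpd G m) (cobj Q d) o ->
    (gcomp v (sinc' n m c d) x (eO m o) <-> to_triv m d v (theta n x) o).
  move=> cx dO; split=> [[y [_ dy xy] vy]|[y [dy yx _ vy]]].
    by rewrite xy; apply/(to_trivE _ dm dy dO).
  by exists y.
split=> [E s o cs|E].
  have [x cx xs] := theta_surj cn cs; subst s.
  have [dO|ndO] := pselect (object (sgpd G m) (cobj Q d) o).
    by rewrite -R // -L // E.
  split=> [[y [_ _ //]]|[z _ [[/esym//]|[_ /iin[]//]]]].
apply: graph_ext => x w.
have [cx|ncx] := pselect (object (sgpd G' n) (new c) x); last first.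
  by split=> [[y /uin[]//]|[y []//]].
have [dw|ndw] := pselect (object (sgpd G' m) (eI m (cobj Q d)) w); last first.
  split=> [[y _ [z [o [_ dO _ we _]]]]|[y _ /vin[]//]].
  by case: ndw; apply/(eO_object _ di); exists o.
have /(eO_object _ di)[o dO <-] := dw.
by rewrite R // L // -E //; exact: (theta_in cn).
Qed.

Lemma cinc'_maps n m (nm : (n < m)%N) c d : nsubsets A n.+1 c -> nsubsets A m.+1 d -> c `<=` d ->
  maps (Defs.incl G' nm) (eI n (cobj Q c)) (eI m (cobj Q d)) (cinc' n m c d).
Proof.
move=> cn dm cd; rewrite (old_incl B) ?(cobj_idx cn) ?(cobj_idx dm) //; last 2 first.
- exact: cobj_idx cn.
- exact: cobj_idx dm.
by exists (cinc Q c d) => //; exact: cinc_incl.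
Qed.

Lemma sinc'_maps n m (nm : (n < m)%N) c d : nsubsets A n.+1 c -> nsubsets A m.+1 d -> c `<=` d ->
  maps (Defs.incl G' nm) (new c) (new d) (sinc' n m c d).
Proof. by move=> cn dm cd; exact: (new_incl B nm). Qed.

(** This is the axiom [fam_hom] for two inclusions lying over the same pair of sets, one between the
    chosen objects and one between the added objects. *)
Lemma restricts_hom n m (nm : (n < m)%N) c d : nsubsets A n.+1 c -> nsubsets A m.+1 d ->
  c `<=` d ->
  [set gcomp (cinc' n m c d) u | u in Hom (sgpd G' n) (new c) (eI n (cobj Q c))] =
  [set gcomp v (sinc' n m c d) | v in Hom (sgpd G' m) (new d) (eI m (cobj Q d))].
Proof.
move=> cn dm cd.
apply: (fam_hom (g := Defs.incl G' nm)).
- exact: eI_idx (cobj_idx cn).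
- exact: eI_idx (cobj_idx dm).
- exact: new_idx cn.
- exact: new_idx dm.
- by rewrite (new_base B) // (old_base B) ?cobj_base //; exact: cobj_idx cn.
- by rewrite (new_base B) // (old_base B) ?cobj_base //; exact: cobj_idx dm.
- exact: cinc'_maps.
- exact: sinc'_maps.
Qed.

Lemma restricts_refl c H : restricts c c H H.
Proof.
move=> s o cs; split=> [h|[x h [[_ ->]|[]//]]//]; by exists o => //; left.
Qed.

(** The equality of [restricts_hom] read from left to right; the descent [restricts_down] reads it
    from right to left. *)
Lemma restricts_lift n m c d Hc : nsubsets A n.+1 c -> nsubsets A m.+1 d -> c `<=` d ->
  trivialisation n c Hc -> exists2 Hd, trivialisation m d Hd & restricts c d Hc Hd.
Proof.
move=> cn dm cd tH; have [e|ncd] := pselect (c = d).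
  subst d; rewrite -(nsubsets_eq cn dm); exists Hc => //; exact: restricts_refl.
have nm := nsubsets_lt cn dm cd ncd.
have [u hu ->] := tH.
have [v hv E] : [set gcomp v (sinc' n m c d) | v in
    Hom (sgpd G' m) (new d) (eI m (cobj Q d))] (gcomp (cinc' n m c d) u).
  by rewrite -(restricts_hom nm) //; exists u.
by exists (to_triv m d v); [exists v|apply/restrictsE].
Qed.

Lemma restricts_down n m c d Hd : nsubsets A n.+1 c -> nsubsets A m.+1 d -> c `<=` d ->
  trivialisation m d Hd -> exists2 Hc, trivialisation n c Hc & restricts c d Hc Hd.
Proof.
move=> cn dm cd tH; have [e|ncd] := pselect (c = d).
  subst d; rewrite (nsubsets_eq cn dm); exists Hd => //; exact: restricts_refl.
have nm := nsubsets_lt cn dm cd ncd.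
have [v hv ->] := tH.
have [u hu E] : [set gcomp (cinc' n m c d) u | u in
    Hom (sgpd G' n) (new c) (eI n (cobj Q c))] (gcomp v (sinc' n m c d)).
  by rewrite (restricts_hom nm) //; exists v.
by exists (to_triv n c u); [exists u|apply/restrictsE].
Qed.

Lemma restricts_trans k n m c d e Hc Hd He : nsubsets A k.+1 c -> nsubsets A n.+1 d ->
  nsubsets A m.+1 e -> c `<=` d -> d `<=` e ->
  restricts c d Hc Hd -> restricts d e Hd He -> restricts c e Hc He.
Proof.
move=> ck dn em cd de rc rd s o cs; rewrite rd; last exact: cd.
split=> [[x /rc-/(_ cs)[y hy yx] xo]|[x hx /(cinc_or_id_comp _ _ ck dn em cd de)[y xy yo]]].
  by exists y => //; apply/(cinc_or_id_comp _ _ ck dn em cd de); exists x.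
by exists y => //; apply/rc => //; exists x.
Qed.

(** Inclusions are injective: the value of [H] at a point of [S_c] is the image of one element of
    [O_c] only. *)
Lemma restricts_uniq n m c d K K' H : nsubsets A n.+1 c -> nsubsets A m.+1 d -> c `<=` d ->
  trivialisation n c K -> trivialisation n c K' -> restricts c d K H -> restricts c d K' H ->
  K = K'.
Proof.
move=> cn dm cd tK tK' rK rK'.
suff sub L L' : trivialisation n c L -> trivialisation n c L' -> restricts c d L H ->
    restricts c d L' H -> forall s o, L s o -> L' s o.
  by apply: graph_ext => s o; split; apply: sub.
move=> tL tL' rL rL' s o Lso.
have /is_bijectionE[Lin _ _ _ _] := trivialisation_bij cn tL.
have [cs co] := Lin _ _ Lso; have [o' oo'] := cinc_or_id_total cn dm cd co.
have /rL'-/(_ cs)[x L'x xo'] : H s o' by apply/rL => //; exists o.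
by rewrite (cinc_or_id_inj cn dm cd oo' xo').
Qed.

End Binding.

Section GcompDef.
Variables (M : structure) (c : tup M) (W : seq (seq (sorts M))).

(** The codes of the maps are the variables, which is what the squares of [restrictsE] need. The
    intermediate objects of the two composites may have different sorts. *)
Lemma edef_gcomp (wu1 wu2 wv1 wv2 wX wY wY' wZ : seq (sorts M))
    (u1 u2 v1 v2 : tup M -> tup M -> tup M -> Prop) (tu1 tu2 tv1 tv2 : seq (tup M) -> tup M) :
  definable3 wu1 wX wY u1 -> definable3 wu2 wY wZ u2 ->
  definable3 wv1 wX wY' v1 -> definable3 wv2 wY' wZ v2 ->
  term c W tu1 wu1 -> term c W tu2 wu2 -> term c W tv1 wv1 -> term c W tv2 wv2 ->
  edef c W (fun ts => gcomp (u2 (tu2 ts)) (u1 (tu1 ts)) = gcomp (v2 (tv2 ts)) (v1 (tv1 ts))).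
Proof.
move=> du1 du2 dv1 dv2 hu1 hu2 hv1 hv2.
have comp w1 w2 wY0 f1 f2 t1 t2 : definable3 w1 wX wY0 f1 -> definable3 w2 wY0 wZ f2 ->
    term c W t1 w1 -> term c W t2 w2 ->
    edef c (wZ :: wX :: W) (fun ts => exists y, typed wY0 y /\
      (f1 (t1 (behead (behead ts))) (head [::] (behead ts)) y /\
       f2 (t2 (behead (behead ts))) y (head [::] ts))).
  move=> d1 d2 h1 h2; apply: edef_ex.
  have tx : term c [:: wY0, wZ, wX & W] (fun ts => head [::] (behead (behead ts))) wX.
    exact: term_behead (term_behead _ (term_head _ _ _)).
  have tz : term c [:: wY0, wZ, wX & W] (fun ts => head [::] (behead ts)) wZ.
    by apply: term_behead; exact: term_head.
  apply: edef_and.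
    apply: edef_definable3 d1 _ tx (term_head _ _ _).
    exact: term_behead (term_behead _ (term_behead _ h1)).
  apply: edef_definable3 d2 _ (term_head _ _ _) tz.
  exact: term_behead (term_behead _ (term_behead _ h2)).
have := edef_all (Q := fun ts x => forall z, typed wZ z ->
   ((exists y, typed wY y /\ (u1 (tu1 ts) x y /\ u2 (tu2 ts) y z)) <->
    (exists y, typed wY' y /\ (v1 (tv1 ts) x y /\ v2 (tv2 ts) y z)))).
move=> /(_ c W wX) H; apply: edef_ext (H _); last first.
  apply: edef_all; apply: edef_iff; first exact: comp du1 du2 hu1 hu2.
  exact: comp dv1 dv2 hv1 hv2.
move=> ts _; split=> [E|E x xw z zw].
  apply: graph_ext => x z; split=> -[y h1 h2].
    have [[_ xw yw] [_ _ zw]] := (du1.1 _ _ _ h1, du2.1 _ _ _ h2).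
    by have [|y' [_ [? ?]]] := (E x xw z zw).1; [exists y|exists y'].
  have [[_ xw yw] [_ _ zw]] := (dv1.1 _ _ _ h1, dv2.1 _ _ _ h2).
  by have [|y' [_ [? ?]]] := (E x xw z zw).2; [exists y|exists y'].
have Exz : gcomp (u2 (tu2 ts)) (u1 (tu1 ts)) x z = gcomp (v2 (tv2 ts)) (v1 (tv1 ts)) x z.
  by rewrite E.
split=> -[y [_ [h1 h2]]].
  have : gcomp (v2 (tv2 ts)) (v1 (tv1 ts)) x z by rewrite -Exz; exists y.
  by move=> [y' h3 h4]; exists y'; have [_ _ ?] := dv1.1 _ _ _ h3.
have : gcomp (u2 (tu2 ts)) (u1 (tu1 ts)) x z by rewrite Exz; exists y.
by move=> [y' h3 h4]; exists y'; have [_ _ ?] := du1.1 _ _ _ h3.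
Qed.

End GcompDef.

(** * Gluing trivialisations *)

Section Coherent.
Variables (U : structure) (Aw : seq (sorts U)) (A : set (tup U)).
Variables (V : extension U unit) (p : nelt V -> tup U).
Variables (G : simplicial_groupoid Aw A)
  (G' : simplicial_groupoid (eq_word_of V Aw) (@eq_tup U V @` A))
  (eO eI : nat -> tup U -> tup (Meq V))
  (new : set (tup U) -> tup (Meq V))
  (theta : nat -> tup (Meq V) -> nelt V).
Hypothesis B : @binding_pair U Aw A V p G G' eO eI new theta.
Variable Q : commuting_system G.
Hypotheses (Vsat : saturated V) (pA : range p = A).

Let triv := trivialisation G' eO eI new theta Q.
Let restr := restricts p Q.
Let X := {a : tup U | A a}.
Let T := nelt V -> tup U -> Prop.
Let F0 : T := fun _ _ => False.

Definition base_set (c : set X) : set (tup U) := [set sval a | a in c].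

(** Coherence of the chosen values [F a] for [a] in [c]: they all come from one trivialisation over
    [c]. The empty set is a separate case, since there is no object over it. *)
Definition glue (c : set X) (F : X -> T) : Prop := c = set0 \/ exists n H,
  [/\ nsubsets A n.+1 (base_set c), triv n (base_set c) H &
      forall a, c a -> triv 0 [set sval a] (F a) /\
        restr [set sval a] (base_set c) (F a) H].

Lemma base_set_nsubsets c : finite_set c -> c !=set0 ->
  exists n, nsubsets A n.+1 (base_set c).
Proof.
move=> cf [a ca]; apply: nsubsets_of_finite; first exact: finite_image.
  by move=> _ [b _ <-]; exact: svalP.
by exists (sval a), a.
Qed.

Lemma sval_nsubsets (a : X) : nsubsets A 1 [set sval a].
Proof. exact: nsubsets1 (svalP a). Qed.

Lemma base_set_sub c d : c `<=` d -> base_set c `<=` base_set d.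
Proof. by move=> cd _ [a /cd da <-]; exists a. Qed.

Lemma base_set1 c a : c a -> [set sval a] `<=` base_set c.
Proof. by move=> ca _ ->; exists a. Qed.

Lemma glue_ext c F F' : (forall a, c a -> F a = F' a) -> glue c F -> glue c F'.
Proof.
move=> FF' [->|[n [H [cn tH rH]]]]; first by left.
by right; exists n, H; split=> // a ca; rewrite -FF' //; exact: rH.
Qed.

(** The restriction of [H] to [c] restricts further to each [a], where it has to be [F a] because
    restrictions of [H] are unique. *)
Lemma glue_down (c d : set X) F n m H : c `<=` d -> nsubsets A n.+1 (base_set c) ->
  nsubsets A m.+1 (base_set d) -> triv m (base_set d) H ->
  (forall a, d a -> triv 0 [set sval a] (F a) /\ restr [set sval a] (base_set d) (F a) H) ->
  exists H', [/\ triv n (base_set c) H', restr (base_set c) (base_set d) H' H &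
    forall a, c a -> restr [set sval a] (base_set c) (F a) H'].
Proof.
move=> cd cn dm tH rF; have cds := base_set_sub cd.
have [H' tH' rH'] := restricts_down B cn dm cds tH.
exists H'; split=> // a ca; have [tF rFa] := rF a (cd a ca).
have ac := base_set1 ca; have a1 := sval_nsubsets a.
have [K tK rK] := restricts_down B a1 cn ac tH'.
suff -> : F a = K by [].
apply: (restricts_uniq B a1 dm (subset_trans ac cds) tF tK rFa).
exact: restricts_trans a1 cn dm ac cds rK rH'.
Qed.

Lemma glue_sub c d F : finite_set d -> c `<=` d -> glue d F -> glue c F.
Proof.
move=> df cd [d0|[m [H [dm tH rH]]]]; first by left; apply/seteqP; split=> // x /cd; rewrite d0.
have [->|/set0P c0] := eqVneq c set0; first by left.
have [n cn] := base_set_nsubsets (sub_finite_set cd df) c0.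
have [H' [tH' _ rH']] := glue_down cd cn dm tH rH.
right; exists n, H'; split=> // a ca; split; last exact: rH'.
by have [] := rH a (cd a ca).
Qed.

(** Every point of [S_c] lies over some [a] in [c], and its image is then forced by [F a] and the
    inclusion of [O_a] in [O_c]. *)
Lemma glue_uniq c F n H K : nsubsets A n.+1 (base_set c) -> triv n (base_set c) H ->
  triv n (base_set c) K -> (forall a, c a -> restr [set sval a] (base_set c) (F a) H) ->
  (forall a, c a -> restr [set sval a] (base_set c) (F a) K) -> H = K.
Proof.
move=> cn tH tK rH rK.
suff sub L L' : triv n (base_set c) L -> triv n (base_set c) L' ->
    (forall a, c a -> restr [set sval a] (base_set c) (F a) L) ->
    (forall a, c a -> restr [set sval a] (base_set c) (F a) L') ->
    forall s o, L s o -> L' s o.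
  by apply: graph_ext => s o; split; apply: sub.
move=> tL tL' rL rL' s o Lso.
have /is_bijectionE[Lin _ _ _ _] := trivialisation_bij B cn tL.
have [[a ca ap] _] := Lin _ _ Lso.
by apply/(rL' a ca) => //; apply/(rL a ca).
Qed.

(** * The choice at one new point *)

Section Step.
Variables (a : X) (F : X -> T).

Lemma update_neq w b : b <> a -> update F a w b = F b.
Proof. by rewrite /update; case: pselect. Qed.

Lemma update_eq w : update F a w a = w.
Proof. by rewrite /update; case: pselect. Qed.

(** A trivialisation gluing [F] over [c] is lifted to [c] with [a] added, and then restricted to
    [a]. This is the non-emptiness of a single condition. *)
Lemma glue_step_exists c : finite_set c -> ~ c a -> glue c F ->
  exists2 w, triv 0 [set sval a] w & glue (a |` c) (update F a w).
Proof.
move=> cf nca gc; have a1 := sval_nsubsets a.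
have [c0|/set0P c0] := eqVneq c set0.
  have [w tw] := trivialisation_exists B Q a1; exists w => //.
  have bE : base_set (a |` c) = [set sval a].
    rewrite c0 setU0; apply/seteqP; split=> [_ [_ -> <-]//|_ ->]; by exists a.
  right; exists 0, w; rewrite bE; split=> // b; rewrite c0 setU0 => ->.
  by rewrite update_eq; split=> //; exact: restricts_refl.
case: gc => [c0'|[n [H [cn tH rH]]]]; first by case: c0 => x; rewrite c0'.
have [|m dm] := @base_set_nsubsets (a |` c) _ (ex_intro _ a (or_introl erefl)).
  by rewrite finite_setU; split; [exact: finite_set1|].
have cd : base_set c `<=` base_set (a |` c) by apply: base_set_sub => x; right.
have ad : [set sval a] `<=` base_set (a |` c) by apply: base_set1; left.
have [Hd tHd rHd] := restricts_lift B cn dm cd tH.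
have [w tw rw] := restricts_down B a1 dm ad tHd.
exists w => //; right; exists m, Hd; split=> // b [->|cb]; first by rewrite update_eq.
have ba : b <> a by move=> ba; apply: nca; rewrite -ba.
rewrite update_neq //; have [tb rb] := rH b cb; split=> //.
exact: restricts_trans (sval_nsubsets b) cn dm (base_set1 cb) cd rb rHd.
Qed.

Let i1 := new [set sval a].
Let i2 := eI 0 (cobj Q [set sval a]).
Let wM := Mw (sgpd G' 0).
Let toF (t : tup (Meq V)) : T :=
  to_triv G' eO new theta Q 0 [set sval a] (Graph (sgpd G' 0) t).

Definition step_set (c : set X) (t : tup (Meq V)) : Prop :=
  hom_code (sgpd G' 0) i1 i2 t /\ glue (a |` c) (update F a (toF t)).

(** A morphism [t] at [a] is admissible when some morphism [t'] over [c] with [a] added makes two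
    squares commute, one with the trivialisation already glued over [c] and one with [t]. The second
    existential keeps the condition first-order. *)
Lemma step_set_edef c : finite_set c -> ~ c a -> glue c F ->
  exists d, edef d [:: wM] (fun ts => step_set c (head [::] ts)).
Proof.
move=> cf nca gc; have a1 := sval_nsubsets a.
have i1i : Idx (sgpd G' 0) i1 := new_idx B a1.
have i2i : Idx (sgpd G' 0) i2 := eI_idx B (cobj_idx Q a1).
have [c0|/set0P c0] := eqVneq c set0.
  exists (i1 ++ i2).
  have /edef_ext : edef (i1 ++ i2) [:: wM]
      (fun ts => hom_code (sgpd G' 0) i1 i2 (head [::] ts)).
    apply: edef_hom_code => //; first exact: term_head.
      by move=> x ?; apply/List.in_or_app; left.
    by move=> x ?; apply/List.in_or_app; right.
  apply=> ts _; split=> [ht|[]//]; split=> //; right; exists 0, (toF (head [::] ts)).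
  have bE : base_set (a |` c) = [set sval a].
    rewrite c0 setU0; apply/seteqP; split=> [_ [_ -> <-]//|_ ->]; by exists a.
  have tt : triv 0 [set sval a] (toF (head [::] ts)).
    by exists (Graph (sgpd G' 0) (head [::] ts)) => //; apply/HomE; exists (head [::] ts).
  rewrite bE; split=> // b; rewrite c0 setU0 => ->.
  by rewrite update_eq; split=> //; exact: restricts_refl.
case: gc => [c0'|[n [H [cn tH rH]]]]; first by case: c0 => x; rewrite c0'.
have [|m dm] := @base_set_nsubsets (a |` c) _ (ex_intro _ a (or_introl erefl)).
  by rewrite finite_setU; split; [exact: finite_set1|].
have cd : base_set c `<=` base_set (a |` c) by apply: base_set_sub => x; right.
have ad : [set sval a] `<=` base_set (a |` c) by apply: base_set1; left.
have nac : ~ base_set c (sval a).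
  by move=> [b cb /sval_injective ba]; apply: nca; rewrite -ba.
have ncd : base_set c <> base_set (a |` c).
  by move=> e; apply: nac; rewrite e; exists a => //; left.
have nad : [set sval a] <> base_set (a |` c).
  move=> e; have [b cb] := c0; have : base_set (a |` c) (sval b) by exists b => //; right.
  by rewrite -e => ba; apply: nac; exists b.
have nm := nsubsets_lt cn dm cd ncd.
have om := nsubsets_lt a1 dm ad nad.
have [h /HomE[m0 hm0 he] HE] := tH; subst h.
set d := base_set (a |` c) in dm cd ad ncd nad nm om *.
pose j1 := new d; pose j2 := eI m (cobj Q d).
have j1i : Idx (sgpd G' m) j1 := new_idx B dm.
have j2i : Idx (sgpd G' m) j2 := eI_idx B (cobj_idx Q dm).
have [q1 Fq1 [q1E _]] := cinc'_maps B Q nm cn dm cd.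
have [q2 Fq2 [q2E _]] := sinc'_maps B nm cn dm cd.
have [r1 Fr1 [r1E _]] := cinc'_maps B Q om a1 dm ad.
have [r2 Fr2 [r2E _]] := sinc'_maps B om a1 dm ad.
(* The parameters: the ends of [t] and of [t'], the code [m0] of the trivialisation over [c], and
   the codes of four inclusions, of chosen and of added objects, from [c] ([q1], [q2]) and from [a]
   ([r1], [r2]). *)
pose par := i1 ++ i2 ++ j1 ++ j2 ++ m0 ++ q1 ++ q2 ++ r1 ++ r2.
exists par.
pose E (t t' : tup (Meq V)) :=
  gcomp (FGraph (Defs.incl G' nm) q1) (Graph (sgpd G' n) m0) =
    gcomp (Graph (sgpd G' m) t') (FGraph (Defs.incl G' nm) q2) /\
  gcomp (FGraph (Defs.incl G' om) r1) (Graph (sgpd G' 0) t) =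
    gcomp (Graph (sgpd G' m) t') (FGraph (Defs.incl G' om) r2).
have /edef_ext : edef par [:: wM] (fun ts => hom_code (sgpd G' 0) i1 i2 (head [::] ts) /\
    exists t', typed (Mw (sgpd G' m)) t' /\ (hom_code (sgpd G' m) j1 j2 t' /\ E (head [::] ts) t')).
  have inpar x (l1 l2 l3 : tup (Meq V)) : List.In x l2 -> List.In x (l1 ++ l2 ++ l3).
    by move=> ?; apply/List.in_or_app; right; apply/List.in_or_app; left.
  apply: edef_and.
    apply: edef_hom_code => //; first exact: term_head.
      by move=> x xi; exact: (inpar x [::]).
    by move=> x xi; exact: (inpar x i1).
  apply: edef_ex; apply: edef_and.
    apply: edef_hom_code => //; first exact: term_head.
      by move=> x xi; rewrite /par catA; exact: inpar.
    by move=> x xi; rewrite /par 2!catA; exact: inpar.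
  have Mor_typed k t : Mor (sgpd G' k) t -> typed (Mw (sgpd G' k)) t.
    exact: (Mor_definable (sgpd G' k)).1.
  have Fam_typed k l (kl : (k < l)%N) q : Fam (Defs.incl G' kl) q ->
      typed (Fw (Defs.incl G' kl)) q.
    exact: (Fam_definable (Defs.incl G' kl)).1.
  have tt' := term_head par (Mw (sgpd G' m)) [:: wM].
  have tt := term_behead (Mw (sgpd G' m)) (term_head par wM [::]).
  apply: edef_and.
    apply: (edef_gcomp (u1 := Graph (sgpd G' n)) (u2 := FGraph (Defs.incl G' nm))
      (v1 := FGraph (Defs.incl G' nm)) (v2 := Graph (sgpd G' m)) (tu1 := fun=> m0)
      (tu2 := fun=> q1) (tv1 := fun=> q2) (tv2 := head [::])
      (Graph_definable _) (FGraph_definable _) (FGraph_definable _) (Graph_definable _)) => //.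
    - apply: term_cst; first exact: (Mor_typed _ _ hm0.1).
      by move=> x xi; rewrite /par 3!catA; exact: inpar.
    - apply: term_cst; first exact: Fam_typed.
      by move=> x xi; rewrite /par 4!catA; exact: inpar.
    - apply: term_cst; first exact: Fam_typed.
      by move=> x xi; rewrite /par 5!catA; exact: inpar.
  apply: (edef_gcomp (u1 := Graph (sgpd G' 0)) (u2 := FGraph (Defs.incl G' om))
      (v1 := FGraph (Defs.incl G' om)) (v2 := Graph (sgpd G' m))
      (tu1 := fun ts => head [::] (behead ts))
      (tu2 := fun=> r1) (tv1 := fun=> r2) (tv2 := head [::])
      (Graph_definable _) (FGraph_definable _) (FGraph_definable _) (Graph_definable _)) => //.
  - apply: term_cst; first exact: Fam_typed.
    by move=> x xi; rewrite /par 6!catA; exact: inpar.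
  - apply: term_cst; first exact: Fam_typed.
    move=> x xi; rewrite /par 7!catA; apply/List.in_or_app; right; exact: xi.
apply=> ts _; set t := head [::] ts; split=> [[ht [t' [_ [ht' [E1 E2]]]]]|[ht gt]].
  have ht_ : Hom (sgpd G' 0) i1 i2 (Graph (sgpd G' 0) t) by apply/HomE; exists t.
  have ht'_ : Hom (sgpd G' m) j1 j2 (Graph (sgpd G' m) t') by apply/HomE; exists t'.
  have hm0_ : Hom (sgpd G' n) (new (base_set c)) (eI n (cobj Q (base_set c)))
    (Graph (sgpd G' n) m0) by apply/HomE; exists m0.
  move: E1 E2; rewrite -q1E -q2E -r1E -r2E => /(restrictsE B cn dm cd ncd hm0_ ht'_) R1.
  move=> /(restrictsE B a1 dm ad nad ht_ ht'_) R2.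
  split=> //; right; exists m, (to_triv G' eO new theta Q m d (Graph (sgpd G' m) t')).
  split=> //; first by exists (Graph (sgpd G' m) t').
  move=> b [->|cb].
    by rewrite update_eq; split=> //; exists (Graph (sgpd G' 0) t).
  have ba : b <> a by move=> ba; apply: nca; rewrite -ba.
  rewrite update_neq //; have [tb rb] := rH b cb; split=> //.
  rewrite HE in rb.
  exact: restricts_trans (sval_nsubsets b) cn dm (base_set1 cb) cd rb R1.
split=> //; case: gt => [e|[m' [K [dm' tK rK]]]].
  by have : set0 a by rewrite -e; left.
have mm' : m' = m by exact: nsubsets_eq dm' dm.
subst m'; have [k /HomE[t' ht' ke] KE] := tK; subst k.
have ht_ : Hom (sgpd G' 0) i1 i2 (Graph (sgpd G' 0) t) by apply/HomE; exists t.
have ht'_ : Hom (sgpd G' m) j1 j2 (Graph (sgpd G' m) t') by apply/HomE; exists t'.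
have hm0_ : Hom (sgpd G' n) (new (base_set c)) (eI n (cobj Q (base_set c)))
  (Graph (sgpd G' n) m0) by apply/HomE; exists m0.
exists t'; split; first by case: ht' => /((Mor_definable (sgpd G' m)).1).
split=> //; split; rewrite -?q1E -?q2E -?r1E -?r2E.
  apply/(restrictsE B cn dm cd ncd hm0_ ht'_); rewrite -KE -HE.
  (* The gluing [K] found over the larger set is a priori unrelated to the fixed [H]; its
     restriction to [c] glues the same values of [F], hence is [H] by uniqueness. *)
  have csub : c `<=` a |` c by move=> x; right.
  have [H' [tH' rH' rH'a]] := glue_down csub cn dm tK rK.
  suff -> : H = H' by [].
  apply: (glue_uniq cn tH tH' _ rH'a) => b cb; have [_ rb] := rH b cb.
  rewrite update_neq // => ba; apply: nca; rewrite -ba //.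
apply/(restrictsE B a1 dm ad nad ht_ ht'_); rewrite -KE.
by have [_] := rK a (or_introl erefl); rewrite update_eq.
Qed.

(** The conditions are indexed by the finite lists over [I]. Each is non-empty and they are
    directed, so a value good for all of them exists once their parameters are fewer than the
    elements of [V]. *)
Lemma glue_step (I : set X) : ~ I a ->
  infinite_set I -> ~ ([set: elt V] #<= I) -> infinite_set [set: elt V] ->
  (forall c, finite_set c -> c `<=` I -> glue c F) ->
  exists w, forall c, finite_set c -> c `<=` I -> glue (a |` c) (update F a w).
Proof.
move=> nIa Iinf Ismall Vinf gI.
pose J := {l : seq X | forall b, List.In b l -> I b}.
pose ls (l : seq X) : set X := [set b | List.In b l].
have lsf l : finite_set (ls l) by apply/finite_list; exists l.
have nla (j : J) : ~ ls (sval j) a by move=> /(svalP j).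
have gl (j : J) : glue (ls (sval j)) F by apply: gI => // b; exact: (svalP j).
have /choice[par parP] : forall l : seq X, exists d, (forall b, List.In b l -> I b) ->
    edef d [:: wM] (fun ts => step_set (ls l) (head [::] ts)).
  move=> l; have [lI|?] := pselect (forall b, List.In b l -> I b); last by exists [::].
  have [d dP] := @step_set_edef (ls l) (lsf l) (nla (exist _ l lI)) (gl (exist _ l lI)).
  by exists d.
have [K KP] := Meq_saturated_words V.
have j0 : J by exists [::].
have sub (j : J) l t : ls l `<=` ls (sval j) -> step_set (ls (sval j)) t -> step_set (ls l) t.
  move=> lj [ht gt]; split=> //; apply: glue_sub gt.
    by rewrite finite_setU; split; [exact: finite_set1|exact: lsf].
  by move=> b [->|/lj]; [left|right].
have [||||t [tw tP]] := KP wM J j0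
  (fun j t => step_set (ls (sval j)) t) (fun j => par (sval j)) Vsat Vinf.
(* Each list contributes finitely many parameters, and [K] replaces each of these imaginaries by a
   finite tuple; in all there are at most as many as elements of the infinite set [I]. *)
- move=> bad; apply: Ismall; apply: card_le_trans bad _.
  apply: card_le_trans _ (card_bigcup_seq (fun l => flatten (map K (par l))) Iinf).
  apply: subset_card_le => x [j xj]; exists (sval j) => //; exact: (svalP j).
- by move=> j; exact: parP (svalP j).
(* The concatenation of two lists gives a condition that implies both, by [glue_sub]. *)
- move=> j j'; have h b : List.In b (sval j ++ sval j') -> I b.
    by move=> hb; have [/(svalP j _)|/(svalP j' _)] := List.in_app_or _ _ _ hb.
  exists (exist _ (sval j ++ sval j') h) => t _ st; split.
    by apply: (sub (exist _ (sval j ++ sval j') h)) => // b ?; apply/List.in_or_app; left.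
  by apply: (sub (exist _ (sval j ++ sval j') h)) => // b ?; apply/List.in_or_app; right.
- move=> j; have [w [h /HomE[t ht he] ->] gw] := glue_step_exists (lsf _) (nla j) (gl j).
  subst h; exists t; split; first by case: ht => /((Mor_definable (sgpd G' 0)).1).
  by split.
exists (toF t) => c /finite_list[l ->] lI.
by have [] := tP (exist _ l lI).
Qed.

End Step.

Lemma glue_exists : exists F : X -> T, forall c, finite_set c -> glue c F.
Proof.
have [R [Rwf Rtot Rtr Rsmall]] := initial_well_order X.
(* As [p] maps onto [A], the set [A] is no larger than [V]; a segment into which [V] embeds would
   receive all of [A], against [Rsmall]. *)
have XV : [set: X] #<= [set: elt V].
  apply/card_leE; exists (fun x v => exists2 s, v = inr s & p s = sval x).
  split=> [x _|x x' v _ _ [s -> sx] [s' [<-] s'x']]; last by apply: sval_injective; rewrite /= -sx.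
  have [s _ sx] : range p (sval x) by rewrite pA; exact: svalP.
  by exists (inr s) => //; exists s.
apply: (transfinite_choice Rwf Rtot Rtr F0).
- exact: glue_ext.
- by move=> F; left.
move=> a F gF.
have nRaa : ~ R a a.
  by elim/(well_founded_ind Rwf): (a) => x IH xx; exact: (IH x xx xx).
(* If the segment is finite, the condition for the whole segment implies all the others, and a
   single extension suffices. *)
have [Ifin|Iinf] := pselect (finite_set [set y | R y a]).
  have [w _ gw] := glue_step_exists Ifin nRaa (gF _ Ifin (@subset_refl _ _)).
  exists w => c cf cI; apply: glue_sub gw.
    by rewrite finite_setU; split; [exact: finite_set1|].
  by move=> b [->|/cI]; [left|right].
apply: (@glue_step a F [set y | R y a]) => //.
- by move=> VI; apply: (Rsmall a); exact: card_le_trans XV VI.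
- move=> Vf; apply: Iinf; apply: card_le_finite Vf.
  by apply: card_le_trans XV; exact: card_leT.
Qed.

End Coherent.

(** * Interpreting the associated cover *)

Section Star.
Variables (U : structure) (Aw : seq (sorts U)) (A : set (tup U)).
Variables (V : extension U unit) (p : nelt V -> tup U).
Variables (G : simplicial_groupoid Aw A)
  (G' : simplicial_groupoid (eq_word_of V Aw) (@eq_tup U V @` A))
  (eO eI : nat -> tup U -> tup (Meq V))
  (new : set (tup U) -> tup (Meq V))
  (theta : nat -> tup (Meq V) -> nelt V).
Hypothesis B : @binding_pair U Aw A V p G G' eO eI new theta.
Variable Q : commuting_system G.

Let triv := trivialisation G' eO eI new theta Q.

(** [eta] sends [s] to its image under the trivialisation of its own fibre, placed in the copy over
    [p s]. It is bijective fibre by fibre, and on [S_c] its composite with [star_map c] is the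
    trivialisation that glues these fibres. *)
Lemma trivialising_map_exists : saturated V -> range p = A ->
  exists eta : nelt V -> Ostar Q, [/\ bijective eta, (forall s, star_proj (eta s) = p s) &
    forall n c, nsubsets A n.+1 c -> triv n c (fun s o => star_map c (eta s) o)].
Proof.
move=> Vsat pA; have [F FP] := glue_exists B Q Vsat pA.
have Ap s : A (p s) by rewrite -pA; exists s.
pose pt s : {a | A a} := exist _ (p s) (Ap s).
have b1 (a : {a | A a}) : base_set [set a] = [set sval a].
  by apply/seteqP; split=> [_ [_ -> <-]//|_ ->]; exists a.
have F1 a : triv 0 [set sval a] (F a).
  have [e|[n [H [_ _ /(_ a erefl)[]//]]]] := FP [set a] (finite_set1 a).
  by have : set0 a by rewrite -e.
have Fbij a := trivialisation_bij B (nsubsets1 (svalP a)) (F1 a).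
have /choice[o oP] : forall s, exists o, F (pt s) s o.
  by move=> s; have /is_bijectionE[_ Ft _ _ _] := Fbij (pt s); apply: Ft.
have oo s : object (sgpd G 0) (cobj Q [set p s]) (o s).
  by have /is_bijectionE[Fi _ _ _ _] := Fbij (pt s); have [] := Fi _ _ (oP s).
pose eta s : Ostar Q := exist _ (p s, o s) (conj (Ap s) (oo s)).
exists eta; split=> //.
  have eta_inj : injective eta.
    move=> s s' [ps os]; have /is_bijectionE[_ _ _ _ Finj] := Fbij (pt s).
    apply: (Finj _ _ (o s)); first exact: oP.
    suff -> : pt s = pt s' by rewrite os; exact: oP.
    exact: sval_injective.
  have eta_surj y : exists s, eta s = y.
    case: y => [[a x] [/= Aa ax]].
    have /is_bijectionE[Fi _ Fs Ff _] := Fbij (exist _ a Aa).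
    have [s Fsx] := Fs x ax; exists s; apply: sval_injective => /=.
    have [/= ps _] := Fi _ _ Fsx.
    have e : pt s = exist _ a Aa by exact: sval_injective.
    by congr pair => //; apply: Ff _ Fsx; rewrite -e.
  have [g gP] := choice eta_surj; exists g => // s; exact: eta_inj.
move=> n c cn; pose c' := [set a : {a | A a} | c (sval a)].
have c'E : base_set c' = c.
  apply/seteqP; split=> [_ [a ca <-]//|a ca].
  by exists (exist _ a (cn.1 a ca)).
have c'f : finite_set c'.
  apply: card_le_finite (nsubsets_finite cn).
  by apply: (card_le_fun (f := sval)) => // x y _ _; exact: sval_injective.
have [e|[m [H [cm tH rH]]]] := FP c' c'f.
  have [a ca] := nsubsets_ne cn.
  by have : set0 (exist _ a (cn.1 a ca)) by rewrite -e.
rewrite c'E in cm tH rH; rewrite (nsubsets_eq cn cm) /triv.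
suff <- : H = (fun s x => star_map c (eta s) x) by [].
apply: graph_ext => s x.
have [cs|ncs] := pselect (c (p s)); last first.
  have /is_bijectionE[Hi _ _ _ _] := trivialisation_bij B cm tH.
  by split=> [/Hi[]|[]].
have [_ /(_ s x erefl) ->] := rH (pt s) cs.
have /is_bijectionE[_ _ _ Ff _] := Fbij (pt s).
split=> [[z Fz h]|[_ h]]; first by split=> //; rewrite -(Ff _ _ _ Fz (oP s)).
by exists (o s).
Qed.

Variable eta : nelt V -> Ostar Q.
Hypotheses (eta_bij : bijective eta) (eta_p : forall s, star_proj (eta s) = p s).
Hypothesis eta_triv : forall n c, nsubsets A n.+1 c ->
  triv n c (fun s o => star_map c (eta s) o).

Lemma eta_inj : injective eta. Proof. exact: bij_inj. Qed.

Lemma eta_surj y : exists s, eta s = y.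
Proof. by case: eta_bij => g _ gK; exists (g y). Qed.

Implicit Types (k l : tup U + set (tup U)).

Definition ix n k : tup (Meq V) := match k with inl i => eI n i | inr c => new c end.

Definition new_point n (x' : tup (Meq V)) : Prop :=
  exists2 c, nsubsets A n.+1 c & object (sgpd G' n) (new c) x'.

(* The points of the objects of G' and of the groupoid with the objects O_{*,c}
   correspond through eO and eta. *)
Definition same_point n (x : tup U + Ostar Q) (x' : tup (Meq V)) : Prop :=
  match x with
  | inl o => Obj (sgpd G n) o /\ x' = eO n o
  | inr y => new_point n x' /\ eta (theta n x') = y
  end.

Lemma ix_idx n k : is_index G n k -> Idx (sgpd G' n) (ix n k).
Proof. by case: k => [i|c] /=; [exact: (eI_idx B)|exact: (new_idx B)]. Qed.

Lemma idx_ix n i : Idx (sgpd G' n) i -> exists2 k, is_index G n k & ix n k = i.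
Proof.
by rewrite (Idx_ext B) => -[[j Ij <-]|[c cn <-]]; [exists (inl j)|exists (inr c)].
Qed.

Lemma under_idx n k : is_index G n k -> Idx (sgpd G n) (under Q k).
Proof. by case: k => [i|c] //=; exact: cobj_idx. Qed.

Lemma old_point n o : Obj (sgpd G n) o ->
  Idx (sgpd G n) (idx (sgpd G n) o) /\ object (sgpd G' n) (eI n (idx (sgpd G n) o)) (eO n o).
Proof.
move=> Oo; have Io : Idx (sgpd G n) (idx (sgpd G n) o) by rewrite -idx_surj; exists o.
by split=> //; apply/(eO_object B _ Io); exists o.
Qed.

Lemma new_pointP n k x' : is_index G n k -> object (sgpd G' n) (ix n k) x' ->
  (new_point n x' <-> is_new k).
Proof.
case: k => [i|c] /= ki kx'; last by split=> // _; exists c.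
split=> // -[c cn cx']; have e := object_eq kx' cx'.
by case: (new_fresh B cn); exists i.
Qed.

(** The map from an object to the object of [G] below it corresponds to a morphism of [G']: an
    identity for an old object, and for a new one the trivialisation provided by [eta_triv]. *)
Lemma to_under_hom n k : is_index G n k -> exists2 K,
  Hom (sgpd G' n) (ix n k) (eI n (under Q k)) K &
  forall x o, to_under n k x o <-> exists x', [/\ same_point n x x',
    object (sgpd G' n) (ix n k) x', object (sgpd G n) (under Q k) o & K x' (eO n o)].
Proof.
case: k => [i|c] /= ki.
  have Ii := eI_idx B ki.
  exists (gid (object (sgpd G' n) (eI n i))); first exact: Hom_id.
  case=> [x|y] o; split=> //.
  - move=> [ix xo]; subst o; have [Ox _] := ix.
    have Ex : object (sgpd G' n) (eI n i) (eO n x) by apply/(eO_object B _ ki); exists x.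
    by exists (eO n x); split.
  - move=> [_ [[Ox ->] ix io [_ e]]]; have /(eO_object B _ ki)[z iz ze] := ix.
    have xz : z = x by apply: (eO_injective B iz (conj Ox erefl)).
    by subst z; split=> //; exact: (eO_injective B iz io e).
  - move=> [x' [[[c cn cx'] _] ix' _ _]].
    by case: (new_fresh B cn); exists i => //; exact: object_eq ix' cx'.
have [h hh hE] := eta_triv ki; exists h => //.
case=> [x|y] o; split=> //.
- move=> [x' [[Ox x'e] cx' _ _]]; have [Ii ox] := old_point Ox.
  case: (new_fresh B ki); exists (idx (sgpd G n) x) => //.
  by apply: object_eq cx'; rewrite x'e.
- have [s <-] := eta_surj y.
  have -> : star_map c (eta s) o = to_triv G' eO new theta Q n c h s o by rewrite -hE.
  move=> [x [cx xs co hx]]; exists x; split=> //.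
  by split; [exists c|rewrite xs].
- move=> [x' [[_ <-] cx' co hx']].
  have -> : star_map c (eta (theta n x')) o =
    to_triv G' eO new theta Q n c h (theta n x') o by rewrite -hE.
  by exists x'.
Qed.

(** * Morphisms and inclusions together: [HU] is the family in [G], [HM] the one in [G'] *)

Section Family.
Variables (n m : nat) (HU : tup U -> tup U -> set (tup U -> tup U -> Prop))
  (HM : tup (Meq V) -> tup (Meq V) -> set (tup (Meq V) -> tup (Meq V) -> Prop)).
Hypothesis HM_dom : forall i j f x y, HM i j f -> f x y ->
  object (sgpd G' n) i x /\ object (sgpd G' m) j y.
Hypothesis HM_total : forall i j f x, HM i j f -> object (sgpd G' n) i x -> exists y, f x y.
Hypothesis HM_old : forall i j, Idx (sgpd G n) i -> Idx (sgpd G m) j ->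
  HM (eI n i) (eI m j) =
  [set gtransport (object (sgpd G n) i) (object (sgpd G m) j) (eO n) (eO m) f | f in HU i j].
Hypothesis HM_pre : forall i i' j f u, Idx (sgpd G' n) i -> Idx (sgpd G' n) i' ->
  Idx (sgpd G' m) j -> HM i j f -> Hom (sgpd G' n) i' i u -> HM i' j (gcomp f u).
Hypothesis HM_post : forall i j j' f v, Idx (sgpd G' n) i -> Idx (sgpd G' m) j ->
  Idx (sgpd G' m) j' -> HM i j f -> Hom (sgpd G' m) j j' v -> HM i j' (gcomp v f).

Definition star_graph (g : tup (Meq V) -> tup (Meq V) -> Prop) :
    tup U + Ostar Q -> tup U + Ostar Q -> Prop :=
  fun x y => exists x' y', [/\ same_point n x x', same_point m y y' & g x' y'].

Lemma star_graph_eq k l g u K L : is_index G n k -> is_index G m l ->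
  Hom (sgpd G' n) (ix n k) (eI n (under Q k)) K ->
  (forall x o, to_under n k x o <-> exists x', [/\ same_point n x x',
    object (sgpd G' n) (ix n k) x', object (sgpd G n) (under Q k) o & K x' (eO n o)]) ->
  Hom (sgpd G' m) (ix m l) (eI m (under Q l)) L ->
  (forall x o, to_under m l x o <-> exists x', [/\ same_point m x x',
    object (sgpd G' m) (ix m l) x', object (sgpd G m) (under Q l) o & L x' (eO m o)]) ->
  (forall x y, g x y -> object (sgpd G' n) (ix n k) x /\ object (sgpd G' m) (ix m l) y) ->
  (forall x y o o', K x (eO n o) -> L y (eO m o') -> object (sgpd G n) (under Q k) o ->
     object (sgpd G m) (under Q l) o' -> (g x y <-> u o o')) ->
  star_graph g = gcomp (gconv (to_under m l)) (gcomp u (to_under n k)).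
Proof.
move=> ki li /Hom_bij/is_bijectionE[Ki Kt _ _ _] Ku.
move=> /Hom_bij/is_bijectionE[Li Lt _ _ _] Lu gdom gu.
have uk := under_idx ki; have ul := under_idx li.
apply: graph_ext => x y; split=> [[x' [y' [xx' yy' gxy]]]|].
  have [kx' ly'] := gdom _ _ gxy.
  have [w Kw] := Kt _ kx'; have [_ /(eO_object B _ uk)[o ko oe]] := Ki _ _ Kw; subst w.
  have [w Lw] := Lt _ ly'; have [_ /(eO_object B _ ul)[o' lo' oe]] := Li _ _ Lw; subst w.
  exists o'; last by apply/Lu; exists y'.
  by exists o; [apply/Ku; exists x'|apply/(gu x' y')].
move=> [o' [o /Ku[x' [xx' kx' ko Kx']] uoo'] /Lu[y' [yy' ly' lo' Ly']]].
by exists x', y'; split=> //; apply/(gu _ _ _ _ Kx' Ly').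
Qed.

(** Conjugating [g] by the morphisms [K] and [L] of [to_under_hom] gives a member of the family
    between objects of [G], hence a map [u] of [U] by [HM_old]. The converse [HU_to_HM] conjugates
    back. *)
Lemma HM_to_HU k l g : is_index G n k -> is_index G m l -> HM (ix n k) (ix m l) g ->
  exists2 u, HU (under Q k) (under Q l) u &
    star_graph g = gcomp (gconv (to_under m l)) (gcomp u (to_under n k)).
Proof.
move=> ki li gH; have [K KH Ku] := to_under_hom ki; have [L LH Lu] := to_under_hom li.
have uk := under_idx ki; have ul := under_idx li.
have Ik := ix_idx ki; have Il := ix_idx li.
have Ek := eI_idx B uk; have El := eI_idx B ul.
have : HM (eI n (under Q k)) (eI m (under Q l)) (gcomp L (gcomp g (gconv K))).
  apply: HM_post LH => //.
  apply: (HM_pre _ _ _ gH) => //.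
  by apply: Hom_inv => //.
rewrite HM_old // => -[u uH uE]; exists u => //.
apply: (star_graph_eq ki li KH Ku LH Lu) => [x y|x y o o' Kx Ly ko lo'].
  exact: HM_dom.
have /Hom_bij/is_bijectionE[_ _ _ _ Kinj] := KH.
have /Hom_bij/is_bijectionE[_ _ _ _ Linj] := LH.
split=> [gxy|uoo'].
  have : gcomp L (gcomp g (gconv K)) (eO n o) (eO m o') by exists y => //; exists x.
  rewrite -uE => -[z [z' [kz lz' oz oz' uzz']]].
  by rewrite (eO_injective B ko kz oz) (eO_injective B lo' lz' oz').
have : gcomp L (gcomp g (gconv K)) (eO n o) (eO m o') by rewrite -uE; exists o, o'.
by move=> [y' [x' Kx' gxy'] Ly']; rewrite (Kinj _ _ _ Kx Kx') (Linj _ _ _ Ly Ly').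
Qed.

Lemma HU_to_HM k l u : is_index G n k -> is_index G m l -> HU (under Q k) (under Q l) u ->
  exists2 g, HM (ix n k) (ix m l) g &
    star_graph g = gcomp (gconv (to_under m l)) (gcomp u (to_under n k)).
Proof.
move=> ki li uH; have [K KH Ku] := to_under_hom ki; have [L LH Lu] := to_under_hom li.
have uk := under_idx ki; have ul := under_idx li.
have Ik := ix_idx ki; have Il := ix_idx li.
have Ek := eI_idx B uk; have El := eI_idx B ul.
pose u' := gtransport (object (sgpd G n) (under Q k)) (object (sgpd G m) (under Q l))
  (eO n) (eO m) u.
have u'H : HM (eI n (under Q k)) (eI m (under Q l)) u' by rewrite HM_old //; exists u.
have gH : HM (ix n k) (ix m l) (gcomp (gconv L) (gcomp u' K)).
  apply: (HM_post (j := eI m (under Q l))) => //.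
    by apply: (HM_pre _ _ _ u'H KH) => //.
  by apply: Hom_inv => //.
exists (gcomp (gconv L) (gcomp u' K)) => //.
apply: (star_graph_eq ki li KH Ku LH Lu) => [x y|x y o o' Kx Ly ko lo'].
  exact: HM_dom.
have /Hom_bij/is_bijectionE[_ _ _ Kf _] := KH.
have /Hom_bij/is_bijectionE[_ _ _ Lf _] := LH.
split=> [[w' [w Kw [z [z' [kz lz' wz wz' uzz']]]] Lw]|uoo'].
  have oz : o = z by apply: (eO_injective B ko kz); rewrite -wz; exact: Kf Kx Kw.
  have oz' : o' = z' by apply: (eO_injective B lo' lz'); rewrite -wz'; exact: Lf Ly Lw.
  by rewrite oz oz'.
by exists (eO m o') => //; exists (eO n o) => //; exists o, o'.
Qed.

Variables (w : seq (sorts (Meq V))) (Fm : set (tup (Meq V)))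
  (Gr : tup (Meq V) -> tup (Meq V) -> tup (Meq V) -> Prop).
Hypothesis Fm_HM : forall q, Fm q -> exists i j,
  [/\ Idx (sgpd G' n) i, Idx (sgpd G' m) j & HM i j (Gr q)].
Hypothesis HM_Fm : forall i j g, HM i j g -> exists2 q, Fm q & g = Gr q.

(** Membership in a new object is tested on one pair of points, so that the condition mentions no
    indices and is 0-definable. *)
Definition new_code (q : tup (Meq V)) : Prop :=
  Fm q /\ exists x y, Gr q x y /\ (new_point n x \/ new_point m y).

(** Conjugation identifies the two families; totality of the maps supplies the pair of points that
    [new_code] asks for. *)
Lemma star_family f : (exists k l u, [/\ is_index G n k, is_index G m l, is_new k || is_new l,
     HU (under Q k) (under Q l) u & f = gcomp (gconv (to_under m l)) (gcomp u (to_under n k))])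
  <-> exists2 q, new_code q & f = star_graph (Gr q).
Proof.
split=> [[k [l [u [ki li kl uH ->]]]]|[q [Fq [x [y [qxy nxy]]] ->]]].
  have [g gH <-] := HU_to_HM ki li uH; have [q Fq ge] := HM_Fm gH; subst g.
  exists q => //; split=> //.
  have [x kx] := object_ne (ix_idx ki); have [y gxy] := HM_total gH kx.
  exists x, y; split=> //; have [_ ly] := HM_dom gH gxy.
  by case/orP: kl => [/(new_pointP ki kx)|/(new_pointP li ly)]; [left|right].
have [_ [_ [/idx_ix[k ki <-] /idx_ix[l li <-] gH]]] := Fm_HM Fq.
have [u uH uE] := HM_to_HU ki li gH; exists k, l, u; split=> //.
have [kx ly] := HM_dom gH qxy.
by apply/orP; case: nxy => [/(new_pointP ki kx)|/(new_pointP li ly)]; [left|right].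
Qed.

End Family.

End Star.

Lemma Forall2_consl (S T : Type) (R : S -> T -> Prop) x l ts :
  List.Forall2 R (x :: l) ts -> exists q ts', [/\ R x q, List.Forall2 R l ts' & ts = q :: ts'].
Proof. by move=> H; inversion H as [|? q ? ts' ? ?]; exists q, ts'. Qed.

(** * Codes in [V^eq] for all sorts of the star extension *)

Section Star.
Variables (U : structure) (Aw : seq (sorts U)) (A : set (tup U)).
Variables (V : extension U unit) (p : nelt V -> tup U).
Variables (G : simplicial_groupoid Aw A)
  (G' : simplicial_groupoid (eq_word_of V Aw) (@eq_tup U V @` A))
  (eO eI : nat -> tup U -> tup (Meq V))
  (new : set (tup U) -> tup (Meq V))
  (theta : nat -> tup (Meq V) -> nelt V).
Hypothesis B : @binding_pair U Aw A V p G G' eO eI new theta.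
Variable Q : commuting_system G.
Let triv := trivialisation G' eO eI new theta Q.
Variable eta : nelt V -> Ostar Q.
Hypotheses (eta_bij : bijective eta) (eta_p : forall s, star_proj (eta s) = p s).
Hypothesis eta_triv : forall n c, nsubsets A n.+1 c ->
  triv n c (fun s o => star_map c (eta s) o).
Hypothesis p_definable : definable (M := V) set0 (inr tt :: map inl Aw)
  [set t | exists s, t = inr s :: map inl (p s)].

Let star_graph' := star_graph G' eO new theta eta.
Let new_code' := new_code G' new.

Lemma star_homE n f : star_hom (Q := Q) n f <->
  exists2 q, new_code' n n (Mor (sgpd G' n)) (Graph (sgpd G' n)) q &
             f = star_graph' n n (Graph (sgpd G' n) q).
Proof.
apply: (star_family B eta_bij eta_triv (HU := Hom (sgpd G n)) (HM := Hom (sgpd G' n))).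
- by move=> i j h x y /Hom_bij/is_bijectionE[hi _ _ _ _] /hi.
- by move=> i j h x /Hom_bij/is_bijectionE[_ ht _ _ _] /ht.
- exact: (old_hom B).
- by move=> i i' j h u Ii Ii' Ij hH uH; exact: Hom_comp Ii' Ii Ij uH hH.
- by move=> i j j' h v Ii Ij Ij' hH vH; exact: Hom_comp Ii Ij Ij' hH vH.
- move=> q Mq; have [i [j [Ii Ij qb]]] := Graph_bij Mq.
  by exists i, j; split=> //; exists q.
- by move=> i j g [q Mq [-> _]]; exists q.
Qed.

Lemma star_inclE n m (nm : (n < m)%N) f : star_incl (Q := Q) n m f <->
  exists2 q, new_code' n m (Fam (Defs.incl G' nm)) (FGraph (Defs.incl G' nm)) q &
             f = star_graph' n m (FGraph (Defs.incl G' nm) q).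
Proof.
have mdom (M : structure) (Bw : seq (sorts M)) (C : set (tup M))
    (H : simplicial_groupoid Bw C) i j h x y :
    maps (Defs.incl H nm) i j h -> h x y -> object (sgpd H n) i x /\ object (sgpd H m) j y.
  by move=> [q _ [_ [hi _]]] /hi.
rewrite -(star_family B eta_bij eta_triv (HU := maps (Defs.incl G nm))
  (HM := maps (Defs.incl G' nm))).
- split=> [[nm' [k [l [u [ki li kl uH ->]]]]]|[k [l [u [ki li kl uH ->]]]]].
    by exists k, l, u; split=> //; rewrite (eq_irrelevance nm nm').
  by exists nm, k, l, u.
- exact: mdom.
- by move=> i j h x [q _ [_ [_ ht]]] /ht[y [hxy _]]; exists y.
- exact: (old_incl B).
- by move=> i i' j h u; exact: fam_pre.
- by move=> i j j' h v; exact: fam_post.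
- move=> q Fq; have [i [j [Ii Ij qb]]] := FGraph_map Fq.
  by exists i, j; split=> //; exists q.
- by move=> i j g [q Fq [-> _]]; exists q.
Qed.

Definition side_sorts n (b : bool) : seq (sorts (Meq V)) :=
  if b then [:: inl (inr tt)] else eq_word_of V (Ow (sgpd G n)).

(** This is [same_point] with the points of [O_*] replaced by their preimages under [eta]: a
    relation inside [V^eq], given by [eO] on old points and by [theta] on new ones. *)
Definition side_point n (b : bool) (xs x' : tup (Meq V)) : Prop :=
  if b then exists2 c, nsubsets A n.+1 c &
    object (sgpd G' n) (new c) x' /\ xs = [:: inl (inr (theta n x'))]
  else exists2 o, Obj (sgpd G n) o & xs = @eq_tup U V o /\ x' = eO n o.

Definition point_code (x : tup U + Ostar Q) (xs : tup (Meq V)) : Prop :=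
  match x with
  | inl o => xs = eq_tup V o
  | inr y => exists2 s, eta s = y & xs = [:: inl (inr s)]
  end.

Lemma eq_tup_inj : injective (@eq_tup U V).
Proof. by move=> x y; apply: inj_map => ? ? []. Qed.

Lemma eq_tup_typed w o : typed w o -> typed (eq_word_of V w) (eq_tup V o).
Proof. by rewrite /typed /= => <-; rewrite /eq_word_of /eq_tup -!map_comp. Qed.

Lemma eq_tup_typed_inv w o : typed (eq_word_of V w) (eq_tup V o) -> typed w o.
Proof.
rewrite /typed /= /eq_word_of /eq_tup -map_comp => h.
apply: (@inj_map _ _ (fun s => inl (inl s) : sorts (Meq V))); first by move=> ? ? [].
by rewrite -[RHS]h -map_comp.
Qed.

Lemma new_typed (s : nelt V) : typed (M := Meq V) [:: inl (inr tt)] [:: inl (inr s)].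
Proof. by rewrite /typed /=; case: (nsort_of s). Qed.

Lemma side_pointE n x xs x' : point_code x xs ->
  same_point G' eO new theta eta n x x' <-> side_point n (is_new x) xs x'.
Proof.
case: x => [o ->|y [s <- ->]] /=.
  split=> [[Oo ->]|[o' Oo' [/eq_tup_inj-> ->]]//]; by exists o.
split=> [[[c cn cx'] e]|[c cn [cx' [->]]]].
  by exists c => //; split=> //; rewrite (eta_inj eta_bij e).
by split=> //; exists c.
Qed.

Lemma side_point_code n b xs x' : side_point n b xs x' ->
  typed (side_sorts n b) xs /\ exists2 x, point_code x xs & is_new x = b.
Proof.
case: b => /= [[c cn [cx' ->]]|[o Oo [-> _]]].
  split; first exact: new_typed.
  by exists (inr (eta (theta n x'))) => //; exists (theta n x').
split; first exact: (eq_tup_typed ((Obj_definable (sgpd G n)).1 _ Oo)).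
by exists (inl o).
Qed.

Lemma edef_side_point c W n b f g : term c W f (side_sorts n b) ->
  term c W g (Ow (sgpd G' n)) -> edef c W (fun ts => side_point n b (f ts) (g ts)).
Proof.
case: b => /= tf tg; last exact: edef_definable2 (eO_definable B n) tf tg.
exact: edef_definable2 (theta_definable B n) tg tf.
Qed.

Lemma edef_new_point c W n f : term c W f (Ow (sgpd G' n)) ->
  edef c W (fun ts => new_point G' new n (f ts)).
Proof.
move=> tf; have := edef_ex (Q := fun ts y => side_point n true y (f ts)).
move=> /(_ c W [:: inl (inr tt)]) H; apply: edef_ext (H _).
  move=> ts _; split=> [[y [_ [d dn [fd _]]]]|[d dn fd]]; first by exists d.
  by exists [:: inl (inr (theta n (f ts)))]; split; [exact: new_typed|exists d].
apply: edef_side_point; first exact: term_head.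
exact: term_behead tf.
Qed.

Section Family.
Variables (n m : nat) (w : seq (sorts (Meq V))) (Fm : set (tup (Meq V)))
  (Gr : tup (Meq V) -> tup (Meq V) -> tup (Meq V) -> Prop).
Hypotheses (Fm_def : definable set0 w Fm)
  (Gr_def : definable3 w (Ow (sgpd G' n)) (Ow (sgpd G' m)) Gr).

Definition side_graph b1 b2 (q xs ys : tup (Meq V)) : Prop := exists x' y',
  [/\ side_point n b1 xs x', side_point m b2 ys y' & Gr q x' y'].

Lemma star_graphE q x y xs ys : point_code x xs -> point_code y ys ->
  star_graph' n m (Gr q) x y <-> side_graph (is_new x) (is_new y) q xs ys.
Proof.
move=> xc yc; split=> -[x' [y' [h1 h2 h3]]]; exists x', y'.
  by split=> //; [exact/(side_pointE n x' xc)|exact/(side_pointE m y' yc)].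
by split=> //; [exact/(side_pointE n x' xc)|exact/(side_pointE m y' yc)].
Qed.

Lemma edef_side_graph c W b1 b2 tq tx ty : term c W tq w ->
  term c W tx (side_sorts n b1) -> term c W ty (side_sorts m b2) ->
  edef c W (fun ts => side_graph b1 b2 (tq ts) (tx ts) (ty ts)).
Proof.
move=> hq hx hy.
have := edef_ex (Q := fun ts x' => exists y', typed (Ow (sgpd G' m)) y' /\
  (side_point n b1 (tx ts) x' /\ (side_point m b2 (ty ts) y' /\ Gr (tq ts) x' y'))).
move=> /(_ c W (Ow (sgpd G' n))) H; apply: edef_ext (H _).
  move=> ts _; split=> [[x' [_ [y' [_ [? [? ?]]]]]]|[x' [y' [h1 h2 h3]]]].
    by exists x', y'.
  have [_ xw yw] := Gr_def.1 _ _ _ h3.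
  by exists x'; split=> //; exists y'.
apply: edef_ex; set Ox := Ow (sgpd G' n); set Oy := Ow (sgpd G' m).
have t0 := term_head c Oy (Ox :: W).
have t1 := term_behead Oy (term_head c Ox W).
apply: edef_and; first exact: edef_side_point (term_behead _ (term_behead _ hx)) t1.
apply: edef_and; first exact: edef_side_point (term_behead _ (term_behead _ hy)) t0.
exact: edef_definable3 Gr_def (term_behead _ (term_behead _ hq)) t1 t0.
Qed.

Lemma edef_new_code c W tq : term c W tq w ->
  edef c W (fun ts => new_code' n m Fm Gr (tq ts)).
Proof.
move=> hq; apply: edef_and; first exact: edef_definable0 Fm_def hq.
have := edef_ex (Q := fun ts x => exists y, typed (Ow (sgpd G' m)) y /\
  (Gr (tq ts) x y /\ (new_point G' new n x \/ new_point G' new m y))).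
move=> /(_ c W (Ow (sgpd G' n))) H; apply: edef_ext (H _).
  move=> ts _; split=> [[x' [_ [y' [_ [? ?]]]]]|[x' [y' [h1 h2]]]].
    by exists x', y'.
  have [_ xw yw] := Gr_def.1 _ _ _ h1.
  by exists x'; split=> //; exists y'.
apply: edef_ex; set Ox := Ow (sgpd G' n); set Oy := Ow (sgpd G' m).
have t0 := term_head c Oy (Ox :: W).
have t1 := term_behead Oy (term_head c Ox W).
apply: edef_and; first exact: edef_definable3 Gr_def (term_behead _ (term_behead _ hq)) t1 t0.
by apply: edef_or; apply: edef_new_point.
Qed.

Lemma star_graph_eqE q q' : star_graph' n m (Gr q) = star_graph' n m (Gr q') <->
  forall b, List.In b [:: (false, false); (false, true); (true, false); (true, true)] ->
  forall xs, typed (side_sorts n b.1) xs -> forall ys, typed (side_sorts m b.2) ys ->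
  (side_graph b.1 b.2 q xs ys <-> side_graph b.1 b.2 q' xs ys).
Proof.
split=> [E b _ xs xw ys yw|H].
  have sub q1 q2 : star_graph' n m (Gr q1) = star_graph' n m (Gr q2) ->
      side_graph b.1 b.2 q1 xs ys -> side_graph b.1 b.2 q2 xs ys.
    move=> E' [x' [y' [hx hy g]]].
    have [_ [x xc xb]] := side_point_code hx; have [_ [y yc yb]] := side_point_code hy.
    rewrite -xb -yb; apply/(star_graphE q2 xc yc); rewrite -E'.
    by apply/(star_graphE q1 xc yc); rewrite xb yb; exists x', y'.
  by split; apply: sub.
have cex x : exists xs, point_code x xs.
  case: x => [o|y]; first by exists (eq_tup V o).
  by have [s sy] := eta_surj eta_bij y; exists [:: inl (inr s)], s.
have sub q1 q2 : (forall b,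
      List.In b [:: (false, false); (false, true); (true, false); (true, true)] ->
    forall xs, typed (side_sorts n b.1) xs -> forall ys, typed (side_sorts m b.2) ys ->
    (side_graph b.1 b.2 q1 xs ys -> side_graph b.1 b.2 q2 xs ys)) ->
    forall x y, star_graph' n m (Gr q1) x y -> star_graph' n m (Gr q2) x y.
  move=> K x y; have [xs xc] := cex x; have [ys yc] := cex y.
  move=> /(star_graphE q1 xc yc) g; apply/(star_graphE q2 xc yc).
  have [x' [y' [/side_point_code[xw _] /side_point_code[yw _] _]]] := g.
  apply: (K (is_new x, is_new y)) => //=.
  by case: (is_new x) (is_new y) => [] []; auto.
by apply: graph_ext => x y; split; apply: sub => b bi xs xw ys yw; apply H.
Qed.

Lemma edef_star_code : edef [::] [:: w; w] (fun ts => exists f,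
  (new_code' n m Fm Gr (head [::] ts) /\ f = star_graph' n m (Gr (head [::] ts))) /\
  (new_code' n m Fm Gr (head [::] (behead ts)) /\
     f = star_graph' n m (Gr (head [::] (behead ts))))).
Proof.
have t0 := term_head [::] w [:: w].
have t1 := term_behead w (term_head [::] w [::]).
have H : edef [::] [:: w; w] (fun ts =>
    star_graph' n m (Gr (head [::] ts)) = star_graph' n m (Gr (head [::] (behead ts)))).
  apply: edef_ext (fun ts _ => iff_sym (star_graph_eqE _ _)) _.
  apply: edef_all_in => b _; apply: edef_all; apply: edef_all; apply: edef_iff.
    apply: edef_side_graph (term_head _ _ _).
    - exact: term_behead (term_behead _ t0).
    - exact: term_behead (term_head _ _ _).
  apply: edef_side_graph (term_head _ _ _).
  - exact: term_behead (term_behead _ t1).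
  - exact: term_behead (term_head _ _ _).
apply: edef_ext (edef_and (edef_new_code t0) (edef_and (edef_new_code t1) H)).
move=> ts _; split=> [[h0 [h1 e]]|[f [[h0 ->] [h1 e]]]//].
by exists (star_graph' n m (Gr (head [::] ts))).
Qed.

Lemma edef_star_rel b1 b2 :
  edef [::] (w :: map (@single _) (side_sorts n b1) ++ map (@single _) (side_sorts m b2))
    (fun ts => exists q x y xs ys,
      [/\ ts = q :: map (@single _) xs ++ map (@single _) ys /\ new_code' n m Fm Gr q,
          point_code x xs, point_code y ys, is_new x = b1 /\ is_new y = b2 &
          star_graph' n m (Gr q) x y]).
Proof.
set W1 := map _ (side_sorts n b1); set W2 := map _ (side_sorts m b2).
have f1 : term [::] W1 flatten (side_sorts n b1).
  by rewrite -[side_sorts _ _]flatten_single; exact: term_flatten.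
have f2 : term [::] W2 flatten (side_sorts m b2).
  by rewrite -[side_sorts _ _]flatten_single; exact: term_flatten.
have tq := term_head [::] w (W1 ++ W2).
have tx := term_behead w (term_take W2 f1).
have ty := term_behead w (term_drop W1 f2).
apply: edef_ext (edef_and (edef_new_code tq) (edef_side_graph tq tx ty)).
move=> [//|q ts] [_ /wt_cat[/wt_single[xs xw xe] /wt_single[ys yw ye]]] /=.
rewrite -/W1 xe ye !flatten_single; split=> [[Cq g]|].
  have [x' [y' [/side_point_code[_ [x xc xb]] /side_point_code[_ [y yc yb]] _]]] := g.
  exists q, x, y, xs, ys; split=> //; first by rewrite -xe -ye cat_take_drop.
  by apply/(star_graphE q xc yc); rewrite xb yb.
move=> [_ [x [y [xs' [ys' [[[<- tse] Cq] xc yc [xb yb] /(star_graphE q xc yc) g]]]]]].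
split=> //; move: g; rewrite xb yb => g.
have [x' [y' [/side_point_code[xw' _] /side_point_code[yw' _] _]]] := g.
have s' : size (map (@single _) xs') = size W1.
  by rewrite !size_map -xw' size_map.
have <- : xs' = xs.
  by rewrite -[LHS]flatten_single -[RHS]flatten_single -xe tse take_size_cat.
have <- // : ys' = ys.
by rewrite -[LHS]flatten_single -[RHS]flatten_single -ye tse drop_size_cat.
Qed.

End Family.

(** For [m <= n] the sort [sN n m] is empty; the word [[::]] is a filler, and [star_code] admits no
    code there. *)
Definition star_word (s : sorts (star_extension Q)) : seq (sorts (Meq V)) :=
  match s with
  | inl s => [:: inl (inl s)]
  | inr sO => [:: inl (inr tt)]
  | inr (sM n) => Mw (sgpd G' n)
  | inr (sN n m) =>
      match pselect (n < m)%N with left nm => Fw (Defs.incl G' nm) | right _ => [::] end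
  end.

Definition star_code (x : elt (star_extension Q)) (t : tup (Meq V)) : Prop :=
  match x with
  | inl u => t = [:: inl (inl u)]
  | inr (xO y) => exists2 s, eta s = y & t = [:: inl (inr s)]
  | inr (xM n f) => new_code' n n (Mor (sgpd G' n)) (Graph (sgpd G' n)) t /\
      sval f = star_graph' n n (Graph (sgpd G' n) t)
  | inr (xN n m f) =>
      match pselect (n < m)%N with
      | left nm => new_code' n m (Fam (Defs.incl G' nm)) (FGraph (Defs.incl G' nm)) t /\
          sval f = star_graph' n m (FGraph (Defs.incl G' nm) t)
      | right _ => False
      end
  end.

Lemma coded_inl a ts : List.Forall2 star_code (map inl a) ts <->
  ts = map (@single _) (eq_tup V a).
Proof.
split=> [|->]; last by elim: a => [|x a IH]; constructor.
elim: a ts => [|x a IH] ts H; inversion H as [|? ? ? ? e1 e2] => //; subst.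
by rewrite e1 (IH _ e2).
Qed.

Lemma coded_point x ts : List.Forall2 star_code (Defs.point x) ts <->
  exists2 xs, point_code x xs & ts = map (@single _) xs.
Proof.
case: x => [o|y] /=; first by rewrite coded_inl; split=> [->|[_ -> ->]];
  first by exists (eq_tup V o).
split=> [H|[xs [s sy xe] ->]]; last by rewrite xe; constructor; [exists s|constructor].
inversion H as [|? ? ? ? e1 e2]; subst; inversion e2; subst.
move: e1 => [s sy ->].
by exists [:: inl (inr s)] => //; exists s.
Qed.

Lemma coded_points (x : elt (star_extension Q)) x1 x2 ts :
  List.Forall2 star_code (x :: Defs.point x1 ++ Defs.point x2) ts <-> exists q xs ys,
  [/\ ts = q :: map (@single _) xs ++ map (@single _) ys, star_code x q,
      point_code x1 xs & point_code x2 ys].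
Proof.
split=> [H|[q [xs [ys [-> xq xc yc]]]]]; last first.
  by constructor=> //; apply: List.Forall2_app; apply/coded_point; [exists xs|exists ys].
inversion H as [|? q ? ts' e1 e2]; subst.
move: e2 => /List.Forall2_app_inv_l[l1 [l2 [/coded_point[xs xc ->] [/coded_point[ys yc ->] ->]]]].
by exists q, xs, ys.
Qed.

Lemma side_word_star n b : map star_word (side_word G n b) = map (@single _) (side_sorts n b).
Proof. by case: b => //=; rewrite /eq_word_of -!map_comp. Qed.

Lemma point_typed n b x xs : point_code x xs -> typed (side_sorts n b) xs -> is_new x = b ->
  typed (M := star_extension Q) (side_word G n b) (Defs.point x).
Proof.
move=> xc xw xb; subst b; case: x xc xw => [o ->|y _] //= xw; rewrite /typed /= -map_comp.
by rewrite -(eq_tup_typed_inv xw) -map_comp.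
Qed.

(** A point of [O_*] has its preimage under [eta] as code, a map the codes of the maps of [G'] with
    the same graph. Existence of codes for maps is the content of [star_homE] and [star_inclE]. *)
Lemma star_interpretation : interpretation star_word star_code.
Proof.
split.
- case=> [u|[y|n f|n m f]] t /=.
  + by move->.
  + by move=> [s _ ->]; exact: new_typed.
  + by move=> [[Mt _] _]; exact: ((Mor_definable (sgpd G' n)).1 _ Mt).
  + case: pselect => // nm [[Ft _] _]; exact: ((Fam_definable (Defs.incl G' nm)).1 _ Ft).
- case=> [u|[y|n [f fh]|n m [f fh]]] /=.
  + by exists [:: inl (inl u)].
  + by have [s sy] := eta_surj eta_bij y; exists [:: inl (inr s)], s.
  + by have /star_homE[q qc qf] := fh; exists q.
  + case: pselect => [nm|nnm]; last by have [nm _] := fh.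
    by have /(star_inclE nm)[q qc qf] := fh; exists q.
- case=> [u|[y|n f|n m f]] [u'|[y'|n' f'|n' m' f']] t //=.
  + by move=> _ -> [->].
  + by move=> _ [s <- ->] [s' <- [->]].
  + move=> [nn]; subst n' => -[_ fE] [_ f'E].
    by congr (inr (xM _)); apply: sval_injective; rewrite fE f'E.
  + move=> [nn mm]; subst n' m'; case: pselect => // nm [_ fE] [_ f'E].
    by congr (inr (xN _)); apply: sval_injective; rewrite fE f'E.
- have E w : edef [::] [:: w; w]
      (fun ts : seq (tup (Meq V)) => head [::] ts = head [::] (behead ts)).
    by apply: edef_eq; [exact: term_head|apply: term_behead; exact: term_head].
  case=> [s|[|n|n m]] /=.
  + apply: edef_ext (E [:: inl (inl s)]).
    move=> [|[|[[x|x]|x] [|? ?]] [|t' [|? ?]]] //= [xs _].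
    split=> [<-|[[u|z] [zs]]]; last 2 first.
      * by move=> -> ->.
      * by case: z zs.
    by exists (inl x); rewrite /= xs.
  + apply: edef_ext (E [:: inl (inr tt)]).
    move=> [|[|[[x|x]|x] [|? ?]] [|t' [|? ?]]] //= [xs _].
    split=> [<-|[[u|[z|z z'|z z' z'']] [] //= _ [s <- ->] [s' /(eta_inj eta_bij)-> ->]//]].
    by exists (inr (xO (eta x))); split=> //; exists x.
  + apply: edef_ext (edef_star_code (Mor_definable (sgpd G' n)) (Graph_definable (sgpd G' n))).
    move=> ts _; split=> [[f [[c0 e0] [c1 e1]]]|[[u|[z|k f|k l f]] [] //= [kn]]].
      have fh : star_hom (Q := Q) n f by apply/star_homE; exists (head [::] ts).
      by exists (inr (xM (exist _ f fh))).
    by subst k => -[c0 e0] [c1 e1]; exists (sval f).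
  + case: pselect => [nm|nnm]; last first.
      apply: edef_ext (edef_false _ _) => ts _; split=> // -[[u|[z|k f|k l f]] [] //= [kn lm]].
      by subst k l; case: pselect.
    apply: edef_ext (edef_star_code (Fam_definable (Defs.incl G' nm))
      (FGraph_definable (Defs.incl G' nm))).
    move=> ts _; split=> [[f [[c0 e0] [c1 e1]]]|[[u|[z|k f|k l f]] [] //= [kn lm]]].
      have fh : star_incl (Q := Q) n m f by apply/(star_inclE nm); exists (head [::] ts).
      exists (inr (xN (exist _ f fh))); split=> //=; case: pselect => //= nm';
        by rewrite (eq_irrelevance nm' nm).
    subst k l; case: pselect => //= nm'; rewrite (eq_irrelevance nm' nm).
    by move=> [c0 e0] [c1 e1]; exists (sval f).
- case=> [r|[|n b1 b2|n m b1 b2]] /=.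
  + have W : map star_word (map inl (arity r)) = map (@single _) (eq_word_of V (arity r)).
      by rewrite /eq_word_of -!map_comp.
    rewrite W; set W1 := map _ _.
    have tf : term [::] W1 flatten (eq_word_of V (arity r)).
      by rewrite -[eq_word_of _ _]flatten_single; exact: term_flatten.
    have aE : arity (inl (inl r) : Defs.rel (Meq V)) = eq_word_of V (arity r).
      by rewrite /= -map_comp.
    have := holds_definable (inl (inl r) : Defs.rel (Meq V)); rewrite aE.
    move=> /edef_definable0/(_ tf); apply: edef_ext => ts /wt_single[t tw ->].
    rewrite flatten_single; split.
      move=> [_ [z te [x xe hx]]]; have tx : t = eq_tup V x.
        by rewrite te xe /eq_tup -map_comp.
      rewrite {}tx {te} in tw *; exists (map inl x); split; last exact/coded_inl.
      split; last by exists x.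
      by rewrite /typed /= -(eq_tup_typed_inv tw) -!map_comp.
    move=> [_ [[_ [x -> hx]] /coded_inl /(congr1 flatten)]]; rewrite !flatten_single => tx.
    split; first by rewrite aE.
    by exists (map inl x); [rewrite tx /eq_tup -map_comp|exists x].
  + have W : map star_word (inr sO :: map inl Aw) =
        map (@single _) (inl (inr tt) :: eq_word_of V Aw).
      by rewrite /= /eq_word_of -!map_comp.
    rewrite [X in edef _ X]W; set W1 : seq (seq (sorts (Meq V))) := map _ _.
    have tf : term [::] W1 flatten (inl (inr tt) :: eq_word_of V Aw).
      by rewrite -[_ :: _]flatten_single; exact: term_flatten.
    have := Meq_up p_definable; rewrite [map inl (_ :: _)]/= -map_comp.
    move=> /edef_definable0/(_ tf); apply: edef_ext => ts /wt_single[t tw ->].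
    rewrite flatten_single; split.
      move=> [_ [s ->] te].
      have {}te : t = inl (inr s) :: eq_tup V (p s) by rewrite -te /eq_tup /= -map_comp.
      subst t; exists (inr (xO (eta s)) :: map inl (p s)); split.
        split; last by exists (eta s); rewrite eta_p.
        case: tw => _ /eq_tup_typed_inv tw; rewrite /typed /=; congr (_ :: _).
        by rewrite -map_comp; apply: etrans (congr1 (map inl) tw); rewrite -map_comp.
      by constructor; [exists s|exact/coded_inl].
    move=> [_ [[_ [y ->]]]]; have [s <-] := eta_surj eta_bij y; rewrite eta_p.
    move=> H; have [q [ts' [[s' /(eta_inj eta_bij) ss qe] /coded_inl tse te]]] := Forall2_consl H.
    subst s'.
    exists (inr s :: map inl (p s)); first by exists s.
    by rewrite -[RHS]flatten_single te qe tse /= flatten_single /eq_tup -map_comp.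
  + rewrite map_cat !side_word_star.
    apply: edef_ext (edef_star_rel (Mor_definable (sgpd G' n)) (Graph_definable (sgpd G' n)) b1 b2).
    move=> ts tsw; split.
      move=> [q [x [y [xs [ys [[te qc] xc yc [xb yb] g]]]]]].
      have fh : star_hom (Q := Q) n (star_graph' n n (Graph (sgpd G' n) q)).
        by apply/star_homE; exists q.
      exists (inr (xM (exist _ _ fh)) :: Defs.point x ++ Defs.point y); split; last first.
        by apply/coded_points; exists q, xs, ys.
      split; last by exists (exist _ _ fh), x, y.
      have /(star_graphE n n _ _ xc yc)[x' [y' [hx hy _]]] := g; rewrite xb yb in hx hy.
      have tx := point_typed xc (side_point_code hx).1 xb.
      have ty := point_typed yc (side_point_code hy).1 yb.
      by rewrite /typed /= map_cat; congr (_ :: _ ++ _); [exact: tx|exact: ty].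
    move=> [_ [[_ [f [x [y [-> xb yb fxy]]]]] /coded_points[q [xs [ys [te [qc fE] xc yc]]]]]].
    by exists q, x, y, xs, ys; split=> //; rewrite -fE.
  + case: pselect => [nm|nnm]; last first.
      apply: edef_ext (edef_false _ _) => ts _; split=> // -[_ [[_ [f [x [y [-> _ _ _]]]]] _]].
      by have [nm _] := svalP f.
    rewrite map_cat !side_word_star.
    apply: edef_ext (edef_star_rel (Fam_definable (Defs.incl G' nm))
      (FGraph_definable (Defs.incl G' nm)) b1 b2).
    move=> ts tsw; split.
      move=> [q [x [y [xs [ys [[te qc] xc yc [xb yb] g]]]]]].
      have fh : star_incl (Q := Q) n m (star_graph' n m (FGraph (Defs.incl G' nm) q)).
        by apply/(star_inclE nm); exists q.
      exists (inr (xN (exist _ _ fh)) :: Defs.point x ++ Defs.point y); split; last first.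
        apply/coded_points; exists q, xs, ys; split=> //=.
        by case: pselect => //= nm'; rewrite (eq_irrelevance nm' nm).
      split; last by exists (exist _ _ fh), x, y.
      have /(star_graphE n m _ _ xc yc)[x' [y' [hx hy _]]] := g; rewrite xb yb in hx hy.
      have tx := point_typed xc (side_point_code hx).1 xb.
      have ty := point_typed yc (side_point_code hy).1 yb.
      by rewrite /typed /= map_cat; congr (_ :: _ ++ _); [exact: tx|exact: ty].
    move=> [_ [[_ [f [x [y [-> xb yb fxy]]]]] /coded_points[q [xs [ys [te /= fE xc yc]]]]]].
    move: fE; case: pselect => //= nm'; rewrite (eq_irrelevance nm' nm) => -[qc fE].
    by exists q, x, y, xs, ys; split=> //; rewrite -fE.
Qed.

End Star.

(** * Automorphisms and the isomorphism of covers *)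

Lemma bijective_inj_surj (S T : Type) (f : S -> T) : injective f ->
  (forall y, exists x, f x = y) -> bijective f.
Proof.
move=> f_inj /choice[g gK]; exists g => // x; exact: f_inj.
Qed.

Section Automorphisms.
Variable M : structure.

Lemma automorphism_comp (s t : elt M -> elt M) : automorphism s -> automorphism t ->
  automorphism (s \o t).
Proof.
move=> [sb ss sr] [tb ts tr]; split; first exact: bij_comp.
  by move=> x; rewrite /= ss ts.
by move=> r x; rewrite map_comp sr tr.
Qed.

Lemma automorphism_inv (s t : elt M -> elt M) : automorphism s -> cancel s t -> cancel t s ->
  automorphism t.
Proof.
move=> [sb ss sr] sK tK; split; first by exists s.
  by move=> x; rewrite -ss tK.
by move=> r x; rewrite -sr -map_comp (eq_map (g := id)) ?map_id.
Qed.

End Automorphisms.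

Section LiftAutomorphism.
Variables (N M : structure) (gs : sorts N -> sorts M) (g : elt N -> elt M).
Hypotheses (g_sort : forall x, sort_of (g x) = gs (sort_of x))
  (g_inj : forall x y, sort_of x = sort_of y -> g x = g y -> x = y)
  (g_surj : forall s y, sort_of y = gs s -> exists2 x, sort_of x = s & g x = y)
  (g_rel : forall r : Defs.rel N, definable set0 (map gs (arity r))
     [set t | exists2 xs, holds r xs & t = map g xs]).

Lemma map_inj_typed w (t t' : tup N) : typed w t -> typed w t' -> map g t = map g t' -> t = t'.
Proof.
move=> <-; elim: t t' => [|x t IH] [|x' t'] //= [xx tt] [gx gt].
by rewrite (g_inj (esym xx) gx) (IH t').
Qed.

Lemma holds_map (r : Defs.rel N) t : typed (arity r) t ->
  holds r t <-> exists2 xs, holds r xs & map g t = map g xs.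
Proof.
move=> tr; split=> [ht|[xs hx /(map_inj_typed tr) -> //]]; first by exists t.
by case: hx.
Qed.

(** The lift of [x] is the only preimage of [tau (g x)] in the sort of [x]. It preserves a relation
    of [N] because the image of that relation under [g] is 0-definable, hence invariant under
    [tau]. *)
Lemma lift_automorphism tau : automorphism tau ->
  exists2 sigma, automorphism sigma & forall x, g (sigma x) = tau (g x).
Proof.
move=> ta; have [tb ts _] := ta.
have /choice[sigma sP] : forall x, exists y, sort_of y = sort_of x /\ g y = tau (g x).
  move=> x; have [|y ys yx] := g_surj (s := sort_of x) (y := tau (g x)).
    by rewrite ts g_sort.
  by exists y.
have ss x : sort_of (sigma x) = sort_of x by have [] := sP x.
have sg x : g (sigma x) = tau (g x) by have [] := sP x.
exists sigma => //; split=> //.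
  apply: bijective_inj_surj => [x y xy|y].
    have h : sort_of x = sort_of y by rewrite -ss xy ss.
    by apply: (g_inj h); apply: (bij_inj tb); rewrite -!sg xy.
  have [tau' tK t'K] := tb.
  have [|x xs xy] := g_surj (s := sort_of y) (y := tau' (g y)).
    by rewrite -ts t'K g_sort.
  by exists x; apply: g_inj; [rewrite ss|rewrite sg xy t'K].
move=> r t; have st : typed (arity r) (map sigma t) <-> typed (arity r) t.
  by rewrite /typed /= -map_comp (eq_map (g := @sort_of N)).
have [tr|ntr] := pselect (typed (arity r) t); last first.
  by split=> -[] => [/st//|/ntr].
rewrite holds_map; last exact/st.
rewrite (holds_map tr) -map_comp (eq_map (g := tau \o g)) // map_comp.
exact: (definable_automorphism (map g t) ta (g_rel r)).
Qed.

End LiftAutomorphism.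

Lemma holds_inl (U : structure) (K : Type) (E : extension U K) (r : Defs.rel U) t :
  holds (M := E) (inl r) (map inl t) <-> holds r t.
Proof.
have inl_inj : injective (@inl (elt U) (nelt E)) by move=> ? ? [].
rewrite /holds /typed /= -map_comp; split=> [[h [x /(inj_map inl_inj) tx hx]]|[<- h]].
  subst x.
  split=> //; apply: (@inj_map _ _ (@inl (sorts U) K)); first by move=> ? ? [].
  by rewrite -[RHS]h -map_comp.
by split; [rewrite -map_comp|exists t].
Qed.

Lemma holds_inlE (U : structure) (K : Type) (E : extension U K) (r : Defs.rel U) :
  holds (M := E) (inl r) = [set map inl t | t in holds r].
Proof.
apply/seteqP; split=> [t h|_ [t h <-]]; last exact/holds_inl.
by have [_ [x tx _]] := h; exists x => //; apply/(holds_inl E); rewrite -tx.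
Qed.

Lemma restrict_automorphism (U : structure) (K : Type) (E : extension U K) tau :
  automorphism (M := E) tau ->
  exists2 tau0, automorphism (M := U) tau0 & forall u, tau (inl u) = inl (tau0 u).
Proof.
move=> ta; have [[tau' tK t'K] ts tr] := ta.
have res (f : elt E -> elt E) : (forall x, sort_of (f x) = sort_of x) ->
    exists f0, forall u, f (inl u) = inl (f0 u).
  move=> fs; have /choice[f0 f0P] : forall u, exists v, f (inl u) = inl v.
    by move=> u; have := fs (inl u); case: (f (inl u)) => //= v _; exists v.
  by exists f0.
have [tau0 t0] := res tau ts.
have [_ ts' _] := automorphism_inv ta tK t'K.
have [tau0' t0'] := res tau' ts'.
have K1 : cancel tau0 tau0'.
  by move=> u; have := tK (inl u); rewrite t0 t0' => -[].
have K2 : cancel tau0' tau0.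
  by move=> u; have := t'K (inl u); rewrite t0' t0 => -[].
exists tau0 => //; split; first by exists tau0'.
  by move=> u; have := ts (inl u); rewrite t0 => -[].
move=> r t; rewrite -(holds_inl E) -[holds r t](holds_inl E) -(tr _ (map inl t)) -!map_comp.
by rewrite (eq_map (g := inl \o tau0)).
Qed.

Lemma sval_lift (T : Type) (P : T -> Prop) (t : seq T) : (forall x, List.In x t -> P x) ->
  exists tt : seq {x | P x}, map sval tt = t.
Proof.
elim: t => [_|x t IH H]; first by exists [::].
have [|tt <-] := IH; first by move=> y yt; apply: H; right.
by exists (exist _ x (H x (or_introl erefl)) :: tt).
Qed.

(** * Comparison of the two covers through [eta] *)

Section Main.
Variables (U : structure) (Aw : seq (sorts U)) (A : set (tup U)).
Variables (V : extension U unit) (p : nelt V -> tup U).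
Variables (G : simplicial_groupoid Aw A)
  (G' : simplicial_groupoid (eq_word_of V Aw) (@eq_tup U V @` A))
  (eO eI : nat -> tup U -> tup (Meq V))
  (new : set (tup U) -> tup (Meq V))
  (theta : nat -> tup (Meq V) -> nelt V).
Hypothesis B : @binding_pair U Aw A V p G G' eO eI new theta.
Variable Q : commuting_system G.
Let triv := trivialisation G' eO eI new theta Q.
Variables (eta : nelt V -> Ostar Q) (eta' : Ostar Q -> nelt V).
Hypotheses (etaK : cancel eta eta') (eta'K : cancel eta' eta)
  (eta_p : forall s, star_proj (eta s) = p s).
Hypothesis eta_triv : forall n c, nsubsets A n.+1 c ->
  triv n c (fun s o => star_map c (eta s) o).
Hypothesis p_definable : definable (M := V) set0 (inr tt :: map inl Aw)
  [set t | exists s, t = inr s :: map inl (p s)].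
Hypotheses (Vsat : saturated V) (Vse : @stably_embedded U V inl) (pA : range p = A).

Let eta_bij : bijective eta. Proof. by exists eta'. Qed.
Local Notation V2 := (associated_cover Q).

Definition to_star (x : elt V) : elt V2 :=
  match x with inl u => inl u | inr s => inr (eta s) end.
Definition of_star (x : elt V2) : elt V :=
  match x with inl u => inl u | inr y => inr (eta' y) end.

Lemma to_starK : cancel to_star of_star.
Proof. by case=> //= s; rewrite etaK. Qed.

Lemma of_starK : cancel of_star to_star.
Proof. by case=> //= s; rewrite eta'K. Qed.

Lemma of_star_sort (x : elt V2) : sort_of (of_star x) = sort_of x.
Proof. by case: x => //= y; case: (nsort_of _). Qed.

Lemma to_star_sort (x : elt V) : sort_of (s := V2) (to_star x) = sort_of x.
Proof. by rewrite -of_star_sort to_starK. Qed.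

Lemma of_star_surj s (y : elt V) : sort_of y = s ->
  exists2 x, sort_of (s := V2) x = s & of_star x = y.
Proof. by move=> ys; exists (to_star y); rewrite -?of_star_sort to_starK. Qed.

Lemma of_star_rel (r : Defs.rel V2) : definable (M := V) set0 (map id (arity r))
  [set t | exists2 xs, holds r xs & t = map of_star xs].
Proof.
rewrite map_id; case: r => [r|[w [D Dd]]].
  have := holds_definable (inl r : Defs.rel V); congr (definable (M := V)).
  rewrite (holds_inlE V r) (holds_inlE V2 r); apply/seteqP.
  split=> [_ [t ht <-]|_ [_ [t ht <-] ->]]; last by exists t => //; rewrite -map_comp.
  by exists (map inl t); [exists t|rewrite -map_comp].
have [phi phiP] := definable0_sat Dd.
have I := star_interpretation B eta_bij eta_p eta_triv p_definable.
have [psi psiP] := interpretation_sat I phi (map (star_embed_sort Q) w).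
(* [psi] is a formula of [V^eq] whose free variables all have real sorts, so its solution set
   descends to a 0-definable set of [V]. *)
pose D1 : set (tup (Meq V)) := [set x | typed (M := Meq V) (map inl w) x /\ sat x psi].
have D1d : definable (M := Meq V) set0 (map inl w) D1.
  split=> [x []//|]; exists psi, [::]; split=> [i x|t tw]; first by rewrite onth0n.
  by rewrite cats0; split=> [[]|].
have [_ D2d] := Meq_down (M := V) D1d.
split=> [_ [xs [xw _] ->]|].
  by rewrite /typed /= -map_comp (eq_map of_star_sort).
move: D2d => [chi [c [c0 chiP]]]; exists chi, c; split=> // t tw; rewrite -chiP //.
have embE (y : tup V) : List.Forall2 (star_code (Q := Q) G' eO new theta eta)
    (map (@star_embed _ _ _ _ Q) (map to_star y)) (map (@single _) (map inl y)).
  by elim: y => [|[u|s] y IH]; constructor=> //; exists s.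
have typE (y : tup V) : typed (M := V) w y ->
    typed (M := star_extension Q) (map (star_embed_sort Q) w)
      (map (@star_embed _ _ _ _ Q) (map to_star y)).
  by rewrite /typed /= => <-; rewrite -!map_comp; apply: eq_map => -[].
have {}tw : typed (M := V) w t := tw.
split=> [[xs [xw hx] te]|[_ [tw' S]]].
  split=> //; split; first by rewrite /typed /= -tw -!map_comp.
  have := psiP _ _ (typE t tw) (embE t); rewrite flatten_single => <-.
  apply/phiP; first exact: typE.
  by rewrite te -[map to_star _]map_comp (eq_map of_starK) map_id.
exists (map to_star t); last by rewrite -map_comp (eq_map to_starK) map_id.
split; first by rewrite /typed /= -[RHS]tw -map_comp; apply: eq_map => x; exact: to_star_sort.
apply/phiP; first exact: typE.
by apply/(psiP _ _ (typE t tw) (embE t)); rewrite flatten_single.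
Qed.

Let J := @join U V V2 eta.

Definition join_sort (s : sorts J) : sorts V :=
  match s with inl s => inl s | inr _ => inr tt end.
(** Both new sorts collapse onto [S]. The map is bijective from each sort onto its image sort, and
    identifies a point of the first new sort with its image under [eta] in the second. *)
Definition join_map (x : elt J) : elt V :=
  match x with
  | inl u => inl u
  | inr (inl s) => inr s
  | inr (inr y) => inr (eta' y)
  end.

Lemma join_map_sort x : sort_of (join_map x) = join_sort (sort_of x).
Proof. by case: x => [u|[s|y]] //=; case: (nsort_of _). Qed.

Lemma join_map_inj x y : sort_of x = sort_of y -> join_map x = join_map y -> x = y.
Proof.
case: x y => [u|[s|o]] [u'|[s'|o']] //= _ []; [by move=> ->|by move=> ->|].
by move=> /(can_inj eta'K) ->.
Qed.

Lemma join_map_surj s y : sort_of y = join_sort s -> exists2 x, sort_of x = s & join_map x = y.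
Proof.
case: s y => [s|[]] [u|z] //=.
- by move=> [us]; exists (inl u); rewrite //= us.
- by exists (inr (inr (eta z))); rewrite //= etaK.
- by exists (inr (inl z)).
Qed.

Lemma join_map_emb1 (x : elt V) : join_map (@join_emb1 U V V2 x) = x.
Proof. by case: x. Qed.

Lemma join_map_emb2 (x : elt V2) : join_map (@join_emb2 U V V2 x) = of_star x.
Proof. by case: x. Qed.

Lemma join_map_rel (r : Defs.rel J) : definable (M := V) set0 (map join_sort (arity r))
  [set t | exists2 xs, holds r xs & t = map join_map xs].
Proof.
have s1 w : map join_sort (map (@join_sort1 U V) w) = w.
  by rewrite -map_comp -[RHS]map_id; apply: eq_map => -[|[]].
have s2 w : map join_sort (map (@join_sort2 U V2) w) = w.
  by rewrite -map_comp -[RHS]map_id; apply: eq_map => -[|[]].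
case: r => [r|[[r|r]|[]]] /=.
- rewrite -map_comp; have := holds_definable (inl r : Defs.rel V).
  congr (definable (M := V)); rewrite (holds_inlE V r) (holds_inlE J r); apply/seteqP.
  split=> [_ [t ht <-]|_ [_ [t ht <-] ->]]; last by exists t => //; rewrite -map_comp.
  by exists (map inl t); [exists t|rewrite -map_comp].
- rewrite s1; have := holds_definable (inr r : Defs.rel V).
  congr (definable (M := V)); apply/seteqP; split=> [t [tr ht]|_ [xs [xr [x xe hx] ->]]].
    exists (map (@join_emb1 U V V2) t); last by rewrite -map_comp (eq_map join_map_emb1) map_id.
    split; last by exists t.
    apply: etrans (congr1 (map (@join_sort1 U V)) tr).
    by rewrite -!map_comp; apply: eq_map => -[].
  rewrite xe -map_comp (eq_map join_map_emb1) map_id; split=> //.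
  have := congr1 (map join_sort) xr; rewrite s1 xe => e; apply: etrans e.
  by rewrite -!map_comp; apply: eq_map => -[|s] //=; case: (nsort_of s).
- rewrite s2; have := of_star_rel (inr r); rewrite map_id.
  congr (definable (M := V)); apply/seteqP; split=> [_ [x [xr hx] ->]|_ [xs [xr [x xe hx] ->]]].
    exists (map (@join_emb2 U V V2) x); last by rewrite -map_comp; apply: eq_map => -[].
    split; last by exists x.
    apply: etrans (congr1 (map (@join_sort2 U V2)) xr).
    by rewrite -!map_comp; apply: eq_map => -[].
  exists x; last by rewrite xe -map_comp; apply: eq_map => -[].
  split=> //; have := congr1 (map join_sort) xr; rewrite s2 xe => e; apply: etrans e.
  by rewrite -!map_comp; apply: eq_map => -[].
- split=> [_ [_ [_ [s ->]] ->]|].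
    by rewrite /typed /= etaK; case: (nsort_of s).
  (* After the collapse the graph of [eta] is the diagonal of [S]. *)
  exists (Eq V 0 1), [::]; split=> [i x|t tw]; first by rewrite onth0n.
  rewrite cats0 /=; split=> [[xs [_ [s ->]] ->]|[x [x0 x1]]].
    by exists (inr s); rewrite /= etaK.
  case: t tw x0 x1 => [|[u|s] [|y [|? ?]]] //= _ [<-] [->].
  exists [:: inr (inl s); inr (inr (eta s))]; last by rewrite /= etaK.
  by split; last by exists s.
Qed.

(** [join_map] is at most two-to-one, so for infinite [V] the join has the cardinality of [V] and
    its types translate to types of [V] over small sets. For finite [V] the join is finite, hence
    saturated. *)
Lemma join_saturated : saturated J.
Proof.
have [Vf|Vinf] := pselect (finite_set [set: elt V]).
  apply: finite_saturated.
  have := finite_setX Vf (@finite_finset _ [set: bool]); apply: card_le_finite.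
  apply: (card_le_fun (f := fun x => (join_map x,
    match sort_of x with inl _ => false | inr b => b end))) => //.
  move=> x y _ _ [e1 e2]; apply: (join_map_inj _ e1); move: e1 e2.
  by case: x y => [u|[s|o]] [u'|[s'|o']] //= [-> _].
move=> C s Phi Csmall PhiC fin.
have /choice[tr trP] : forall f : {f | Phi f}, exists psi,
    forall e, typed (s :: map (@sort_of _) (sval f).2) e ->
      (sat e (sval f).1 <-> sat (map join_map e) psi).
  move=> f; exact: (map_interpretation join_map_sort join_map_inj join_map_surj join_map_rel).
have [|j v|l|v [vs vP]] := @saturated_family V (join_map @` C) (join_sort s) _
    (fun f : {f | Phi f} => (tr f, map join_map (sval f).2)) Vsat.
(* If [V] embedded in the image of the parameters, then so would the join, embedded in two copies of
   [V]; it would thus embed in [C]. *)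
- move=> VC; apply: Csmall; apply: card_le_trans _ (card_image_le join_map C).
  have VV := card_prod_bool (U := elt V) Vinf (card_lexx _).
  apply: card_le_trans _ (card_le_trans VV VC).
  apply: (card_le_fun (f := fun x => (join_map x,
    match sort_of x with inl _ => false | inr b => b end))) => //.
  move=> x y _ _ [e1 e2]; apply: (join_map_inj _ e1); move: e1 e2.
  by case: x y => [u|[s'|o]] [u'|[s''|o']] //= [-> _].
- move=> /List.in_map_iff[x [<- xj]]; exists x => //.
  by have /In_onth[i xi] := xj; exact: PhiC (svalP j) xi.
- have [||x [xs xP]] := fin [set f | exists2 j, List.In j l & sval j = f].
  + apply/finite_list; exists (map sval l); apply/seteqP; split=> f /=.
      by move=> [j jl <-]; exact: List.in_map.
    by move=> /List.in_map_iff[j [<- jl]]; exists j.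
  + by move=> _ [j _ <-]; exact: svalP.
  exists (join_map x); split; first by rewrite join_map_sort xs.
  move=> j jl; apply/(trP j (x :: (sval j).2)); first by rewrite -xs.
  by apply: xP; exists j.
have [x xs xv] := join_map_surj vs; exists x; split=> // f Pf.
have := vP (exist _ f Pf); rewrite /= -xv.
by move/(trP (exist _ f Pf) (x :: f.2)); apply; rewrite -xs.
Qed.

Definition new_elts (ys : seq (Ostar Q)) : tup (star_extension Q) :=
  map (fun y => inr (xO y)) ys.

Lemma wt_nseq (M : structure) (w : seq (sorts M)) (ts : seq (tup M)) :
  (forall t, List.In t ts -> typed w t) -> wt (nseq (size ts) w) ts.
Proof.
elim: ts => //= t ts IH H; rewrite /wt /= IH; last by move=> t' ?; apply: H; right.
by rewrite (H t (or_introl erefl)).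
Qed.

Lemma wt_app (M : structure) (W1 W2 : seq (seq (sorts M))) ts1 ts2 :
  wt W1 ts1 -> wt W2 ts2 -> wt (W1 ++ W2) (ts1 ++ ts2).
Proof. by rewrite /wt map_cat => -> ->. Qed.

(* The graphs xM f are compared through this projection, as the constructor xM
   is dependent. *)
Definition graph_of (x : elt (star_extension Q)) :
    option (tup U + Ostar Q -> tup U + Ostar Q -> Prop) :=
  match x with inr (xM _ f) => Some (sval f) | _ => None end.

(** One morphism from new to old points maps the [j]-th entry of [ys] to the [j]-th entry of [os],
    for all [j] at once. The morphism is quantified in the auxiliary sort [sM n], while the free
    variables have sorts of [C(G)]: this makes [D] one of the relations of [C(G)]. *)
Lemma common_hom_definable n k : exists2 D : set (tup (star_extension Q)),
  definable (M := star_extension Q) set0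
    (nseq k (inr sO) ++ flatten (nseq k (map inl (Ow (sgpd G n))))) D &
  forall ys os, size ys = k -> size os = k ->
    (forall o, List.In o os -> typed (Ow (sgpd G n)) o) ->
    (D (new_elts ys ++ map inl (flatten os)) <->
     exists2 f, star_hom (Q := Q) n f &
       forall j y o, onth ys j = Some y -> onth os j = Some o -> f (inr y) (inl o)).
Proof.
pose N := extend (star_extension Q).
pose ow : seq (sorts N) := map inl (Ow (sgpd G n)).
pose W : seq (seq (sorts N)) := nseq k [:: inr sO] ++ nseq k ow.
pose r : Defs.rel N := inr (rM n true false).
pose P (ts : seq (tup N)) := exists fm, typed (M := N) [:: inr (sM n)] fm /\
  forall j, List.In j (iota 0 k) ->
    holds r (fm ++ nth [::] ts j ++ nth [::] ts (k + j)).
have sW : size W = k + k by rewrite size_cat !size_nseq.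
have iotaP j : List.In j (iota 0 k) <-> j < k.
  have -> : List.In j (iota 0 k) <-> j \in iota 0 k.
    elim: (iota 0 k) => //= i l IH; rewrite inE; split=> [[->|/IH->]|/orP[/eqP->|/IH]];
      rewrite ?eqxx ?orbT; auto.
  by rewrite mem_iota.
have Pd : edef [::] W P.
  apply: (edef_ex (Q := fun ts fm => forall j, List.In j (iota 0 k) ->
    holds r (fm ++ nth [::] ts j ++ nth [::] ts (k + j)))).
  apply: edef_all_in => j /iotaP jk.
  have t1 : term [::] W (fun ts => nth [::] ts j) [:: inr sO].
    have := @term_nth N [::] W j; rewrite sW nth_cat size_nseq jk nth_nseq jk.
    by apply; rewrite ltn_addr.
  have t2 : term [::] W (fun ts => nth [::] ts (k + j)) ow.
    have := @term_nth N [::] W (k + j); rewrite sW nth_cat size_nseq.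
    by rewrite ifN -?leqNgt ?leq_addr // addKn nth_nseq jk ltn_add2l; apply.
  apply: edef_definable0 (holds_definable r) _.
  exact: term_cat (term_head _ _ _) (term_behead _ (term_cat t1 t2)).
have := edef_definable0I Pd.
have -> : flatten W = nseq k (inr sO) ++ flatten (nseq k ow).
  by rewrite flatten_cat; congr (_ ++ _); elim: (k) => //= i ->.
set D := mkset _ => Dd; exists D => // ys os sys sos osw.
pose ts0 : seq (tup N) := map (fun y => [:: inr (xO y)]) ys ++ map (map inl) os.
have ts0w : wt W ts0.
  apply: wt_app.
    rewrite -sys -(size_map (fun y => [:: inr (xO y)] : tup N) ys); apply: wt_nseq => t.
    by move=> /List.in_map_iff[y [<- _]].
  rewrite -sos -(size_map (map inl : tup U -> tup N) os); apply: wt_nseq => t.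
  by move=> /List.in_map_iff[o [<- /osw ow_]]; rewrite /typed /= /ow -ow_ -!map_comp.
have ts0f : new_elts ys ++ map inl (flatten os) = flatten ts0.
  rewrite flatten_cat; congr (_ ++ _); first by elim: (ys) => //= y l ->.
  by rewrite map_flatten.
rewrite ts0f; have -> : D (flatten ts0) <-> P ts0.
  by split=> [[ts [tsw /(wt_inj ts0w tsw) -> //]]|]; exists ts0.
have nth1 j y : onth ys j = Some y -> nth [::] ts0 j = [:: inr (xO y)].
  move=> yj; have jk : j < size ys by rewrite -onthTE yj.
  by rewrite nth_cat size_map jk (nth_map y) // (onth_nth _ _ _ _ yj).
have nth2 j o : onth os j = Some o -> nth [::] ts0 (k + j) = map inl o.
  move=> oj; have jk : j < size os by rewrite -onthTE oj.
  rewrite nth_cat size_map sys ifN -?leqNgt ?leq_addr // addKn (nth_map o) //.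
  by rewrite (onth_nth _ _ _ _ oj).
have onthk (T : Type) (l : seq T) j : size l = k -> j < k -> exists x, onth l j = Some x.
  by move=> lk jk; move: (onthTE l j); rewrite lk jk; case: onth => // x _; exists x.
split=> [[fm [fw fP]]|[f fh fP]].
  have [f fmE] : exists f : {f | star_hom (Q := Q) n f}, fm = [:: inr (xM f)].
    case: fm fw {fP} => [|[u|[y|n' f|n' m f]] [|? ?]] //= [nn]; subst n'; by exists f.
  exists (sval f); first exact: svalP.
  move=> j y o yj oj; have jk : j < k by rewrite -sys -onthTE yj.
  have [_ [g [x [z [e xn zn gxz]]]]] := fP j ((iotaP j).2 jk).
  move: e; rewrite fmE (nth1 _ _ yj) (nth2 _ _ oj) /= => e.
  have [fg] := congr1 (fun t => graph_of (head (inr (xM f)) t)) e; move: e.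
  case: x xn gxz => //= y' _ gxz [_ yy]; case: z zn gxz => //= o' _ gxz oo; move: gxz.
  have [-> -> ->] : [/\ sval f = sval g, y = y' & o = o'] => //.
  by split=> //; apply: inj_map oo => ? ? [].
exists [:: inr (xM (exist _ f fh))]; split=> // j /iotaP jk.
have [y yj] := onthk _ ys j sys jk; have [o oj] := onthk _ os j sos jk.
rewrite (nth1 _ _ yj) (nth2 _ _ oj); split.
  have oin : List.In o os by apply/In_onth; exists j.
  rewrite /typed /=; congr [:: _, _ & _]; apply: etrans (congr1 (map inl) (osw o oin)).
  by rewrite -!map_comp.
by exists (exist _ f fh), (inr y), (inl o); split=> //; exact: fP yj oj.
Qed.

(* An automorphism of C(G) over U agrees on each tuple of O_{*,c} with a morphism of the
   groupoid, which corresponds to an element of Aut(S_c / U). *)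
Lemma automorphism_over_holds rho (r : Defs.rel V) t : automorphism (M := V2) rho ->
  (forall u, rho (inl u) = inl u) -> holds r t ->
  holds r (map (fun x => of_star (rho (to_star x))) t).
Proof.
set rhoV := fun x => of_star (rho (to_star x)).
move=> rho_aut rhoU; have rhoVU u : rhoV (inl u) = inl u by rewrite /rhoV /= rhoU.
have [_ rho_sort rho_rel] := rho_aut.
have rhoVs s : exists s', rhoV (inr s) = inr s'.
  rewrite /rhoV /=; have := rho_sort (inr (eta s)).
  by case: (rho _) => //= y _; exists (eta' y).
case: r => [r|r] ht.
  have [_ [x tx _]] := ht; suff -> : map rhoV t = t by [].
  by rewrite tx -map_comp; apply: eq_map => u; exact: rhoVU.
(* Only the entries of [t] in the new sort can move; [c] will be the finite set of points of [A]
   below them. *)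
pose ss := pmap (fun x : elt V => if x is inr s then Some s else None) t.
have ssP s : List.In (inr s) t <-> List.In s ss.
  rewrite /ss; elim: (t) => //= -[u|s'] l IH /=; rewrite -?IH; first by split=> [[]|]; auto.
  by split=> -[[<-]|]; auto.
pose c : set (tup U) := [set p s | s in [set s | List.In s ss]].
(* If [t] has no new entries, [rho] fixes it. The case stands apart because groupoids exist only
   over non-empty sets. *)
have [ss0|ss0] := pselect (forall s, ~ List.In s ss).
  suff -> : map rhoV t = t by [].
  rewrite -[RHS]map_id; move: ssP; elim: (t) => //= -[u|s] l IH ssP /=.
    by rewrite rhoVU IH // => s; rewrite -ssP; split=> [?|[]//]; right.
  by have := ss0 s; rewrite -ssP; case; left.
have [n cn] : exists n, nsubsets A n.+1 c.
  apply: nsubsets_of_finite.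
  - by apply: finite_image; apply/finite_list; exists ss.
  - by move=> _ [s _ <-]; rewrite -pA; exists s.
  - by move: ss0 => /existsNP[s /contrapT sin]; exists (p s), s.
have ci := cobj_idx Q cn; have Nc := new_idx B cn; have Ec := eI_idx B ci.
have [h hh hE] := eta_triv cn.
have trivE s o : star_map c (eta s) o <-> to_triv G' eO new theta Q n c h s o by rewrite -hE.
have /is_bijectionE[Hin Htot _ Hfun Hinj] := trivialisation_bij B cn (eta_triv cn).
have /choice[y yP] : forall s, exists o, c (p s) -> star_map c (eta s) o.
  move=> s; have [cs|?] := pselect (c (p s)); last by exists [::].
  by have [o so] := Htot s cs; exists o.
have ssc s : List.In s ss -> c (p s) by exists s.
have sso s : List.In s ss -> star_map c (eta s) (y s) by move=> /ssc/yP.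
have [D Dd DP] := common_hom_definable n (size ss).
pose w0 : seq (sorts U + unit) := nseq (size ss) (inr tt) ++
  flatten (nseq (size ss) (map inl (Ow (sgpd G n)))).
have w0E : map (star_embed_sort Q) w0 = nseq (size ss) (inr sO) ++
    flatten (nseq (size ss) (map inl (Ow (sgpd G n)))).
  rewrite map_cat map_nseq map_flatten map_nseq; congr (_ ++ flatten (nseq _ _)).
  by rewrite -map_comp.
have Dd' : definable (M := star_extension Q) set0 (map (star_embed_sort Q) w0) D.
  by rewrite w0E.
pose r0 : Defs.rel V2 := inr (existT _ w0 (exist _ D Dd')).
have os_typed o : List.In o (map y ss) -> typed (Ow (sgpd G n)) o.
  move=> /List.in_map_iff[s [<- /sso/Hin[_ [Oo _]]]].
  exact: (Obj_definable (sgpd G n)).1.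
pose T : tup V2 := map (fun s => inr (eta s)) ss ++ map inl (flatten (map y ss)).
have T_emb (f : nelt V -> Ostar Q) :
    map (@star_embed _ _ _ _ Q) (map (fun s => inr (f s)) ss ++ map inl (flatten (map y ss))) =
    new_elts (map f ss) ++ map inl (flatten (map y ss)).
  by rewrite map_cat /new_elts -!map_comp.
have hT : holds r0 T.
  split.
    rewrite /typed /= map_cat /w0; congr (_ ++ _).
      by elim: (ss) => //= ? ? ->.
    elim: (ss) os_typed => //= s l IH os_typed; rewrite !map_cat IH; last first.
      by move=> o ?; apply: os_typed; right.
    congr (_ ++ _); rewrite -(os_typed (y s) (or_introl erefl)).
    by rewrite -!map_comp.
  rewrite /= T_emb; apply/DP; rewrite ?size_map //.
  (* The witness for [T] is the map [f_c] itself, composed with the identity of the chosen object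
     over [c]. *)
  exists (gcomp (gconv (to_under (Q := Q) n (inl (cobj Q c))))
      (gcomp (gid (object (sgpd G n) (cobj Q c))) (to_under n (inr c)))).
    by exists (inr c), (inl (cobj Q c)), (gid (object (sgpd G n) (cobj Q c))); split=> //=;
      exact: Hom_id.
  move=> j z o; rewrite !onth_map; case ej: (onth ss j) => [s|] //= [<-] [<-].
  have sin : List.In s ss by apply/In_onth; exists j.
  have so := sso s sin; have [_ os] := Hin _ _ so.
  exists (y s); last by split.
  by exists (y s).
have rhoT : map rho T = map (fun s => inr (eta (if rhoV (inr s) is inr s' then s' else s))) ss ++
    map inl (flatten (map y ss)).
  rewrite map_cat -!map_comp (eq_map (g := inl)) //; congr (_ ++ _).
  apply: eq_map => s /=; rewrite /rhoV /=; have := rho_sort (inr (eta s)).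
  by case: (rho _) => //= z _; rewrite eta'K.
(* As [rho] fixes the entries from [U], the relation for the image of [T] yields one morphism [f]
   sending each moved point to the old value [y s]. *)
have [_] := (rho_rel r0 T).2 hT; rewrite rhoT /= T_emb DP ?size_map //.
move=> [f [k [l [u [ki li _ uH ->]]]] fP].
have ssf s : List.In s ss -> exists s' o, [/\ rhoV (inr s) = inr s',
    to_under n k (inr (eta s')) o, u o (y s) & exists2 i, l = inl i & object (sgpd G n) i (y s)].
  move=> sin; have /In_onth[j sj] := sin; have [s' s'E] := rhoVs s.
  have := fP j (eta s') (y s); rewrite !onth_map sj /= s'E => /(_ erefl erefl).
  move=> [o' [o ko uo]]; rewrite /gconv /to_under; case: l {li uH fP} => // i [iy e].
  by exists s', o; split=> //; [rewrite e|exists i].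
have [s0 s0in] : exists s, List.In s ss by move/existsNP: ss0 => [s /contrapT]; exists s.
have [s0' [o0 [_ k0 _ [i le iy]]]] := ssf s0 s0in.
have [_ coy] := Hin _ _ (sso s0 s0in).
have ic : i = cobj Q c by exact: object_eq iy coy.
subst l i; case: k ki uH k0 ssf fP => [//|c'] /= c'n uH _ ssf _.
(* The domain of [f] is some new object over [c']; a morphism joins only objects over the same
   subset. *)
have cc : c' = c.
  have := (base_connected (g := sgpd G n) (cobj_idx Q c'n) ci).1 (ex_intro _ u uH).
  by rewrite !cobj_base.
subst c'.
pose obj := object (sgpd G n) (cobj Q c).
pose u' := gtransport obj obj (eO n) (eO n) u.
have u'H : Hom (sgpd G' n) (eI n (cobj Q c)) (eI n (cobj Q c)) u'.
  by rewrite (old_hom B) //; exists u.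
(* Both [s] and its moved point [s'] are compared in the chosen object: [h] takes [s] to [y s], the
   inverse of [u] takes this to the image of [s'], and the inverse of [h] returns to [s']. So [k]
   moves each entry as [rho] does. *)
pose k := gcomp (gconv h) (gcomp (gconv u') h).
have kH : Hom (sgpd G' n) (new c) (new c) k.
  apply: (Hom_comp Nc Ec Nc); last exact: (Hom_inv Nc Ec hh).
  exact: (Hom_comp Nc Ec Ec hh (Hom_inv Ec Ec u'H)).
pose kS := gtransport (object (sgpd G' n) (new c)) (object (sgpd G' n) (new c))
   (theta n) (theta n) k.
have kSE s : List.In s ss -> exists2 s', rhoV (inr s) = inr s' & kS s s'.
  move=> sin; have [s' [o [rs so uo _]]] := ssf s sin; exists s' => //.
  have [x [cx xs cy hx]] := (trivE _ _).1 (sso s sin).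
  have [x' [cx' x's co hx']] := (trivE _ _).1 so.
  exists x, x'; split=> //; exists (eO n o) => //; exists (eO n (y s)) => //.
  by exists o, (y s).
have : Aut_over p c kS by rewrite -(new_Aut B cn); exists k.
move=> [sg [sg_aut sgU sgk]]; have [_ _ sg_rel] := sg_aut.
have [tt ttE] : exists tt : tup (over_structure p c), map sval tt = t.
  by apply: sval_lift => -[//|s] /ssP /ssc.
(* A relation of [V] belongs to the structure induced on [U] and [S_c], and is therefore preserved
   by the automorphism [sg] attached to [kS]. *)
have hd : definable (params (V := V) c) (arity (inr r : Defs.rel V)) (holds (inr r : Defs.rel V)).
  exact: (definable_sub (@sub0set _ _) (holds_definable (inr r : Defs.rel V))).
pose r1 : Defs.rel (over_structure p c) := existT _ _ (exist _ _ hd).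
have htt : holds r1 tt.
  split; last by rewrite /= ttE.
  by case: ht => th _; rewrite /typed /= -[RHS]th -ttE -map_comp.
have [_] := (sg_rel r1 tt).2 htt; rewrite /= -map_comp => ht'.
suff -> : map rhoV t = map (sval \o sg) tt by [].
rewrite -ttE -map_comp; apply: List.map_ext_in => x xin /=.
have xt : List.In (sval x) t by rewrite -ttE; exact: List.in_map.
case ex: (sval x) => [v|s]; first by rewrite (sgU x v ex) ex rhoVU.
have [s' -> ks] : exists2 s', rhoV (inr s) = inr s' & kS s s'.
  by apply: kSE; apply/ssP; rewrite -ex.
have [x2 ex2 <-] := (sgk s s').1 ks.
by congr (sval (sg _)); apply: sval_injective; rewrite ex.
Qed.

(** Preservation is known in one direction only; applied to the inverse of [rho], which also fixes
    [U], it gives the equivalence. *)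
Lemma automorphism_over rho : automorphism (M := V2) rho ->
  (forall u, rho (inl u) = inl u) -> automorphism (fun x => of_star (rho (to_star x))).
Proof.
move=> ra rU; have [[rho' rK r'K] rs _] := ra.
have ra' := automorphism_inv ra rK r'K.
have r'U u : rho' (inl u) = inl u by rewrite -{1}(rU u) rK.
have K1 : cancel (fun x => of_star (rho (to_star x))) (fun x => of_star (rho' (to_star x))).
  by move=> x; rewrite of_starK rK to_starK.
have K2 : cancel (fun x => of_star (rho' (to_star x))) (fun x => of_star (rho (to_star x))).
  by move=> x; rewrite of_starK r'K to_starK.
split; first by exists (fun x => of_star (rho' (to_star x))).
  by move=> x; rewrite of_star_sort rs to_star_sort.
move=> r t; split=> h; last exact: automorphism_over_holds.
have := automorphism_over_holds ra' r'U h.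
by rewrite -map_comp (eq_map (g := id)) ?map_id.
Qed.

(* An automorphism of C(G) agrees on U with an automorphism of V, and two automorphisms
   with the same restriction to U differ by one of the previous lemma. *)
Lemma automorphism_of_star tau : automorphism (M := V2) tau ->
  automorphism (fun x => of_star (tau (to_star x))).
Proof.
move=> ta; have [tau0 t0a t0] := restrict_automorphism ta.
have [sigma sa s0] := Vse t0a.
(* [sigma2] is [sigma] carried to [C(G)], whose relations are 0-definable in [V]; [sigma2' \o tau]
   then fixes [U] pointwise. *)
have [|||sigma2 s2a s2] := @lift_automorphism V2 V id of_star _ _ _ of_star_rel sigma sa.
- exact: of_star_sort.
- by move=> x y _ /(can_inj of_starK).
- by move=> s y; exact: of_star_surj.
have [[sigma2' sK s'K] _ _] := s2a.
have s2'a := automorphism_inv s2a sK s'K.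
have rho_aut := automorphism_comp s2'a ta.
have s2U u : sigma2 (inl u) = inl (tau0 u).
  by apply: (can_inj of_starK); rewrite s2 s0.
have := automorphism_comp sa (automorphism_over rho_aut _).
have -> : (sigma \o fun x => of_star ((sigma2' \o tau) (to_star x))) =
    (fun x => of_star (tau (to_star x))).
  by apply: funext => x; rewrite /= -s2 s'K.
by apply=> u /=; rewrite t0 -s2U sK.
Qed.

(** Automorphisms of [V] lift to the join along [join_map]. For [C(G)] an automorphism is first
    turned into one of [V] by [automorphism_of_star]; injectivity of [join_map] within a sort shows
    that the lift extends the given automorphism. *)
Theorem eta_isomorphism : cover_isomorphism (V2 := V2) p (@star_proj U Aw A G Q) eta.
Proof.
have lift tau : automorphism (M := V) tau ->
    exists2 sigma, automorphism (M := J) sigma & forall x, join_map (sigma x) = tau (join_map x).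
  exact: (lift_automorphism join_map_sort join_map_inj join_map_surj join_map_rel).
split=> //; split=> //; split; try exact: join_saturated.
  move=> tau ta; have [sigma sa sE] := lift tau ta; exists sigma => // x.
  have [_ ss _] := sa; have [_ ts _] := ta.
  apply: join_map_inj; last by rewrite sE !join_map_emb1.
  have e1 (z : elt V) : sort_of (s := J) (@join_emb1 U V V2 z) = join_sort1 (sort_of z) by case: z.
  by rewrite ss !e1 ts.
move=> tau ta; have [sigma sa sE] := lift _ (automorphism_of_star ta); exists sigma => // x.
have [_ ss _] := sa; have [_ ts _] := ta.
apply: join_map_inj; last by rewrite sE !join_map_emb2 of_starK.
have e2 (z : elt V2) : sort_of (s := J) (@join_emb2 U V V2 z) = join_sort2 (sort_of z) by case: z.
by rewrite ss !e2 ts.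
Qed.

End Main.

Unset Implicit Arguments.

Theorem theorem4p31
  (U : structure) (U_sat : saturated U) (U_EI : eliminates_imaginaries U)
  (Aw : seq (sorts U)) (A : set (tup U)) (A_def : definable set0 Aw A)
  (V : extension U unit) (p : nelt V -> tup U)
  (V_cover : @is_cover U V inl) (V_analysable : one_analysable Aw A p)
  (V_ufg : uniformly_finitely_generated Aw A p)
  (V_lse : locally_stably_embedded A p)
  (G : simplicial_groupoid Aw A) (G_binding : is_binding p G)
  (Q : commuting_system G) :
  exists eta : nelt V -> nelt (associated_cover Q),
    cover_isomorphism (V2 := associated_cover Q) p (@star_proj U Aw A G Q) eta.
Proof.
have [Vsat Vse] := V_cover; have [pA pdef _] := V_analysable.
have [G' [eO [eI [new [theta B]]]]] := G_binding.
have [eta [[eta' etaK eta'K] eta_p eta_triv]] := trivialising_map_exists B Q Vsat pA.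
by exists eta; apply: (eta_isomorphism B etaK eta'K eta_p eta_triv pdef Vsat Vse pA).
Qed.
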